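(* Define the matrices $$A=\begin{pmatrix}-2&3\\4&-3\end{pmatrix},\quad B=\begin{pmatrix}-1&2\\3&-2\end{pmatrix},\quad C=\begin{pmatrix}-1&2\\2&-1\end{pmatrix},\quad D=\begin{pmatrix}-1&3\\3&-1\end{pmatrix},\quad E=\begin{pmatrix}-1&3\\5&-3\end{pmatrix},\quad F=\begin{pmatrix}-1&4\\5&-2\end{pmatrix}.$$ All balanced $2\times2$ urns with subtraction of balance $s=1$ (cases $A$, $B$ and $C$, up to exchanging the two colors) are elliptic. All arithmetically irreducible balanced $2\times 2$ urns with subtraction of balance $s=2$ (cases $D$, $E$, up to exchanging the two colors) are also elliptic. There exists one sporadic urn of balance $s=3$ (case $F$, up to exchanging the two colors) that is elliptic. These six matrices represent (up to exchanging the two colors) the only arithmetically irreducible models of balanced $2\times 2$ urns with subtraction that are elliptic.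
   Context: A balanced $2\times2$ urn with subtraction is an urn model with matrix $\begin{pmatrix}-a&a+s\\ b+s&-b\end{pmatrix}$, where $a,b,s$ are positive integers ($s$ is the balance): at each step a uniformly random ball is drawn, observed and put back; if it is of the first color, $a$ balls of the first color are removed and $a+s$ of the second are added; if it is of the second color, $b+s$ balls of the first color are added and $b$ of the second are removed. Exchanging the two colors exchanges $a$ and $b$. Urns are always assumed tenable: $a$ divides $b+s$ and $b$ divides $a+s$, and the initial numbers $(a_0,b_0)$ of balls of the two colors satisfy $a\mid a_0$, $b\mid b_0$, with $t_0:=a_0+b_0\ge1$. Put $h=a+b+s$, $\delta(u)=(1-u^h)^{1/h}$ (with $\delta(0)=1$), $I(u)=\int_0^u t^{a-1}\delta(t)^{-(a+b)}dt$. The fundamental function $\psi$ of the urn with initial conditions $(a_0,b_0)$ is the function analytic near $0$ defined implicitly by $\psi(I(u))=u^{a_0}/\delta(u)^{t_0}$ for $u$ near $0$. The urn is called elliptic if, for some choice of initial conditions $(a_0,b_0)$, the function $\psi$ is a fractional power of an elliptic function: $\psi(z)=\Pi(z;\Lambda)^{p/q}$, where $p/q$ is a nonzero rational and $\Pi(\cdot;\Lambda)$ is meromorphic in $\mathbb{C}$ and admits a period lattice $\Lambda$. The model is arithmetically irreducible if the four entries of its matrix have greatest common divisor $1$.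
   Formalization: The last claim (the six matrices are the only irreducible elliptic models) is proved with one exception: the urn with rows (-1,5),(5,-1), balance 4, started with a0=b0, where psi'^2=1+4psi^6 for a0=b0=1, so psi is a square root of an elliptic function. *)

(* Defs.v *)
From Stdlib Require Import Reals ZArith Arith List.
From Coquelicot Require Import Coquelicot.

Import ListNotations.

Definition mat2 : Type := ((Z * Z) * (Z * Z))%type.

Definition urn_matrix (a b s : nat) : mat2 :=
  ((- Z.of_nat a, Z.of_nat (a + s)), (Z.of_nat (b + s), - Z.of_nat b))%Z.

Definition exchange_colors (M : mat2) : mat2 :=
  let '((x, y), (z, t)) := M in ((t, z), (y, x)).

Definition represented (M : mat2) (Ms : list mat2) : Prop :=
  In M Ms \/ In (exchange_colors M) Ms.

Definition tenable (a b s : nat) : Prop :=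
  (0 < a)%nat /\ (0 < b)%nat /\ (0 < s)%nat /\
  Nat.divide a (b + s) /\ Nat.divide b (a + s).

Definition tenable_init (a b a0 b0 : nat) : Prop :=
  Nat.divide a a0 /\ Nat.divide b b0 /\ (1 <= a0 + b0)%nat.

Definition arith_irreducible (M : mat2) : Prop :=
  let '((x, y), (z, t)) := M in Z.gcd (Z.gcd x y) (Z.gcd z t) = 1%Z.

Open Scope C_scope.

(* Principal [h]-th root on the half-plane [Re z > 0], where [Arg z] is
   [atan (Im z / Re z)]; its value at [1] is [1]. *)
Definition root_right (h : nat) (z : C) : C :=
  let r := Rpower (Cmod z) (/ INR h) in
  let theta := Rdiv (atan (Rdiv (Im z) (Re z))) (INR h) in
  (Rmult r (cos theta), Rmult r (sin theta)).

(* For [|u| < 1] the number [1 - u^h] lies in the half-plane [Re > 0]. *)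
Definition delta (h : nat) (u : C) : C := root_right h (1 - u ^ h).

(* Integral of [f] along the segment from [0] to [u]. *)
Definition segment_integral (f : C -> C) (u : C) : C :=
  RInt (V := C_R_CompleteNormedModule)
    (fun x : R => u * f (RtoC x * u)) 0%R 1%R.

Definition urn_integral (a b s : nat) (u : C) : C :=
  let h := (a + b + s)%nat in
  segment_integral (fun t => t ^ (a - 1) / delta h t ^ (a + b)) u.

Definition holomorphic_near (f : C -> C) (z0 : C) : Prop :=
  locally z0 (fun z : C => ex_derive f z).

Definition fundamental_function (a b s a0 b0 : nat) (psi : C -> C) : Prop :=
  let h := (a + b + s)%nat in
  holomorphic_near psi 0 /\
  locally (RtoC 0) (fun u : C =>
    psi (urn_integral a b s u) = u ^ a0 / delta h u ^ (a0 + b0)).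

(* Values at the poles are irrelevant, hence the punctured neighbourhood. *)
Definition meromorphic (f : C -> C) : Prop :=
  forall z0 : C, exists (n : nat) (g : C -> C),
    holomorphic_near g z0 /\
    locally z0 (fun z : C => z <> z0 -> f z = g z / (z - z0) ^ n).

Definition period (f : C -> C) (w : C) : Prop :=
  forall z : C, f (z + w) = f z.

(* A lattice is [Z w1 + Z w2] with [w1, w2] linearly independent over [R]. *)
Definition elliptic_function (f : C -> C) : Prop :=
  meromorphic f /\
  exists w1 w2 : C,
    (forall x y : R, RtoC x * w1 + RtoC y * w2 = 0 -> x = 0%R /\ y = 0%R) /\
    period f w1 /\ period f w2.

Definition CpowZ (z : C) (p : Z) : C :=
  match p with
  | Z0 => 1
  | Zpos n => z ^ Pos.to_nat n
  | Zneg n => / (z ^ Pos.to_nat n)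
  end.

(* [psi = Pi^(p/q)] for a branch of the power means [psi^q = Pi^p]; the point
   [0] is excluded because [Pi] may have a pole there. *)
Definition fractional_power_of_elliptic (psi : C -> C) : Prop :=
  exists (Pi : C -> C) (p : Z) (q : nat),
    elliptic_function Pi /\ p <> 0%Z /\ (0 < q)%nat /\
    locally (RtoC 0) (fun z : C => z <> RtoC 0 -> psi z ^ q = CpowZ (Pi z) p).

Definition elliptic_from (a b s a0 b0 : nat) : Prop :=
  exists psi : C -> C,
    fundamental_function a b s a0 b0 psi /\ fractional_power_of_elliptic psi.

Definition elliptic_urn (a b s : nat) : Prop :=
  exists a0 b0 : nat, tenable_init a b a0 b0 /\ elliptic_from a b s a0 b0.

Close Scope C_scope.

Definition matA : mat2 := ((-2, 3), (4, -3))%Z.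
Definition matB : mat2 := ((-1, 2), (3, -2))%Z.
Definition matC : mat2 := ((-1, 2), (2, -1))%Z.
Definition matD : mat2 := ((-1, 3), (3, -1))%Z.
Definition matE : mat2 := ((-1, 3), (5, -3))%Z.
Definition matF : mat2 := ((-1, 4), (5, -2))%Z.

(* The urn [(a, b, s) = (1, 1, 4)], which the classification has to set apart
   when it is started with equally many balls of both colors.  For
   [a0 = b0 = 1] one has [psi (I u) = u (1 - u^6)^(-1/3)] and
   [I' u = (1 - u^6)^(-1/3)], hence
     [psi' (I u) = (1 + u^6) / (1 - u^6)]  and  [psi'^2 = 1 + 4 psi^6].
   So [Y = psi^2] solves [Y'^2 = 4 Y + 16 Y^4] and is an elliptic function: [psi]
   is the power [1/2] of an elliptic function, and this irreducible urn is
   elliptic although it is not one of [matA], ..., [matF].  For [a0 <> b0] this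
   urn gives no fractional power of an elliptic function. *)
Definition matG : mat2 := ((-1, 5), (5, -1))%Z.

(* Main.v *)
Require Import Defs.
From Stdlib Require Import Reals ZArith Arith List.
From Coquelicot Require Import Coquelicot.
From Stdlib Require Import Lra Lia Psatz Classical ClassicalEpsilon FunctionalExtensionality.
Import ListNotations.

(** Why the theorem is true.

  The map [I] is a Schwarz-Christoffel map: it sends a sector of the unit disc
  to a piece of a triangle with angles [a pi / h], [s pi / h] and [b pi / h], the
  second one at the image of [u = 1], where [psi] is infinite. Tenability says
  that [a] and [b] divide [h]. The heart of the matter is that an elliptic urn
  has also [s] dividing [h], with one family of exceptions: the three angles are
  then unit fractions of [pi], the triangle tiles the plane by reflections, and
  there are only ten triples without common factor, those of the six matrices
  and of their exchanges ([euclidean_triangles]).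

  Necessity. Suppose that [psi^q = M] near [0] with [M] meromorphic. With the
  coordinate [w = delta u], the side of the triangle that ends at the pole is
  described by [z = z1 - L w], where [L] is the integral [I] of the urn with the
  parameters [s], [b], [a] ([dual_integral]); there [psi] is
  [Psi w = delta w ^ a0 / w ^ t0]. The identity theorem propagates the equation
  [M (z1 - L w) = Psi w ^ q] along the side to a punctured neighbourhood of
  [w = 0] ([equation_at_corner]). Since functions are only assumed to be
  differentiable, the identity theorem is derived from the start, through the
  theorem of Goursat, a primitive on a disc, the formula of Cauchy and Taylor
  expansions.

  Hence the logarithmic derivative
  [ell = (t0 - b0 X) / (w^s delta w ^ a)], [X = w^h], of [Psi] with respect to
  [- L] is a meromorphic function of [L] at [0], with a simple pole
  ([key_relation]). Differentiating once more,
  [(d ell / dL) / ell^2] is a holomorphic function of [L], but it is also a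
  rational function of [X]. As [L w = w^s / s + ...], a function of [L] vanishes
  in [w] to an order divisible by [s], so [s] divides [h] as soon as the first
  power of [X] occurs. It does not occur exactly if [b0 (b + s) = a0 (a + s)];
  the coefficient of [X^2] and that of another invariant at [X^3] then give
  [s] dividing [2 h], and [s] dividing [h] unless [a0 = b0], which forces
  [a = b] ([urn_arithmetic]). Then [a = b = 1] by irreducibility and [s]
  divides [4]: the only new urn is the one of [matG].

  Sufficiency. For each of the ten triples and a suitable choice of initial
  numbers, [psi] is a rational function of a monomial [v] in [u] and [delta u]
  that satisfies [v'' = c0 + c2 v^2 + c3 v^3] with constants [c0], [c2], [c3], as
  a function of [z = I u] ([elliptic_case]). The same initial value problem has a solution that is meromorphic in the plane and doubly
  periodic: a Moebius transform of a rescaled translate of Jacobi's [cn], with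
  parameter [(2 + sqrt 3) / 4] (hexagonal lattice) or [1 / 2] (square lattice)
  ([hexagonal_solution], [square_solution]). The two agree near [0] because the
  difference satisfies a linear system and vanishes with its derivative
  ([linear_system_unique]).

  The function [cn] is built from the real one, the cosine of the inverse of an
  elliptic integral, by the addition theorem and Jacobi's imaginary
  transformation: this gives explicit real and imaginary parts, the
  Cauchy-Riemann equations are polynomial identities, one period is real and
  the other one imaginary, and the poles are the zeros of the analogous function
  for the complementary parameter at [- i z] ([jacobi_cn]). *)

Set Bullet Behavior "Strict Subproofs".
Open Scope C_scope.

(** * Derivatives and continuity on the complex plane *)

Definition cder (f : C -> C) (z l : C) : Prop :=
  is_derive (K := C_AbsRing) (V := C_NormedModule) f z l.
Definition cex (f : C -> C) (z : C) : Prop := exists l : C, cder f z l.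
Definition rder (f : R -> C) (t : R) (l : C) : Prop :=
  is_derive (K := R_AbsRing) (V := C_R_NormedModule) f t l.
Definition cont (f : C -> C) (z : C) : Prop :=
  continuous (T := C_UniformSpace) (U := C_UniformSpace) f z.
Definition rcont (f : R -> C) (t : R) : Prop :=
  continuous (T := R_UniformSpace) (U := C_UniformSpace) f t.

Definition disc (c : C) (r : R) (w : C) : Prop := (Cmod (w - c) < r)%R.

Lemma locally_disc (z : C) (P : C -> Prop) :
  locally z P <-> exists r : R, (0 < r)%R /\ forall w : C, disc z r w -> P w.
Proof.
split.
- intros [e H]. exists e. split; [apply cond_pos|]. intros w Hw. apply H.
  apply C_NormedModule_mixin_compat1. exact Hw.
- intros [r [Hr H]].
  assert (Hs : (0 < sqrt 2)%R) by (apply sqrt_lt_R0; lra).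
  exists (mkposreal _ (Rdiv_lt_0_compat _ _ Hr Hs)). intros w Hw. apply H.
  pose proof (C_NormedModule_mixin_compat2 _ _ _ Hw) as H1. simpl in H1.
  eapply Rlt_le_trans. exact H1. right. field. lra.
Qed.

Lemma Rmin_def (x a b : R) : (x < Rmin a b)%R -> (x < a)%R /\ (x < b)%R.
Proof. intros H. pose proof (Rmin_l a b). pose proof (Rmin_r a b). lra. Qed.

Lemma cder_eps (f : C -> C) (z l : C) :
  cder f z l <-> forall eps : R, (0 < eps)%R -> exists r : R, (0 < r)%R /\
    forall w : C, disc z r w -> (Cmod (f w - f z - (w - z) * l) <= eps * Cmod (w - z))%R.
Proof.
split.
- intros [_ H] eps He. specialize (H z (fun P HP => HP) (mkposreal eps He)).
  apply locally_C, locally_disc in H. exact H.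
- intros H. split. { apply is_linear_scal_l. }
  intros x Hx. assert (x = z) as ->.
  { symmetry. apply is_filter_lim_locally_unique. exact Hx. }
  intros eps. apply locally_C, locally_disc. exact (H eps (cond_pos eps)).
Qed.

Lemma cder_eq (f : C -> C) (z l l' : C) : cder f z l -> l = l' -> cder f z l'.
Proof. intros H <-; exact H. Qed.

Lemma rder_eq (f : R -> C) t l l' : rder f t l -> l = l' -> rder f t l'.
Proof. intros H <-; exact H. Qed.

Lemma cder_unique (f : C -> C) (z l l' : C) : cder f z l -> cder f z l' -> l = l'.
Proof.
intros H1 H2. rewrite <- (is_C_derive_unique f z l H1). apply is_C_derive_unique; exact H2.
Qed.

Lemma cder_ext (f g : C -> C) (z l : C) : locally z (fun w : C => f w = g w) -> cder f z l -> cder g z l.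
Proof. intros H. apply is_derive_ext_loc, locally_C, H. Qed.

Lemma cder_const (c z : C) : cder (fun _ => c) z 0.
Proof. exact (is_derive_const (K := C_AbsRing) (V := C_NormedModule) c z). Qed.

(** The field seen as a one-dimensional space over itself has the norm of the
  plane but another uniform structure; the domination in the definition of the
  derivative only sees the norm. *)
Lemma cder_ring (f : C -> C) (z l : C) :
  cder f z l <-> is_derive (K := C_AbsRing) (V := AbsRing_NormedModule C_AbsRing) f z l.
Proof. split; (intros [_ H]; split; [apply is_linear_scal_l | exact H]). Qed.

Lemma cder_id (z : C) : cder (fun w => w) z 1.
Proof. apply cder_ring. exact (is_derive_id (K := C_AbsRing) z). Qed.

Lemma cder_plus (f g : C -> C) (z df dg : C) :
  cder f z df -> cder g z dg -> cder (fun w => f w + g w) z (df + dg).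
Proof. exact (is_derive_plus (K := C_AbsRing) (V := C_NormedModule) f g z df dg). Qed.

Lemma cder_opp (f : C -> C) (z df : C) : cder f z df -> cder (fun w => - f w) z (- df).
Proof. exact (is_derive_opp (K := C_AbsRing) (V := C_NormedModule) f z df). Qed.

Lemma cder_minus (f g : C -> C) (z df dg : C) :
  cder f z df -> cder g z dg -> cder (fun w => f w - g w) z (df - dg).
Proof. exact (is_derive_minus (K := C_AbsRing) (V := C_NormedModule) f g z df dg). Qed.

Lemma cder_comp (f g : C -> C) (z df dg : C) :
  cder f (g z) df -> cder g z dg -> cder (fun w => f (g w)) z (df * dg).
Proof.
intros H1 H2. rewrite Cmult_comm.
exact (is_derive_comp (K := C_AbsRing) (V := C_NormedModule) f g z df dg H1 (proj1 (cder_ring g z dg) H2)).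
Qed.

Lemma cder_mult (f g : C -> C) (z df dg : C) :
  cder f z df -> cder g z dg -> cder (fun w => f w * g w) z (df * g z + f z * dg).
Proof.
intros H1 H2. apply cder_ring in H1, H2. apply cder_ring.
exact (is_derive_mult (K := C_AbsRing) f g z df dg H1 H2 Cmult_comm).
Qed.

Lemma Cmod_sym (x y : C) : Cmod (x - y) = Cmod (y - x).
Proof. rewrite <- Cmod_opp. f_equal. ring. Qed.

Lemma cder_inv_id (z : C) : z <> 0 -> cder (fun w => / w) z (- / (z * z)).
Proof.
intros Hz. apply cder_eps. intros eps He.
pose proof (proj1 (Cmod_gt_0 z) Hz) as Hm. set (m := Cmod z) in *.
exists (Rmin (m / 2) (eps * (m * m * m) / 2)). split.
{ apply Rmin_glb_lt. lra. repeat apply Rmult_lt_0_compat; lra. }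
intros w Hw. apply Rmin_def in Hw. destruct Hw as [Hw1 Hw2].
assert (Hmw : (m / 2 <= Cmod w)%R).
{ rewrite Cmod_sym in Hw1. assert (H := Cmod_triangle w (z - w)). replace (w + (z - w)) with z in H by ring.
  fold m in H. lra. }
assert (Hwn : w <> 0). { apply Cmod_gt_0. lra. }
replace (/ w - / z - (w - z) * - / (z * z)) with ((w - z) * (w - z) / (w * (z * z))) by (field; auto).
rewrite Cmod_div, !Cmod_mult by (repeat apply Cmult_neq_0; auto).
fold m. set (x := Cmod (w - z)) in *. assert (0 <= x)%R by apply Cmod_ge_0.
assert (0 < m * m)%R by nra. assert (Hp : (0 < Cmod w * (m * m))%R) by nra.
apply (Rmult_le_reg_r (Cmod w * (m * m))); auto.
unfold Rdiv at 1. rewrite Rmult_assoc, Rinv_l, Rmult_1_r by lra.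
rewrite (Rmult_comm eps x), !Rmult_assoc. apply Rmult_le_compat_l; auto.
apply Rle_trans with (eps * ((m / 2) * (m * m)))%R. lra.
apply Rmult_le_compat_l. lra. apply Rmult_le_compat_r; lra.
Qed.

Lemma cder_inv (f : C -> C) (z df : C) :
  cder f z df -> f z <> 0 -> cder (fun w => / f w) z (- df / (f z * f z)).
Proof.
intros H Hn. eapply cder_eq. apply (cder_comp (fun w => / w) f). apply cder_inv_id; eauto. exact H.
cbv beta. field; auto.
Qed.

Lemma cder_div (f g : C -> C) (z df dg : C) :
  cder f z df -> cder g z dg -> g z <> 0 ->
  cder (fun w => f w / g w) z ((df * g z - f z * dg) / (g z * g z)).
Proof.
intros H1 H2 Hn. eapply cder_eq. apply cder_mult. exact H1. apply cder_inv; eauto.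
cbv beta. field; auto.
Qed.

Lemma cder_pow (f : C -> C) (z df : C) (n : nat) :
  cder f z df -> cder (fun w => f w ^ n) z (RtoC (INR n) * f z ^ (n - 1) * df).
Proof.
intros H. induction n as [|n IH].
- simpl. eapply cder_eq. apply cder_const. ring.
- eapply cder_eq. exact (cder_mult f (fun w => f w ^ n) z _ _ H IH).
  replace (S n - 1)%nat with n by lia. rewrite S_INR, RtoC_plus.
  cbv beta. destruct n as [|n]; simpl Cpow; [simpl; ring|]. rewrite Nat.sub_0_r. ring.
Qed.

Ltac cderiv :=
  lazymatch goal with
  | |- cder (fun w => w) _ _ => apply cder_id
  | |- cder (fun _ => ?c) _ _ => apply (cder_const c)
  | |- cder (fun w => @?f w + @?g w) _ _ => apply (cder_plus f g); cderiv
  | |- cder (fun w => @?f w - @?g w) _ _ => apply (cder_minus f g); cderiv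
  | |- cder (fun w => - @?f w) _ _ => apply (cder_opp f); cderiv
  | |- cder (fun w => @?f w * @?g w) _ _ => apply (cder_mult f g); cderiv
  | |- cder (fun w => @?f w / @?g w) _ _ => apply (cder_div f g); [cderiv | cderiv | ]
  | |- cder (fun w => / @?f w) _ _ => apply (cder_inv f); [cderiv | ]
  | |- cder (fun w => @?f w ^ ?n) _ _ => apply (cder_pow f); cderiv
  | |- cder _ _ _ => try eassumption
  end.

Lemma cont_eps (f : C -> C) (z : C) :
  cont f z <-> forall eps : R, (0 < eps)%R -> exists r : R, (0 < r)%R /\
    forall w : C, disc z r w -> disc (f z) eps (f w).
Proof.
split.
- intros H eps He. apply locally_disc. apply (H (disc (f z) eps)). apply locally_disc. eauto.
- intros H P HP. apply locally_disc in HP. destruct HP as [e [He HP]].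
  destruct (H e He) as [r [Hr H']]. apply locally_disc. exists r; split; auto.
Qed.

Lemma cder_cont (f : C -> C) (z l : C) : cder f z l -> cont f z.
Proof.
intros H P HP. apply locally_C.
exact (ex_derive_continuous (K := C_AbsRing) (V := C_NormedModule) f z (ex_intro _ l H) P HP).
Qed.

Lemma cex_cont (f : C -> C) (z : C) : cex f z -> cont f z.
Proof. intros [l H]. eapply cder_cont; eauto. Qed.

Lemma Cmult_continuous (a b : C) :
  filterlim (fun p : C * C => fst p * snd p) (filter_prod (locally a) (locally b)) (locally (a * b)).
Proof.
intros P HP. apply locally_C in HP. destruct (filterlim_mult (K := C_AbsRing) a b P HP) as [Q S HQ HS H].
exists Q S; auto; apply locally_C; auto.
Qed.

Lemma cont_mult (f g : C -> C) z : cont f z -> cont g z -> cont (fun w => f w * g w) z.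
Proof. intros H1 H2. exact (filterlim_comp_2 _ _ Cmult H1 H2 (Cmult_continuous _ _)). Qed.

Lemma cont_minus (f g : C -> C) z : cont f z -> cont g z -> cont (fun w => f w - g w) z.
Proof. exact (continuous_minus (K := C_AbsRing) (V := C_NormedModule) f g z). Qed.

Lemma rcont_mult (f g : R -> C) t : rcont f t -> rcont g t -> rcont (fun s => f s * g s) t.
Proof. intros H1 H2. exact (filterlim_comp_2 _ _ Cmult H1 H2 (Cmult_continuous _ _)). Qed.

Lemma rcont_comp (f : C -> C) (g : R -> C) t : cont f (g t) -> rcont g t -> rcont (fun s => f (g s)) t.
Proof. intros H1 H2. apply (continuous_comp g f); assumption. Qed.

Definition rc (f : C -> R) (z : C) : Prop := continuous (T := C_UniformSpace) (U := R_UniformSpace) f z.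

Lemma rc_const k z : rc (fun _ => k) z.
Proof. apply continuous_const. Qed.

Lemma rc_fst z : rc fst z.
Proof. destruct z as [x y]. apply continuous_fst. Qed.

Lemma rc_snd z : rc snd z.
Proof. destruct z as [x y]. apply continuous_snd. Qed.

Lemma rc_Cmod z : rc Cmod z.
Proof.
intros P [e He]. apply locally_disc. exists e. split. apply cond_pos.
intros w Hw. apply He. unfold ball; simpl. unfold AbsRing_ball, abs, minus, plus, opp; simpl.
assert (T1 := Cmod_triangle (w - z) z). assert (T2 := Cmod_triangle (z - w) w). unfold disc in Hw.
rewrite (Cmod_sym z w) in T2. replace (w - z + z) with w in T1 by ring. replace (z - w + w) with z in T2 by ring.
apply Rabs_lt_between. lra.
Qed.

Lemma rc_mult f g z : rc f z -> rc g z -> rc (fun w => f w * g w)%R z.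
Proof. exact (continuous_mult (K := R_AbsRing) f g z). Qed.

Lemma rc_minus f g z : rc f z -> rc g z -> rc (fun w => f w - g w)%R z.
Proof. exact (continuous_minus (K := R_AbsRing) (V := R_NormedModule) f g z). Qed.

Lemma rc_comp (f : R -> R) (g : C -> R) z : rc g z -> ex_derive f (g z) -> rc (fun w => f (g w)) z.
Proof.
intros Hg Hf. apply (continuous_comp (U := C_UniformSpace) (V := R_UniformSpace) (W := R_UniformSpace) g f); auto.
exact (ex_derive_continuous (K := R_AbsRing) (V := R_NormedModule) f (g z) Hf).
Qed.

Lemma cont_pair (f g : C -> R) (z : C) : rc f z -> rc g z -> cont (fun w => (f w, g w)) z.
Proof.
intros Hf Hg. apply (continuous_comp_2 (U := C_UniformSpace) (V := R_UniformSpace) (W := R_UniformSpace)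
  (X := C_UniformSpace) f g (fun x y => (x, y)) z Hf Hg).
intros P HP. unfold filtermap. eapply filter_imp; [|exact HP]. intros [x y]; auto.
Qed.

(** * Paths and integrals along paths *)

Lemma normCR (z : C) : norm (K := R_AbsRing) (V := C_R_NormedModule) z = Cmod z.
Proof.
unfold norm; simpl. unfold prod_norm. unfold norm; simpl. unfold abs; simpl.
unfold Cmod. f_equal. rewrite !Rmult_1_r, <- !Rabs_mult. rewrite !Rabs_pos_eq; nra.
Qed.

Lemma rder_cont (f : R -> C) t l : rder f t l -> rcont f t.
Proof.
intros H. apply (ex_derive_continuous (K := R_AbsRing) (V := C_R_NormedModule) f t). exists l; exact H.
Qed.

Lemma rder_pair (f g : R -> R) (t df dg : R) :
  is_derive f t df -> is_derive g t dg -> rder (fun s => (f s, g s)) t (df, dg).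
Proof.
intros H1 H2.
assert (H := filterdiff_comp_2 (K := R_AbsRing) f g (fun x y => (x, y)) _ _ (fun x y => (x, y)) H1 H2).
cbv beta in H. unfold rder, is_derive. eapply filterdiff_ext_lin; [apply H|]; [|reflexivity].
apply (filterdiff_linear (K := R_AbsRing) (U := prod_NormedModule R_AbsRing R_NormedModule R_NormedModule)
  (V := C_R_NormedModule) (fun p => (fst p, snd p))).
apply (is_linear_ext (K := R_AbsRing) (fun p => p)). intros []; reflexivity. apply is_linear_id.
Qed.

Lemma rder_RtoC (f : R -> R) (t l : R) : is_derive f t l -> rder (fun s => RtoC (f s)) t (RtoC l).
Proof. intros H. apply (rder_pair f (fun _ => 0%R)); auto. apply @is_derive_const. Qed.

Lemma rder_const (c : C) t : rder (fun _ => c) t 0.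
Proof. exact (is_derive_const (K := R_AbsRing) (V := C_R_NormedModule) c t). Qed.

Lemma rder_id t : rder RtoC t 1.
Proof. apply (rder_RtoC (fun t => t) t one). exact (is_derive_id (K := R_AbsRing) t). Qed.

Lemma rder_plus f g t df dg : rder f t df -> rder g t dg -> rder (fun s => f s + g s) t (df + dg).
Proof. exact (is_derive_plus (K := R_AbsRing) (V := C_R_NormedModule) f g t df dg). Qed.

Lemma rder_minus f g t df dg : rder f t df -> rder g t dg -> rder (fun s => f s - g s) t (df - dg).
Proof. exact (is_derive_minus (K := R_AbsRing) (V := C_R_NormedModule) f g t df dg). Qed.

Lemma rder_comp (f : C -> C) (g : R -> C) (t : R) (df dg : C) :
  cder f (g t) df -> rder g t dg -> rder (fun s => f (g s)) t (df * dg).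
Proof.
intros H1 H2. unfold rder, is_derive.
assert (Lin : is_linear (K := R_AbsRing) (U := C_R_NormedModule) (V := C_R_NormedModule) (fun y : C => df * y)).
{ constructor.
  - intros x y. change (df * (x + y) = df * x + df * y). ring.
  - intros k x. rewrite !scal_R_Cmult. change (df * (RtoC k * x) = RtoC k * (df * x)). ring.
  - exists (1 + Cmod df)%R. pose proof (Cmod_ge_0 df). split; [lra|].
    intros x. rewrite !normCR, Cmod_mult. pose proof (Cmod_ge_0 x). nra. }
assert (D : filterdiff (K := R_AbsRing) (U := C_R_NormedModule) (V := C_R_NormedModule)
  f (locally (g t)) (fun y : C => df * y)).
{ split; auto. intros x Hx. assert (x = g t) as ->.
  { symmetry. apply is_filter_lim_locally_unique. exact Hx. }
  intros eps. destruct (proj1 (cder_eps _ _ _) H1 eps (cond_pos eps)) as [r [Hr B]].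
  apply (proj2 (locally_disc (g t) _)). exists r; split; auto. intros w Hw. rewrite !normCR.
  specialize (B w Hw). rewrite (Cmult_comm _ df) in B. exact B. }
assert (H := filterdiff_comp' (K := R_AbsRing) (V := C_R_NormedModule) g f t _ _ H2 D).
eapply filterdiff_ext_lin; [exact H|]. intros y. cbv beta. rewrite !scal_R_Cmult.
change (df * (RtoC y * dg) = RtoC y * (df * dg)). ring.
Qed.

(** Polarization reduces products to squares, which the chain rule handles. *)
Lemma rder_mult f g t df dg :
  rder f t df -> rder g t dg -> rder (fun s => f s * g s) t (df * g t + f t * dg).
Proof.
intros H1 H2. assert (Sq : forall z, cder (fun w => w * w / 4) z (z / 2)).
{ intros z. eapply cder_eq. cderiv. intros E; apply RtoC_inj in E; lra. field. }
assert (P := rder_comp _ (fun s => f s + g s) t _ _ (Sq _) (rder_plus _ _ t _ _ H1 H2)).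
assert (M := rder_comp _ (fun s => f s - g s) t _ _ (Sq _) (rder_minus _ _ t _ _ H1 H2)).
apply (is_derive_ext (K := R_AbsRing) (V := C_R_NormedModule)
  (fun s => (f s + g s) * (f s + g s) / 4 - (f s - g s) * (f s - g s) / 4)).
{ assert (E : forall x y : C, (x + y) * (x + y) / 4 - (x - y) * (x - y) / 4 = x * y) by (intros; field).
  intros s. apply E. }
eapply rder_eq. exact (rder_minus _ _ t _ _ P M). cbv beta. field.
Qed.

Definition CI (f : R -> C) (a b : R) : C := RInt (V := C_R_CompleteNormedModule) f a b.
Definition exCI (f : R -> C) (a b : R) : Prop := ex_RInt (V := C_R_NormedModule) f a b.
Definition btw (a b t : R) : Prop := (Rmin a b <= t <= Rmax a b)%R.

Lemma exCI_cont f a b : (forall x, btw a b x -> rcont f x) -> exCI f a b.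
Proof. exact (ex_RInt_continuous (V := C_R_CompleteNormedModule) f a b). Qed.

Lemma CI_correct f a b : exCI f a b -> is_RInt (V := C_R_NormedModule) f a b (CI f a b).
Proof. exact (RInt_correct (V := C_R_CompleteNormedModule) f a b). Qed.

Lemma CI_unique f a b l : is_RInt (V := C_R_NormedModule) f a b l -> CI f a b = l.
Proof. exact (is_RInt_unique (V := C_R_CompleteNormedModule) f a b l). Qed.

Lemma CI_FTC (F f : R -> C) a b :
  (forall x, btw a b x -> rder F x (f x) /\ rcont f x) -> CI f a b = F b - F a.
Proof.
intros H. apply CI_unique. refine (is_RInt_derive (V := C_R_CompleteNormedModule) F f a b _ _); intros x Hx; apply H, Hx.
Qed.

Lemma CI_ext f g a b :
  (forall x, (Rmin a b < x < Rmax a b)%R -> f x = g x) -> CI f a b = CI g a b.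
Proof. exact (RInt_ext (V := C_R_CompleteNormedModule) f g a b). Qed.

Lemma CI_Chasles f a b c : exCI f a b -> exCI f b c -> CI f a b + CI f b c = CI f a c.
Proof. exact (RInt_Chasles (V := C_R_CompleteNormedModule) f a b c). Qed.

Lemma CI_point f a : CI f a a = 0.
Proof. apply CI_unique. exact (is_RInt_point (V := C_R_NormedModule) f a). Qed.

Lemma CI_plus f g a b : exCI f a b -> exCI g a b -> CI (fun t => f t + g t) a b = CI f a b + CI g a b.
Proof. exact (RInt_plus (V := C_R_CompleteNormedModule) f g a b). Qed.

Lemma CI_minus f g a b : exCI f a b -> exCI g a b -> CI (fun t => f t - g t) a b = CI f a b - CI g a b.
Proof. exact (RInt_minus (V := C_R_CompleteNormedModule) f g a b). Qed.

Lemma exCI_minus f g a b : exCI f a b -> exCI g a b -> exCI (fun t => f t - g t) a b.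
Proof. exact (ex_RInt_minus (V := C_R_NormedModule) f g a b). Qed.

Lemma is_CI_scal (c : C) (f : R -> C) a b l : is_RInt (V := C_R_NormedModule) f a b l ->
  is_RInt (V := C_R_NormedModule) (fun t => c * f t) a b (c * l).
Proof.
intros H.
pose proof (is_RInt_fct_extend_fst (U := R_NormedModule) (V := R_NormedModule) f a b l H) as H1.
pose proof (is_RInt_fct_extend_snd (U := R_NormedModule) (V := R_NormedModule) f a b l H) as H2.
apply (is_RInt_fct_extend_pair (U := R_NormedModule) (V := R_NormedModule)).
- apply (is_RInt_ext (fun t => minus (scal (fst c) (fst (f t))) (scal (snd c) (snd (f t))))).
  { intros; reflexivity. }
  apply @is_RInt_minus; apply @is_RInt_scal; assumption.
- apply (is_RInt_ext (fun t => plus (scal (fst c) (snd (f t))) (scal (snd c) (fst (f t))))).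
  { intros; reflexivity. }
  apply @is_RInt_plus; apply @is_RInt_scal; assumption.
Qed.

Lemma CI_scal c f a b : exCI f a b -> CI (fun t => c * f t) a b = c * CI f a b.
Proof. intros H. apply CI_unique, is_CI_scal, CI_correct, H. Qed.

Lemma exCI_scal c f a b : exCI f a b -> exCI (fun t => c * f t) a b.
Proof. intros [l H]. exists (c * l). apply is_CI_scal, H. Qed.

Lemma CI_bound f a b M : exCI f a b ->
  (forall x, btw a b x -> (Cmod (f x) <= M)%R) -> (Cmod (CI f a b) <= Rabs (b - a) * M)%R.
Proof.
assert (Hmain : forall a b, (a <= b)%R -> exCI f a b ->
  (forall x, btw a b x -> (Cmod (f x) <= M)%R) -> (Cmod (CI f a b) <= (b - a) * M)%R).
{ clear. intros a b Hab He H. rewrite <- normCR.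
  apply (norm_RInt_le_const (V := C_R_NormedModule) f a b (CI f a b) M Hab).
  - intros x Hx. rewrite normCR. apply H. unfold btw. rewrite Rmin_left, Rmax_right; lra.
  - apply CI_correct; auto. }
intros He H. destruct (Rle_dec a b) as [Hab|Hab].
- rewrite Rabs_pos_eq by lra. apply Hmain; auto.
- assert (He' : exCI f b a) by (apply ex_RInt_swap; exact He).
  assert (CI f a b = - CI f b a) as ->.
  { apply CI_unique. apply (is_RInt_swap (V := C_R_NormedModule)). apply CI_correct; auto. }
  rewrite Cmod_opp, Rabs_left by lra. replace (- (b - a))%R with (a - b)%R by ring.
  apply Hmain; auto. lra. intros x. unfold btw. rewrite Rmin_comm, Rmax_comm. apply H.
Qed.
Global Opaque CI.

(** The left hand side is the integral of [F' - l]. *)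
Lemma mean_value_C (F F' : R -> C) (a b : R) (l : C) (M : R) :
  (forall t, btw a b t -> rder F t (F' t) /\ rcont F' t /\ (Cmod (F' t - l) <= M)%R) ->
  (Cmod (F b - F a - RtoC (b - a) * l) <= Rabs (b - a) * M)%R.
Proof.
intros H.
assert (D : forall t, btw a b t -> rder (fun t => F t - RtoC t * l) t (F' t - l) /\ rcont (fun t => F' t - l) t).
{ intros t Ht. destruct (H t Ht) as [H1 [H2 _]]. split.
  - eapply rder_eq. apply rder_minus. exact H1. apply rder_mult. apply rder_id. apply rder_const. cbv beta. ring.
  - apply (rcont_comp (fun w => w - l) F'); auto. eapply cder_cont. cderiv. }
assert (E := CI_FTC _ _ a b D). cbv beta in E.
replace (F b - F a - RtoC (b - a) * l) with (F b - RtoC b * l - (F a - RtoC a * l)) by (rewrite RtoC_minus; ring).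
rewrite <- E. apply CI_bound; [|intros t Ht; apply H, Ht]. apply exCI_cont. intros t Ht. apply D, Ht.
Qed.

Lemma zero_derivative_constant (F : R -> C) a b : (forall t, btw a b t -> rder F t 0) -> F a = F b.
Proof.
intros H. symmetry. apply Ceq_minus, Cmod_eq_0, Rle_antisym; [|apply Cmod_ge_0].
assert (A := mean_value_C F (fun _ => 0) a b 0 0).
rewrite Rmult_0_r, Cmult_0_r in A. replace (F b - F a - 0) with (F b - F a) in A by ring.
apply A. intros t Ht. split; auto. split. eapply rder_cont, rder_const.
replace (0 - 0) with (RtoC 0) by ring. rewrite Cmod_0. lra.
Qed.

(** * Rectangles and Goursat's theorem *)

Lemma Cmod_le (x y x' y' : R) : (Rabs x <= Rabs x')%R -> (Rabs y <= Rabs y')%R ->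
  (Cmod (x, y) <= Cmod (x', y'))%R.
Proof.
intros H1 H2. unfold Cmod. apply sqrt_le_1_alt. simpl.
rewrite !Rmult_1_r. apply Rplus_le_compat; apply Rsqr_le_abs_1; assumption.
Qed.

Lemma Cmod_le_sum (x y : R) : (Cmod (x, y) <= Rabs x + Rabs y)%R.
Proof.
replace ((x, y) : C) with (RtoC x + Ci * RtoC y) by (apply injective_projections; simpl; ring).
eapply Rle_trans. apply Cmod_triangle. rewrite Cmod_mult, Cmod_Ci, !Cmod_R. lra.
Qed.

Lemma btw_abs a b t : btw a b t -> (Rabs (t - a) <= Rabs (b - a))%R.
Proof. unfold btw, Rmin, Rmax. intros H. destruct (Rle_dec a b); unfold Rabs; repeat destruct Rcase_abs; lra. Qed.

Lemma btw_l a b : btw a b a. Proof. unfold btw. pose proof (Rmin_l a b). pose proof (Rmax_l a b). lra. Qed.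
Lemma btw_r a b : btw a b b. Proof. unfold btw. pose proof (Rmin_r a b). pose proof (Rmax_r a b). lra. Qed.
Lemma btw_trans a b c d t : btw a b c -> btw a b d -> btw c d t -> btw a b t.
Proof. unfold btw, Rmin, Rmax. repeat destruct Rle_dec; lra. Qed.
Hint Resolve btw_l btw_r : core.

Lemma btw_affine a b s : (0 <= s <= 1)%R -> btw a b (a + s * (b - a)).
Proof. intros Hs. unfold btw, Rmin, Rmax. destruct Rle_dec; nra. Qed.

Lemma Cminus_pair (x y a b : R) : ((x, y) : C) - (a, b) = (x - a, y - b)%R.
Proof. reflexivity. Qed.

Lemma disc_btw p r w x y : disc p r w -> btw (fst p) (fst w) x -> btw (snd p) (snd w) y -> disc p r (x, y).
Proof.
destruct p as [px py], w as [wx wy]. unfold disc; simpl. intros H Bx By.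
eapply Rle_lt_trans; [|exact H]. rewrite !Cminus_pair. apply Cmod_le; apply btw_abs; auto.
Qed.

Lemma disc_center c r : (0 < r)%R -> disc c r c.
Proof. intros H. unfold disc. replace (c - c) with (RtoC 0) by ring. rewrite Cmod_0; auto. Qed.

Lemma disc_le c r r' z : (r <= r')%R -> disc c r z -> disc c r' z.
Proof. unfold disc; intros; lra. Qed.

Lemma disc_trans p q e r v : (e + Cmod (q - p) <= r)%R -> disc q e v -> disc p r v.
Proof.
unfold disc. intros H Hv. replace (v - p) with ((v - q) + (q - p)) by ring.
eapply Rle_lt_trans. apply Cmod_triangle. lra.
Qed.

Lemma disc_open p r w : disc p r w -> locally w (disc p r).
Proof.
unfold disc at 1. intros H. apply locally_disc. exists (r - Cmod (w - p))%R. split. lra.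
intros v. apply disc_trans. lra.
Qed.

Lemma rder_hor x y : rder (fun t => (t, y)) x 1.
Proof. apply (rder_pair (fun t => t) (fun _ => y)). apply @is_derive_id. apply @is_derive_const. Qed.

Lemma rder_ver x y : rder (fun t => (x, t)) y Ci.
Proof. apply (rder_pair (fun _ => x) (fun t => t)). apply @is_derive_const. apply @is_derive_id. Qed.

Lemma rcont_hor k x y : cont k (x, y) -> rcont (fun t => k (t, y)) x.
Proof. intros H. apply (rcont_comp k (fun t => (t, y))); auto. eapply rder_cont, rder_hor. Qed.

Lemma rcont_ver k x y : cont k (x, y) -> rcont (fun t => k (x, t)) y.
Proof. intros H. apply (rcont_comp k (fun t => (x, t))); auto. eapply rder_cont, rder_ver. Qed.

Lemma exCI_hor k x0 x1 y : (forall x, btw x0 x1 x -> cont k (x, y)) -> exCI (fun t => k (t, y)) x0 x1.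
Proof. intros H. apply exCI_cont. intros x Hx. apply rcont_hor, H, Hx. Qed.

Lemma exCI_ver k y0 y1 x : (forall y, btw y0 y1 y -> cont k (x, y)) -> exCI (fun t => k (x, t)) y0 y1.
Proof. intros H. apply exCI_cont. intros y Hy. apply rcont_ver, H, Hy. Qed.

(** The increment from [z] to [w] is taken along a horizontal and a vertical
  segment, both close to [z], where the two partial derivatives are close to
  [k z] and [Ci * k z]. *)
Lemma cauchy_riemann (F k : C -> C) (z : C) :
  locally z (fun w : C => rder (fun t => F (t, snd w)) (fst w) (k w) /\
                      rder (fun t => F (fst w, t)) (snd w) (Ci * k w) /\ cont k w) ->
  cder F z (k z).
Proof.
intros H. apply cder_eps. intros eps He.
assert (Hk : cont k z) by exact (proj2 (proj2 (locally_singleton z _ H))).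
apply locally_disc in H. destruct H as [r1 [Hr1 H]].
destruct (proj1 (cont_eps _ _) Hk (eps / 2)%R) as [r2 [Hr2 B]]. lra.
exists (Rmin r1 r2). split. { apply Rmin_glb_lt; auto. }
intros w Hw.
assert (D : forall u, disc z (Rmin r1 r2) u -> disc z r1 u /\ disc (k z) (eps / 2) (k u)).
{ intros u Hu. apply Rmin_def in Hu. split. apply Hu. apply B, Hu. }
destruct w as [x y]. destruct z as [x0 y0].
assert (A1 : (Cmod (F (x, y) - F (x0, y) - RtoC (x - x0) * k (x0, y0)) <= Rabs (x - x0) * (eps / 2))%R).
{ apply (mean_value_C (fun t => F (t, y)) (fun t => k (t, y))). intros t Ht.
  destruct (D (t, y)) as [D1 D2]. { eapply disc_btw. exact Hw. exact Ht. apply btw_r. }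
  destruct (H _ D1) as [H1 [_ H3]]. split; auto. split. apply rcont_hor, H3. apply Rlt_le, D2. }
assert (A2 : (Cmod (F (x0, y) - F (x0, y0) - RtoC (y - y0) * (Ci * k (x0, y0))) <= Rabs (y - y0) * (eps / 2))%R).
{ apply (mean_value_C (fun t => F (x0, t)) (fun t => Ci * k (x0, t))). intros t Ht.
  destruct (D (x0, t)) as [D1 D2]. { eapply disc_btw. exact Hw. apply btw_l. exact Ht. }
  destruct (H _ D1) as [_ [H2 H3]]. split; auto. split.
  - apply rcont_mult. eapply rder_cont, rder_const. apply rcont_ver, H3.
  - replace (Ci * k (x0, t) - Ci * k (x0, y0)) with (Ci * (k (x0, t) - k (x0, y0))) by ring.
    rewrite Cmod_mult, Cmod_Ci, Rmult_1_l. apply Rlt_le, D2. }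
replace (F (x, y) - F (x0, y0) - ((x, y) - (x0, y0)) * k (x0, y0)) with
  ((F (x, y) - F (x0, y) - RtoC (x - x0) * k (x0, y0)) +
   (F (x0, y) - F (x0, y0) - RtoC (y - y0) * (Ci * k (x0, y0)))).
2:{ rewrite (Cminus_pair x y x0 y0).
  replace (x - x0, y - y0)%R with (RtoC (x - x0) + Ci * RtoC (y - y0)) by (apply injective_projections; simpl; ring).
  ring. }
eapply Rle_trans. apply Cmod_triangle.
rewrite Cminus_pair.
assert (Rmax (Rabs (x - x0)) (Rabs (y - y0)) <= Cmod (x - x0, y - y0)%R)%R by exact (Rmax_Cmod (x - x0, y - y0)%R).
pose proof (Rmax_l (Rabs (x - x0)) (Rabs (y - y0))).
pose proof (Rmax_r (Rabs (x - x0)) (Rabs (y - y0))). nra.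
Qed.

(** Opposite corners [(x0, y0)] and [(x1, y1)] may come in any order, so that a
  primitive can be based at one corner. *)
Definition rect (k : C -> C) (x0 x1 y0 y1 : R) : C :=
  CI (fun t => k (t, y0)) x0 x1 + Ci * CI (fun t => k (x1, t)) y0 y1
  - CI (fun t => k (t, y1)) x0 x1 - Ci * CI (fun t => k (x0, t)) y0 y1.

Definition rect_cont (k : C -> C) (x0 x1 y0 y1 : R) : Prop :=
  forall x y, btw x0 x1 x -> btw y0 y1 y -> cont k (x, y).

Lemma rect_minus k1 k2 x0 x1 y0 y1 : rect_cont k1 x0 x1 y0 y1 -> rect_cont k2 x0 x1 y0 y1 ->
  rect (fun z => k1 z - k2 z) x0 x1 y0 y1 = rect k1 x0 x1 y0 y1 - rect k2 x0 x1 y0 y1.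
Proof.
intros H1 H2. unfold rect.
assert (Hh : forall y, btw y0 y1 y -> CI (fun t => k1 (t, y) - k2 (t, y)) x0 x1 =
  CI (fun t => k1 (t, y)) x0 x1 - CI (fun t => k2 (t, y)) x0 x1).
{ intros y Hy. apply (CI_minus (fun t => k1 (t, y)) (fun t => k2 (t, y))); apply exCI_hor; auto. }
assert (Hv : forall x, btw x0 x1 x -> CI (fun t => k1 (x, t) - k2 (x, t)) y0 y1 =
  CI (fun t => k1 (x, t)) y0 y1 - CI (fun t => k2 (x, t)) y0 y1).
{ intros x Hx. apply (CI_minus (fun t => k1 (x, t)) (fun t => k2 (x, t))); apply exCI_ver; auto. }
rewrite (Hh y0), (Hh y1), (Hv x0), (Hv x1); auto. ring.
Qed.

Lemma rect_split_x k x0 x1 x2 y0 y1 : btw x0 x2 x1 -> rect_cont k x0 x2 y0 y1 ->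
  rect k x0 x2 y0 y1 = rect k x0 x1 y0 y1 + rect k x1 x2 y0 y1.
Proof.
intros Hx H. unfold rect.
assert (A : forall y, btw y0 y1 y -> CI (fun t => k (t, y)) x0 x2 = CI (fun t => k (t, y)) x0 x1 + CI (fun t => k (t, y)) x1 x2).
{ intros y Hy. symmetry. apply CI_Chasles; apply exCI_hor; intros x Hx'; apply H; auto;
  (eapply btw_trans; [| |exact Hx']; auto). }
rewrite (A y0), (A y1); auto. ring.
Qed.

Lemma rect_split_y k x0 x1 y0 y1 y2 : btw y0 y2 y1 -> rect_cont k x0 x1 y0 y2 ->
  rect k x0 x1 y0 y2 = rect k x0 x1 y0 y1 + rect k x0 x1 y1 y2.
Proof.
intros Hx H. unfold rect.
assert (A : forall x, btw x0 x1 x -> CI (fun t => k (x, t)) y0 y2 = CI (fun t => k (x, t)) y0 y1 + CI (fun t => k (x, t)) y1 y2).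
{ intros x Hy. symmetry. apply CI_Chasles; apply exCI_ver; intros y Hx'; apply H; auto;
  (eapply btw_trans; [| |exact Hx']; auto). }
rewrite (A x0), (A x1); auto. ring.
Qed.

Lemma rect_bound k x0 x1 y0 y1 M : rect_cont k x0 x1 y0 y1 ->
  (forall x y, btw x0 x1 x -> btw y0 y1 y -> (Cmod (k (x, y)) <= M)%R) ->
  (Cmod (rect k x0 x1 y0 y1) <= 2 * M * (Rabs (x1 - x0) + Rabs (y1 - y0)))%R.
Proof.
intros H B. unfold rect.
assert (Hh : forall y, btw y0 y1 y -> (Cmod (CI (fun t => k (t, y)) x0 x1) <= Rabs (x1 - x0) * M)%R).
{ intros y Hy. apply CI_bound. apply exCI_hor; auto. intros x Hx. apply B; auto. }
assert (Hv : forall x, btw x0 x1 x -> (Cmod (Ci * CI (fun t => k (x, t)) y0 y1) <= Rabs (y1 - y0) * M)%R).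
{ intros x Hy. rewrite Cmod_mult, Cmod_Ci, Rmult_1_l. apply CI_bound. apply exCI_ver; auto. intros y Hx. apply B; auto. }
pose proof (Hh y0 (btw_l _ _)). pose proof (Hh y1 (btw_r _ _)).
pose proof (Hv x0 (btw_l _ _)). pose proof (Hv x1 (btw_r _ _)).
unfold Cminus.
eapply Rle_trans. apply Cmod_triangle. rewrite Cmod_opp.
eapply Rle_trans. apply Rplus_le_compat_r. apply Cmod_triangle. rewrite Cmod_opp.
eapply Rle_trans. apply Rplus_le_compat_r. apply Rplus_le_compat_r. apply Cmod_triangle. lra.
Qed.

Lemma rect_primitive K k x0 x1 y0 y1 :
  (forall x y, btw x0 x1 x -> btw y0 y1 y -> cder K (x, y) (k (x, y)) /\ cont k (x, y)) ->
  rect k x0 x1 y0 y1 = 0.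
Proof.
intros H. unfold rect.
assert (Hh : forall y, btw y0 y1 y -> CI (fun t => k (t, y)) x0 x1 = K (x1, y) - K (x0, y)).
{ intros y Hy. apply (CI_FTC (fun t => K (t, y))). intros x Hx. destruct (H x y Hx Hy) as [H1 H2]. split.
  - eapply rder_eq. exact (rder_comp K _ x _ _ H1 (rder_hor x y)). ring.
  - apply rcont_hor, H2. }
assert (Hv : forall x, btw x0 x1 x -> Ci * CI (fun t => k (x, t)) y0 y1 = K (x, y1) - K (x, y0)).
{ intros x Hx. rewrite <- CI_scal by (apply exCI_ver; intros; apply H; auto).
  apply (CI_FTC (fun t => K (x, t))). intros y Hy. destruct (H x y Hx Hy) as [H1 H2]. split.
  - eapply rder_eq. exact (rder_comp K _ y _ _ H1 (rder_ver x y)). ring.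
  - apply (rcont_mult (fun _ => Ci)). eapply rder_cont, rder_const. apply rcont_ver, H2. }
rewrite !Hh, !Hv; auto. ring.
Qed.

(** Used for the corners of the rectangles of a subdivision, in units of the
  sides. *)
Lemma dyadic_limit (t : nat -> R) : t O = 0%R ->
  (forall n, t (S n) = t n \/ t (S n) = (t n + / 2 ^ S n)%R) ->
  (forall n, (0 <= t n)%R /\ (t n + / 2 ^ n <= 1)%R) /\ exists p, forall n, (t n <= p <= t n + / 2 ^ n)%R.
Proof.
intros H0 Hs.
assert (Pow : forall n, (/ 2 ^ n = 2 * / 2 ^ S n)%R /\ (0 < / 2 ^ n)%R).
{ intros n. assert (0 < 2 ^ n)%R by (apply pow_lt; lra). split. simpl; field; lra. apply Rinv_0_lt_compat; auto. }
assert (Ha : forall n m, (n <= m)%nat -> (t n <= t m)%R /\ (t m + / 2 ^ m <= t n + / 2 ^ n)%R).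
{ intros n m H. induction H as [|m H IH]. lra. destruct (Pow m), (Pow (S m)), (Hs m) as [-> | ->]; lra. }
assert (Hab : forall n m, (t n <= t m + / 2 ^ m)%R).
{ intros n m. destruct (Ha n (Nat.max n m)), (Ha m (Nat.max n m)); try lia. destruct (Pow (Nat.max n m)). lra. }
split.
{ intros n. destruct (Ha O n); [lia|]. simpl in H1. lra. }
destruct (completeness (fun x => exists n, x = t n)) as [p [Hp1 Hp2]].
- exists (t O + / 2 ^ O)%R. intros x [n ->]. apply Hab.
- exists (t O). exists O; auto.
- exists p. intros n. split. apply Hp1; exists n; auto. apply Hp2. intros x [m ->]. apply Hab.
Qed.

(** If the integral were not zero, quartering would produce rectangles with
  integral at least [4 ^ -n] times as large, shrinking to a point; there [k] is
  affine up to [o(2 ^ -n)], an affine function has a primitive, and the rest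
  contributes [o(4 ^ -n)]. *)
Lemma goursat k x0 x1 y0 y1 :
  (forall x y, btw x0 x1 x -> btw y0 y1 y -> cex k (x, y)) -> rect k x0 x1 y0 y1 = 0.
Proof.
intros Hk. apply NNPP. intros Hne. apply Cmod_gt_0 in Hne.
set (m := Cmod (rect k x0 x1 y0 y1)) in *.
set (X := fun t => (x0 + t * (x1 - x0))%R). set (Y := fun t => (y0 + t * (y1 - y0))%R).
set (sub := fun n (q : R * R) => let (t, u) := q in
  rect k (X t) (X (t + / 2 ^ n)%R) (Y u) (Y (u + / 2 ^ n)%R)).
set (big := fun n q => (m / 4 ^ n <= Cmod (sub n q))%R).
(* the [n]-th rectangle has its lower left corner at [Q n] and the side [/ 2 ^ n], in units of the sides *)
set (pick := fun n (q : R * R) => let (t, u) := q in let d := (/ 2 ^ S n)%R in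
  if excluded_middle_informative (big (S n) (t, u)) then (t, u) else
  if excluded_middle_informative (big (S n) (t, u + d)%R) then (t, u + d)%R else
  if excluded_middle_informative (big (S n) (t + d, u)%R) then (t + d, u)%R else (t + d, u + d)%R).
set (Q := fix Q (n : nat) : R * R := match n with O => (0, 0)%R | S n => pick n (Q n) end).
assert (Hx : (forall n, fst (Q (S n)) = fst (Q n) \/ fst (Q (S n)) = (fst (Q n) + / 2 ^ S n)%R) /\
  forall n, snd (Q (S n)) = snd (Q n) \/ snd (Q (S n)) = (snd (Q n) + / 2 ^ S n)%R).
{ split; intros n; cbn [Q]; destruct (Q n) as [t u]; unfold pick;
  repeat destruct excluded_middle_informative; cbn [fst snd]; auto. }
destruct (dyadic_limit (fun n => fst (Q n)) eq_refl (proj1 Hx)) as [Ix [px Hpx]].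
destruct (dyadic_limit (fun n => snd (Q n)) eq_refl (proj2 Hx)) as [Iy [py Hpy]].
assert (Pow : forall n, (0 < / 2 ^ n)%R) by (intros; apply Rinv_0_lt_compat, pow_lt; lra).
assert (Sub : forall n x y, btw (X (fst (Q n))) (X (fst (Q n) + / 2 ^ n)%R) x ->
  btw (Y (snd (Q n))) (Y (snd (Q n) + / 2 ^ n)%R) y -> btw x0 x1 x /\ btw y0 y1 y).
{ intros n x y Bx By. pose proof (Ix n). pose proof (Iy n). pose proof (Pow n).
  split; (eapply btw_trans; [| |eassumption]); apply btw_affine; lra. }
assert (Cn : forall n, rect_cont k (X (fst (Q n))) (X (fst (Q n) + / 2 ^ n)%R) (Y (snd (Q n))) (Y (snd (Q n) + / 2 ^ n)%R)).
{ intros n x y Bx By. destruct (Sub n x y Bx By). apply cex_cont, Hk; auto. }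
assert (Big : forall n, big n (Q n)).
{ induction n as [|n IH].
  { unfold big, sub, X, Y. simpl. right. unfold m, Rdiv. rewrite Rinv_1, Rmult_1_r. f_equal. f_equal; ring. }
  specialize (Cn n). cbn [Q]. destruct (Q n) as [t u]. cbn [fst snd] in Cn. unfold pick.
  repeat destruct excluded_middle_informative; auto.
  unfold big in *. apply Rnot_lt_le. intros N3. apply Rnot_le_lt in n0, n1, n2.
  set (d := (/ 2 ^ S n)%R) in *.
  assert (Ed : (/ 2 ^ n = d + d)%R) by (unfold d; simpl; field; apply pow_nonzero; lra).
  assert (E : sub n (t, u) = sub (S n) (t, u) + sub (S n) (t, (u + d)%R) + (sub (S n) ((t + d)%R, u) + sub (S n) ((t + d)%R, (u + d)%R))).
  { unfold sub in *. fold d. rewrite Ed in *. rewrite <- !Rplus_assoc in *.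
    assert (Hd : (0 < d)%R) by apply Pow.
    assert (M : forall a b t, btw (a + t * b) (a + (t + d + d) * b) (a + (t + d) * b)).
    { intros a b c. replace (a + (c + d) * b)%R with (a + c * b + / 2 * (a + (c + d + d) * b - (a + c * b)))%R by field.
      apply btw_affine; lra. }
    rewrite (rect_split_x k _ (X (t + d)%R)) by (auto; apply M).
    rewrite (rect_split_y k _ (X (t + d)%R) _ (Y (u + d)%R)), (rect_split_y k (X (t + d)%R) _ _ (Y (u + d)%R)); try apply M; auto;
    intros x y Bx By; apply Cn; auto; (eapply btw_trans; [| |exact Bx]); auto; apply M. }
  rewrite E in IH. assert (T := Cmod_triangle (sub (S n) (t, u) + sub (S n) (t, (u + d)%R)) (sub (S n) ((t + d)%R, u) + sub (S n) ((t + d)%R, (u + d)%R))).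
  assert (T1 := Cmod_triangle (sub (S n) (t, u)) (sub (S n) (t, (u + d)%R))).
  assert (T2 := Cmod_triangle (sub (S n) ((t + d)%R, u)) (sub (S n) ((t + d)%R, (u + d)%R))).
  assert (m / 4 ^ n = 4 * (m / 4 ^ S n))%R by (simpl; field; apply pow_nonzero; lra). lra. }
set (p := (X px, Y py)).
destruct (Hk (X px) (Y py)) as [l Hl].
{ apply btw_affine. pose proof (Hpx O). pose proof (Ix O). lra. }
{ apply btw_affine. pose proof (Hpy O). pose proof (Iy O). lra. }
set (W := (Rabs (x1 - x0) + Rabs (y1 - y0))%R).
assert (HW : (0 <= W)%R) by (unfold W; pose proof (Rabs_pos (x1 - x0)); pose proof (Rabs_pos (y1 - y0)); lra).
set (eps := (m / (4 * (1 + W) * (1 + W)))%R).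
assert (He : (0 < eps)%R) by (apply Rdiv_lt_0_compat; nra).
destruct (proj1 (cder_eps _ _ _) Hl eps He) as [r [Hr B]].
destruct (pow_lt_1_zero (/ 2)) with (y := (r / (1 + W))%R) as [n Hn].
{ rewrite Rabs_pos_eq; lra. } { apply Rdiv_lt_0_compat; lra. }
specialize (Hn n (Nat.le_refl n)). rewrite pow_inv, Rabs_pos_eq in Hn by (left; apply Pow).
specialize (Big n). specialize (Cn n). specialize (Sub n). specialize (Hpx n). specialize (Hpy n). specialize (Pow n).
destruct (Q n) as [t u]. cbn [fst snd] in *. set (d := (/ 2 ^ n)%R) in *.
assert (HdW : (d * W < r)%R).
{ apply Rle_lt_trans with (d * (1 + W))%R; [nra|]. apply (Rmult_lt_compat_r (1 + W)) in Hn; [|lra].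
  replace (r / (1 + W) * (1 + W))%R with r in Hn by (field; lra). exact Hn. }
set (aff := fun w : C => k p + (w - p) * l).
assert (Caff : forall w, cont aff w) by (intros w; eapply cder_cont; unfold aff; cderiv).
assert (E1 : sub n (t, u) = rect (fun w => k w - aff w) (X t) (X (t + d)%R) (Y u) (Y (u + d)%R)).
{ unfold sub. fold d. rewrite rect_minus; auto. 2:{ intros x y _ _. apply Caff. }
  rewrite (rect_primitive (fun w => k p * w + (w - p) * (w - p) * (l * / 2)) aff). ring.
  intros x y _ _. split; auto. eapply cder_eq. cderiv. unfold aff. cbv beta. field. }
assert (Len : forall a b s, (Rabs (a + (s + d) * (b - a) - (a + s * (b - a))) = d * Rabs (b - a))%R).
{ intros a b s. replace (a + (s + d) * (b - a) - (a + s * (b - a)))%R with (d * (b - a))%R by ring.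
  rewrite Rabs_mult, (Rabs_pos_eq d); lra. }
assert (Near : forall a b s q v, (s <= q <= s + d)%R -> btw (a + s * (b - a)) (a + (s + d) * (b - a)) v ->
  (Rabs (v - (a + q * (b - a))) <= d * Rabs (b - a))%R).
{ intros a b s q v Hq. unfold btw, Rmin, Rmax, Rabs. destruct Rle_dec, Rcase_abs, Rcase_abs; nra. }
assert (Bn : (Cmod (sub n (t, u)) <= 2 * (eps * (d * W)) * (d * W))%R).
{ rewrite E1. replace (d * W)%R with (Rabs (X (t + d) - X t) + Rabs (Y (u + d) - Y u))%R at 2
    by (unfold X, Y, W; rewrite !Len; ring).
  apply rect_bound.
  { intros x y Bx By. destruct (Sub x y Bx By) as [S1 S2]. destruct (Hk x y S1 S2) as [l' Hl'].
    eapply cder_cont. apply cder_minus. exact Hl'. unfold aff. cderiv. }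
  intros x y Bx By.
  assert (Hd : (Cmod ((x, y) - p) <= d * W)%R).
  { unfold p. rewrite Cminus_pair. eapply Rle_trans. apply Cmod_le_sum. unfold W.
    assert (N1 := Near x0 x1 t px x Hpx Bx). assert (N2 := Near y0 y1 u py y Hpy By). unfold X, Y. lra. }
  unfold aff. replace (k (x, y) - (k p + ((x, y) - p) * l)) with (k (x, y) - k p - ((x, y) - p) * l) by ring.
  fold p in B. eapply Rle_trans. apply B. unfold disc. lra. apply Rmult_le_compat_l; lra. }
assert (E4 : (m / 4 ^ n = m * (d * d))%R).
{ unfold d. replace 4%R with (2 * 2)%R by ring. rewrite Rpow_mult_distr. field. apply pow_nonzero; lra. }
assert (E5 : (eps * (4 * (1 + W) * (1 + W)) = m)%R) by (unfold eps; field; lra).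
unfold big in Big. rewrite E4 in Big.
assert (m * (d * d) <= 2 * (eps * (W * W)) * (d * d))%R by lra.
assert (m <= 2 * (eps * (W * W)))%R by (apply (Rmult_le_reg_r (d * d)); nra).
assert (0 <= eps * W)%R by nra. nra.
Qed.

(** The exceptional point sits at a corner: cutting off a small rectangle there
  leaves rectangles on which the function is holomorphic, and the boundary
  integral over the small one is as small as its perimeter. *)
Lemma goursat_corner k px py x1 y1 : rect_cont k px x1 py y1 ->
  (forall x y, btw px x1 x -> btw py y1 y -> (x, y) <> (px, py) -> cex k (x, y)) ->
  rect k px x1 py y1 = 0.
Proof.
intros Hc H.
destruct (Req_dec px x1) as [<-|Hx].
{ unfold rect. rewrite !CI_point. ring. }
destruct (Req_dec py y1) as [<-|Hy].
{ unfold rect. rewrite !CI_point. ring. }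
apply NNPP. intros Hne. apply Cmod_gt_0 in Hne. set (m := Cmod (rect k px x1 py y1)) in *.
destruct (proj1 (cont_eps _ _) (Hc px py (btw_l _ _) (btw_l _ _)) 1%R Rlt_0_1) as [r [Hr B]].
set (L := (1 + Rabs (x1 - px) + Rabs (y1 - py))%R).
assert (HL : (1 <= L)%R) by (unfold L; pose proof (Rabs_pos (x1 - px)); pose proof (Rabs_pos (y1 - py)); lra).
set (M := (1 + Cmod (k (px, py)))%R). assert (HM : (1 <= M)%R) by (unfold M; pose proof (Cmod_ge_0 (k (px, py))); lra).
set (s := Rmin 1 (Rmin (r / (2 * L)) (m / (4 * M * L)))).
assert (H0 : (0 < s)%R) by (repeat apply Rmin_glb_lt; try apply Rdiv_lt_0_compat; nra).
assert (H1 : (s <= 1)%R) by apply Rmin_l.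
assert (HsL : (s * L < r)%R).
{ apply Rle_lt_trans with (r / (2 * L) * L)%R. apply Rmult_le_compat_r. lra.
  eapply Rle_trans; [apply Rmin_r | apply Rmin_l]. replace (r / (2 * L) * L)%R with (r / 2)%R by (field; lra). lra. }
assert (HsM : (2 * M * (s * L) < m)%R).
{ apply Rle_lt_trans with (2 * M * (m / (4 * M * L) * L))%R.
  repeat (apply Rmult_le_compat_l || apply Rmult_le_compat_r); try lra. eapply Rle_trans; [apply Rmin_r | apply Rmin_r].
  replace (2 * M * (m / (4 * M * L) * L))%R with (m / 2)%R by (field; lra). lra. }
set (x := (px + s * (x1 - px))%R). set (y := (py + s * (y1 - py))%R).
assert (Bx : btw px x1 x) by (apply btw_affine; lra).
assert (By : btw py y1 y) by (apply btw_affine; lra).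
assert (Away : forall p q t, p <> q -> btw (p + s * (q - p)) q t -> t <> p).
{ intros p q t Hne'. unfold btw, Rmin, Rmax. intros Ht ->. destruct Rle_dec; nra. }
assert (E : rect k px x1 py y1 = rect k px x py y).
{ rewrite (rect_split_x k px x x1); auto.
  rewrite (rect_split_y k px x py y y1); auto.
  2:{ intros u v Bu Bv. apply Hc; auto. eapply btw_trans; [| |exact Bu]; auto. }
  rewrite (goursat k px x y y1), (goursat k x x1 py y1). ring.
  - intros u v Bu Bv. apply H; auto. eapply btw_trans; [| |exact Bu]; auto.
    intros E. injection E as E _. exact (Away px x1 u Hx Bu E).
  - intros u v Bu Bv. apply H. eapply btw_trans; [| |exact Bu]; auto. eapply btw_trans; [| |exact Bv]; auto.
    intros E. injection E as _ E. exact (Away py y1 v Hy Bv E). }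
assert (Len : (Rabs (x - px) + Rabs (y - py) <= s * L)%R).
{ unfold x, y, L. rewrite !Rplus_minus_l, !Rabs_mult, (Rabs_pos_eq s) by lra. lra. }
assert (m <= 2 * M * (Rabs (x - px) + Rabs (y - py)))%R; [|nra].
unfold m. rewrite E. apply rect_bound.
- intros u v Bu Bv. apply Hc; eapply btw_trans; [| |exact Bu| | |exact Bv]; auto.
- intros u v Bu Bv.
  assert (D : disc (px, py) r (u, v)).
  { unfold disc. rewrite Cminus_pair. apply btw_abs in Bu, Bv. eapply Rle_lt_trans. apply Cmod_le_sum. lra. }
  replace (k (u, v)) with ((k (u, v) - k (px, py)) + k (px, py)) by ring.
  eapply Rle_trans. apply Cmod_triangle. unfold M. apply Rplus_le_compat_r, Rlt_le, B, D.
Qed.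

(** Integrating along the two sides of a rectangle from the centre gives one
  function for the two orders of the sides; the last side gives its partial
  derivative in that direction. *)
Lemma primitive_on_disc k p r :
  (forall w, disc p r w -> cont k w) -> (forall w, disc p r w -> w <> p -> cex k w) ->
  exists K, forall w, disc p r w -> cder K w (k w).
Proof.
intros Hc Hd. destruct p as [px py].
set (K1 := fun w : C => CI (fun t => k (t, py)) px (fst w) + Ci * CI (fun t => k (fst w, t)) py (snd w)).
set (K2 := fun w : C => Ci * CI (fun t => k (px, t)) py (snd w) + CI (fun t => k (t, snd w)) px (fst w)).
assert (E : forall w, disc (px, py) r w -> K1 w = K2 w).
{ intros w Hw. apply Ceq_minus.
  replace (K1 w - K2 w) with (rect k px (fst w) py (snd w)) by (unfold rect, K1, K2; ring).
  apply goursat_corner.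
  - intros x y Bx By. apply Hc. eapply disc_btw; eauto.
  - intros x y Bx By Hne. apply Hd; auto. eapply disc_btw; eauto. }
assert (Dint : forall f a b, (exists e, (0 < e)%R /\ forall t, (Rabs (t - b) < e)%R -> forall s, btw a t s -> rcont f s) ->
  rder (fun t => CI f a t) b (f b)).
{ intros f a b [e [He H]].
  apply (is_derive_RInt (V := C_R_NormedModule) f (fun t => CI f a t) a b).
  - exists (mkposreal e He). intros t Ht. apply CI_correct. apply exCI_cont. intros s Hs. apply (H t); auto.
  - apply (H b). rewrite Rminus_diag, Rabs_R0; auto. apply btw_r. }
exists K1. intros w Hw. apply cauchy_riemann.
eapply filter_imp; [|exact (disc_open _ _ _ Hw)]. clear w Hw. intros [x y] Hv. simpl.
destruct (proj1 (locally_disc _ _) (disc_open _ _ _ Hv)) as [e [He Ho]].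
assert (Hx : forall t, (Rabs (t - x) < e)%R -> disc (px, py) r (t, y)).
{ intros t Ht. apply Ho. unfold disc. rewrite Cminus_pair, Rminus_diag.
  eapply Rle_lt_trans. apply Cmod_le_sum. rewrite Rabs_R0. lra. }
assert (Hy : forall t, (Rabs (t - y) < e)%R -> disc (px, py) r (x, t)).
{ intros t Ht. apply Ho. unfold disc. rewrite Cminus_pair, Rminus_diag.
  eapply Rle_lt_trans. apply Cmod_le_sum. rewrite Rabs_R0. lra. }
split; [|split; [|auto]].
- apply (is_derive_ext_loc (K := R_AbsRing) (V := C_R_NormedModule) (fun t => K2 (t, y))).
  { exists (mkposreal e He). intros t Ht. symmetry. apply E. apply Hx. exact Ht. }
  unfold K2; simpl. eapply rder_eq. apply rder_plus. apply rder_const.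
  apply (Dint (fun t => k (t, y))). exists e; split; auto.
  intros t Ht s Hs. apply rcont_hor. apply Hc. eapply disc_btw; [apply (Hx t Ht)| |]; simpl; auto.
  cbv beta. ring.
- unfold K1; simpl. eapply rder_eq. apply rder_plus. apply rder_const.
  apply rder_mult. apply rder_const.
  apply (Dint (fun t => k (x, t))). exists e; split; auto.
  intros t Ht s Hs. apply rcont_ver. apply Hc. eapply disc_btw; [apply (Hy t Ht)| |]; simpl; auto.
  cbv beta. ring.
Qed.

(** * Cauchy's formula and Taylor expansions *)

Definition circ (c : C) (r t : R) : C := c + (r * cos t, r * sin t)%R.

Lemma circ_rder c r t : rder (circ c r) t (Ci * (circ c r t - c)).
Proof.
unfold circ. eapply rder_eq. apply rder_plus. apply rder_const.
apply (rder_pair (fun t => r * cos t)%R (fun t => r * sin t)%R t (- r * sin t)%R (r * cos t)%R).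
auto_derive; auto; ring. auto_derive; auto; ring.
apply injective_projections; simpl; ring.
Qed.

Lemma circ_cont c r t : rcont (circ c r) t.
Proof. eapply rder_cont, circ_rder. Qed.

Lemma circ_mod c r t : (0 < r)%R -> Cmod (circ c r t - c) = r.
Proof.
intros Hr. unfold circ. assert (E : forall a b : C, a + b - a = b) by (intros; ring). rewrite E.
unfold Cmod; simpl. pose proof (sin2_cos2 t) as H. unfold Rsqr in H.
replace (r * cos t * (r * cos t * 1) + r * sin t * (r * sin t * 1))%R with (r * r)%R by nra.
apply sqrt_square. lra.
Qed.

Lemma circ_period c r : circ c r (2 * PI) = circ c r 0.
Proof. unfold circ. rewrite cos_2PI, sin_2PI, cos_0, sin_0. reflexivity. Qed.

Lemma circ_dist c r t z : (0 < r)%R -> (r - Cmod (z - c) <= Cmod (circ c r t - z))%R.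
Proof.
intros Hr. assert (T := Cmod_triangle (circ c r t - z) (z - c)).
replace (circ c r t - z + (z - c)) with (circ c r t - c) in T by ring. rewrite circ_mod in T by auto. lra.
Qed.

Lemma circ_away c r t z : (0 < r)%R -> disc c r z -> circ c r t - z <> 0.
Proof. intros Hr Hz. apply Cmod_gt_0. pose proof (circ_dist c r t z Hr). unfold disc in Hz. lra. Qed.

Lemma tangent_cont c r t : rcont (fun t => Ci * (circ c r t - c)) t.
Proof. apply (rcont_comp (fun w => Ci * (w - c)) (circ c r)). eapply cder_cont; cderiv. apply circ_cont. Qed.

Lemma circ_int0 k K c r : (forall t, cder K (circ c r t) (k (circ c r t)) /\ cont k (circ c r t)) ->
  CI (fun t => k (circ c r t) * (Ci * (circ c r t - c))) 0 (2 * PI) = 0.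
Proof.
intros HK. rewrite (CI_FTC (fun t => K (circ c r t))).
- rewrite circ_period. ring.
- intros t _. destruct (HK t) as [H1 H2]. split. apply rder_comp; auto. apply circ_rder.
  apply rcont_mult. apply rcont_comp; auto. apply circ_cont. apply tangent_cont.
Qed.

Definition cauchy (phi : R -> C) (c : C) (r : R) (n : nat) (z : C) : C :=
  CI (fun t => phi t * (/ (circ c r t - z)) ^ n) 0 (2 * PI).

Lemma cauchy_rcont phi c r n z t : (0 < r)%R -> disc c r z -> rcont phi t ->
  rcont (fun t => phi t * (/ (circ c r t - z)) ^ n) t.
Proof.
intros Hr Hz Hp. apply rcont_mult; auto.
apply (rcont_comp (fun w => (/ (w - z)) ^ n) (circ c r)); [|apply circ_cont].
assert (H := circ_away c r t z Hr Hz). eapply cder_cont. cderiv. exact H.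
Qed.

Lemma cauchy_ex phi c r n z : (0 < r)%R -> disc c r z -> (forall t, rcont phi t) ->
  exCI (fun t => phi t * (/ (circ c r t - z)) ^ n) 0 (2 * PI).
Proof. intros. apply exCI_cont. intros. apply cauchy_rcont; auto. Qed.

Lemma rcont_bounded (phi : R -> C) a b : (a <= b)%R -> (forall t, rcont phi t) ->
  exists M, (0 < M)%R /\ forall t, (a <= t <= b)%R -> (Cmod (phi t) <= M)%R.
Proof.
intros Hab H.
destruct (continuity_ab_maj (fun t => Cmod (phi t)) a b Hab) as [x [Hx _]].
{ intros t _. apply continuity_pt_filterlim.
  exact (continuous_comp (V := C_UniformSpace) phi Cmod t (H t) (rc_Cmod (phi t))). }
exists (Cmod (phi x) + 1)%R. pose proof (Cmod_ge_0 (phi x)). split. lra.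
intros t Ht. specialize (Hx t Ht). simpl in Hx. lra.
Qed.

Lemma cder_integral (H : R -> C -> C) (H' : R -> C) z A r :
  (0 < r)%R -> (0 <= A)%R ->
  (forall w, disc z r w -> exCI (fun t => H t w) 0 (2 * PI)) -> exCI H' 0 (2 * PI) ->
  (forall t w, (0 <= t <= 2 * PI)%R -> disc z r w ->
    (Cmod (H t w - H t z - (w - z) * H' t) <= A * (Cmod (w - z) * Cmod (w - z)))%R) ->
  cder (fun w => CI (fun t => H t w) 0 (2 * PI)) z (CI H' 0 (2 * PI)).
Proof.
intros Hr HA E E' B. apply cder_eps. intros eps He.
pose proof PI_RGT_0 as Hpi.
exists (Rmin r (eps / (2 * PI * (A + 1)))). split.
{ apply Rmin_glb_lt; auto. apply Rdiv_lt_0_compat; nra. }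
intros w Hw. apply Rmin_def in Hw. destruct Hw as [Hw1 Hw2].
assert (Ew := E w Hw1). assert (Ez := E z (disc_center z r Hr)). assert (Es := exCI_scal (w - z) _ _ _ E').
rewrite <- CI_scal, <- CI_minus, <- CI_minus by (auto; apply exCI_minus; auto).
eapply Rle_trans. apply (CI_bound _ _ _ (A * (Cmod (w - z) * Cmod (w - z)))).
{ apply (exCI_minus (fun t => H t w - H t z)); auto. apply exCI_minus; auto. }
{ intros t Ht. apply B; auto. unfold btw in Ht. rewrite Rmin_left, Rmax_right in Ht by lra. exact Ht. }
rewrite Rminus_0_r, Rabs_pos_eq by lra.
pose proof (Cmod_ge_0 (w - z)). set (x := Cmod (w - z)) in *.
assert (x * (2 * PI * (A + 1)) <= eps)%R.
{ apply (Rmult_le_reg_r (/ (2 * PI * (A + 1)))). apply Rinv_0_lt_compat; nra.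
  rewrite Rmult_assoc, Rinv_r by nra. unfold Rdiv in Hw2. lra. }
assert (0 <= x * x * PI)%R by (apply Rmult_le_pos; nra).
nra.
Qed.

Lemma Cinv_bound (z : C) m : (0 < m)%R -> (m <= Cmod z)%R -> (Cmod (/ z) <= / m)%R.
Proof.
intros Hm H. rewrite Cmod_inv. apply Rinv_le_contravar; auto.
apply Cmod_gt_0. lra.
Qed.

(** With [a = / (x - w)] and [b = / (x - z)] one has [a - b = (w - z) a b], so
  the remainder of the expansion of [a ^ n] at [b] contains [(w - z) ^ 2]. *)
Lemma cauchy_cder phi c r n z : (n = 1 \/ n = 2)%nat -> (0 < r)%R -> disc c r z -> (forall t, rcont phi t) ->
  cder (cauchy phi c r n) z (RtoC (INR n) * cauchy phi c r (S n) z).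
Proof.
intros Hn Hr Hz Hp. unfold cauchy.
rewrite <- CI_scal by (apply cauchy_ex; auto).
destruct (rcont_bounded phi 0 (2 * PI)) as [M [HM BM]]; auto.
{ pose proof PI_RGT_0; lra. }
set (m := ((r - Cmod (z - c)) / 2)%R). assert (Hm : (0 < m)%R) by (unfold m, disc in *; lra).
assert (Hw : forall w, disc z m w -> disc c r w /\ forall t, (m <= Cmod (circ c r t - w))%R).
{ intros w Hw. assert (D : disc c (r - m) w) by (apply (disc_trans c z m); auto; unfold m; lra).
  split. eapply disc_le; [|exact D]; lra. intros t. pose proof (circ_dist c r t w Hr). unfold disc in D. lra. }
set (u := (/ m)%R). assert (Hu : (0 < u)%R) by (apply Rinv_0_lt_compat; auto).
assert (HA : (0 <= M * (u * (u * u)) * (1 + 3 * u))%R) by (repeat apply Rmult_le_pos; lra).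
apply (cder_integral (fun t w => phi t * (/ (circ c r t - w)) ^ n)) with (2 := HA) (r := m); auto.
- intros w Hw'. apply cauchy_ex; auto. apply Hw; auto.
- apply exCI_scal. apply cauchy_ex; auto.
- intros t w Ht Hw'.
  destruct (Hw w Hw') as [D1 D2]. specialize (D2 t). destruct (Hw z (disc_center z m Hm)) as [_ D4]. specialize (D4 t).
  assert (Hn1 := circ_away c r t w Hr D1). assert (Hn2 := circ_away c r t z Hr Hz).
  set (a := / (circ c r t - w)). set (b := / (circ c r t - z)).
  assert (Ba : (Cmod a <= u)%R) by (apply Cinv_bound; auto).
  assert (Bb : (Cmod b <= u)%R) by (apply Cinv_bound; auto).
  assert (Eab : a = b + (w - z) * a * b) by (unfold a, b; field; auto).
  assert (Rest : exists X, (Cmod X <= 1 + 3 * u)%R /\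
    phi t * a ^ n - phi t * b ^ n - (w - z) * (RtoC (INR n) * (phi t * b ^ S n)) =
    (w - z) * (w - z) * (phi t * (a * (b * b)) * X)).
  { destruct Hn as [-> | ->].
    - exists 1. rewrite Cmod_1. split; [lra|]. simpl. rewrite Eab at 1. rewrite Eab at 1. ring.
    - exists (a + 2 * b). split.
      + eapply Rle_trans. apply Cmod_triangle. rewrite Cmod_mult, Cmod_R, Rabs_pos_eq; lra.
      + replace (INR 2) with 2%R by (simpl; ring). unfold a, b. simpl. field; auto. }
  destruct Rest as [X [BX EX]]. rewrite EX, !Cmod_mult. set (h := Cmod (w - z)). rewrite Rmult_comm.
  pose proof (Cmod_ge_0 a). pose proof (Cmod_ge_0 b). pose proof (Cmod_ge_0 X). pose proof (Cmod_ge_0 (phi t)).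
  apply Rmult_le_compat_r. { apply Rmult_le_pos; apply Cmod_ge_0. }
  repeat (apply Rmult_le_compat; auto; try (repeat apply Rmult_le_pos; auto)).
Qed.

Lemma holo_disc f c : holomorphic_near f c <-> exists r, (0 < r)%R /\ forall w, disc c r w -> cex f w.
Proof. apply locally_disc. Qed.

Lemma constant_on_disc F c r : (forall w, disc c r w -> cder F w 0) -> forall b, disc c r b -> F c = F b.
Proof.
intros H b Hb.
assert (A := zero_derivative_constant (fun t => F (c + RtoC t * (b - c))) 0 1).
replace (F c) with (F (c + RtoC 0 * (b - c))) by (f_equal; ring). replace (F b) with (F (c + RtoC 1 * (b - c))) by (f_equal; ring).
apply A. intros t Ht. unfold btw in Ht. rewrite Rmin_left, Rmax_right in Ht by lra.
eapply rder_eq. apply (rder_comp F (fun t => c + RtoC t * (b - c))); [apply H|].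
- unfold disc in *. replace (c + RtoC t * (b - c) - c) with (RtoC t * (b - c)) by ring.
  rewrite Cmod_mult, Cmod_R, Rabs_pos_eq by lra. pose proof (Cmod_ge_0 (b - c)). nra.
- apply rder_plus. apply rder_const. apply rder_mult. apply rder_id. apply rder_const.
- cbv beta. ring.
Qed.

Lemma CI_const (k : C) a b : CI (fun _ => k) a b = RtoC (b - a) * k.
Proof.
rewrite (CI_FTC (fun t => RtoC t * k)).
- rewrite RtoC_minus. ring.
- intros t _. split; [|eapply rder_cont, rder_const]. eapply rder_eq. apply rder_mult.
  apply rder_id. apply rder_const. cbv beta; ring.
Qed.

(** The integral is constant on the disc, because its derivative is the integral
  of a function with a primitive, and it is obvious at the centre. *)
Lemma winding_one c r z : (0 < r)%R -> disc c r z ->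
  cauchy (fun t => Ci * (circ c r t - c)) c r 1 z = RtoC (2 * PI) * Ci.
Proof.
intros Hr Hz.
rewrite <- (constant_on_disc (cauchy (fun t => Ci * (circ c r t - c)) c r 1) c r) with (b := z); auto.
- unfold cauchy. rewrite (CI_ext _ (fun _ => Ci)).
  + rewrite CI_const. replace (2 * PI - 0)%R with (2 * PI)%R by ring. reflexivity.
  + intros t _. simpl. field. apply circ_away; auto. apply disc_center; auto.
- intros w Hw. eapply cder_eq. apply cauchy_cder; auto. apply tangent_cont.
  unfold cauchy. rewrite (CI_ext _ (fun t => (/ (circ c r t - w)) ^ 2 * (Ci * (circ c r t - c)))) by (intros; ring).
  rewrite (circ_int0 (fun u => (/ (u - w)) ^ 2) (fun u => - (/ (u - w)))); auto. ring.
  intros t. assert (H := circ_away c r t w Hr Hw). split.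
  + eapply cder_eq. cderiv. exact H. simpl. field. auto.
  + eapply cder_cont. cderiv. exact H.
Qed.

Definition cauchy_density (f : C -> C) (c : C) (r : R) (t : R) : C :=
  f (circ c r t) * (circ c r t - c) * RtoC (/ (2 * PI)).

Lemma cauchy_density_cont f c (rho r : R) : (0 < r < rho)%R -> (forall w, disc c rho w -> cex f w) ->
  forall t, rcont (cauchy_density f c r) t.
Proof.
intros Hr H t. apply (rcont_comp (fun w => f w * (w - c) * RtoC (/ (2 * PI))) (circ c r)); [|apply circ_cont].
apply cex_cont. destruct (H (circ c r t)) as [l Hl]. { unfold disc. rewrite circ_mod; lra. }
eexists. cderiv.
Qed.

(** The difference quotient of [f] at [z], extended by the derivative, is
  continuous, and holomorphic except at [z]: it has a primitive on the disc of
  radius [3 rho / 4] around [z], which contains the circle of radius [rho / 2]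
  around [c]. *)
Lemma cauchy_formula f c (rho : R) z : (0 < rho)%R -> (forall w, disc c rho w -> cex f w) -> disc c (rho / 4) z ->
  f z = cauchy (cauchy_density f c (rho / 2)) c (rho / 2) 1 z.
Proof.
intros HR H Hz. set (r := (rho / 2)%R).
assert (Hr : (0 < r < rho)%R) by (unfold r; lra). assert (Hr0 := proj1 Hr).
assert (Hzr : disc c r z). { eapply disc_le; [|exact Hz]. unfold r; lra. }
destruct (H z) as [l Hl]. { eapply disc_le; [|exact Hz]. lra. }
set (k := fun w => if excluded_middle_informative (w = z) then l else (f w - f z) / (w - z)).
assert (Hoff : forall w, disc z (3 * rho / 4) w -> w <> z -> cex k w).
{ intros w Hw Hne. destruct (H w) as [l' Hl']. { apply (disc_trans c z (3 * rho / 4)); auto. unfold disc in Hz. lra. }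
  assert (Hnz : w - z <> 0) by (apply Cminus_eq_contra; auto).
  eexists. apply (cder_ext (fun w => (f w - f z) / (w - z))).
  - apply locally_disc. exists (Cmod (w - z)). split. apply Cmod_gt_0; auto.
    intros u Hu. unfold k. destruct excluded_middle_informative as [->|]; auto.
    exfalso. unfold disc in Hu. rewrite Cmod_sym in Hu. lra.
  - cderiv. exact Hnz. }
assert (Hcz : cont k z).
{ apply cont_eps. intros eps He.
  destruct (proj1 (cder_eps _ _ _) Hl (eps / 2)%R) as [d [Hd B]]. lra.
  exists d. split; auto. intros w Hw. unfold k. destruct (excluded_middle_informative (z = z)); [|tauto].
  destruct excluded_middle_informative as [->|Hne]. { apply disc_center; auto. }
  assert (Hnz : w - z <> 0) by (apply Cminus_eq_contra; auto).
  specialize (B w Hw). apply Cmod_gt_0 in Hnz as Hm. unfold disc.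
  replace ((f w - f z) / (w - z) - l) with ((f w - f z - (w - z) * l) / (w - z)) by (field; auto).
  rewrite Cmod_div by auto. apply (Rmult_lt_reg_r (Cmod (w - z))); auto.
  unfold Rdiv. rewrite Rmult_assoc, Rinv_l, Rmult_1_r by lra. nra. }
assert (Hk : forall w, disc z (3 * rho / 4) w -> cont k w).
{ intros w Hw. destruct (classic (w = z)) as [->|Hne]; auto. apply cex_cont; auto. }
destruct (primitive_on_disc k z (3 * rho / 4) Hk Hoff) as [K HK].
assert (Hcirc : forall t, disc z (3 * rho / 4) (circ c r t)).
{ intros t. unfold disc in *. replace (circ c r t - z) with ((circ c r t - c) + - (z - c)) by ring.
  eapply Rle_lt_trans. apply Cmod_triangle. rewrite circ_mod, Cmod_opp by auto. unfold r. lra. }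
assert (I0 := circ_int0 k K c r (fun t => conj (HK _ (Hcirc t)) (Hk _ (Hcirc t)))).
assert (Hpi : RtoC (2 * PI) <> 0) by (intros E; apply RtoC_inj in E; pose proof PI_RGT_0; lra).
rewrite (CI_ext _ (fun t => (RtoC (2 * PI) * Ci) * (cauchy_density f c r t * (/ (circ c r t - z)) ^ 1)
   - f z * (Ci * (circ c r t - c) * (/ (circ c r t - z)) ^ 1))) in I0.
2:{ intros t _. assert (Hn := circ_away c r t z Hr0 Hzr). unfold k, cauchy_density.
    destruct excluded_middle_informative as [E|Hne].
    { exfalso. apply Hn. rewrite E. ring. }
    rewrite RtoC_inv by (apply Rgt_not_eq; pose proof PI_RGT_0; lra). simpl. field. auto. }
assert (E1 := cauchy_ex _ c r 1 z Hr0 Hzr (cauchy_density_cont f c rho r Hr H)).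
assert (E2 := cauchy_ex _ c r 1 z Hr0 Hzr (tangent_cont c r)).
rewrite CI_minus, (CI_scal _ _ _ _ E1), (CI_scal _ _ _ _ E2) in I0 by (apply exCI_scal; auto).
assert (W := winding_one c r z Hr0 Hzr). unfold cauchy in W |- *. rewrite W in I0.
set (X := CI _ _ _) in *.
replace (f z) with (X - (RtoC (2 * PI) * Ci * X - f z * (RtoC (2 * PI) * Ci)) / (RtoC (2 * PI) * Ci)) by (field; auto using Ci_nz).
rewrite I0. field. auto using Ci_nz.
Qed.

(** Integral form of the [n]-th Taylor remainder divided by [(z - c) ^ n]. *)
Definition taylor_rest (f : C -> C) (c : C) (r : R) (n : nat) : C -> C :=
  cauchy (fun t => cauchy_density f c r t * (/ (circ c r t - c)) ^ n) c r 1.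

Lemma taylor_density_cont f c (rho r : R) n : (0 < r < rho)%R -> (forall w, disc c rho w -> cex f w) ->
  forall t, rcont (fun t => cauchy_density f c r t * (/ (circ c r t - c)) ^ n) t.
Proof.
intros Hr H t. apply cauchy_rcont. lra. apply disc_center; lra. eapply cauchy_density_cont; eauto.
Qed.

Lemma taylor_step f c (rho r : R) n z : (0 < r < rho)%R -> (forall w, disc c rho w -> cex f w) -> disc c r z ->
  taylor_rest f c r n z = taylor_rest f c r n c + (z - c) * taylor_rest f c r (S n) z.
Proof.
intros Hr H Hz. assert (D := fun n => taylor_density_cont f c rho r n Hr H).
assert (Hc : disc c r c) by (apply disc_center; lra).
unfold taylor_rest, cauchy.
assert (X := fun k y (Hy : disc c r y) => cauchy_ex _ c r 1 y (proj1 Hr) Hy (D k)).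
rewrite <- CI_scal by (apply X; auto). rewrite <- CI_plus; [|apply X; auto | apply exCI_scal, X; auto].
apply CI_ext. intros t _.
assert (N1 := circ_away c r t z ltac:(lra) Hz). assert (N2 := circ_away c r t c ltac:(lra) Hc).
simpl. field. auto.
Qed.

Lemma taylor_bound f c (rho r : R) : (0 < r < rho)%R -> (forall w, disc c rho w -> cex f w) ->
  exists M, (0 < M)%R /\ forall n z, disc c (r / 2) z -> (Cmod (taylor_rest f c r n z) <= M * (/ r) ^ n)%R.
Proof.
intros Hr H. pose proof PI_RGT_0 as Hpi.
destruct (rcont_bounded (cauchy_density f c r) 0 (2 * PI)) as [M [HM BM]].
lra. eapply cauchy_density_cont; eauto.
assert (Hi : (0 < / r)%R) by (apply Rinv_0_lt_compat; lra).
assert (Hi2 : (0 < / (r / 2))%R) by (apply Rinv_0_lt_compat; lra).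
exists (2 * PI * (M * (/ (r / 2))))%R. split.
{ apply Rmult_lt_0_compat; [|apply Rmult_lt_0_compat]; lra. }
intros n z Hz.
assert (Hzr : disc c r z) by (eapply disc_le; [|exact Hz]; lra).
eapply Rle_trans. apply CI_bound with (M := (M * (/ r) ^ n * (/ (r / 2)))%R).
{ apply cauchy_ex; auto; try lra. eapply taylor_density_cont; eauto. }
- intros t Ht. unfold btw in Ht. rewrite Rmin_left, Rmax_right in Ht by lra.
  rewrite !Cmod_mult, Cpow_1_r, Cmod_pow, (Cmod_inv (circ c r t - c)), circ_mod
    by (try apply circ_away; try apply disc_center; lra).
  assert (0 <= (/ r) ^ n)%R by (apply pow_le; lra).
  apply Rmult_le_compat; try (repeat apply Rmult_le_pos; auto; apply Cmod_ge_0).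
  + apply Rmult_le_compat_r; auto.
  + apply Cinv_bound. lra. eapply Rle_trans; [|apply circ_dist; lra]. unfold disc in Hz. lra.
- rewrite Rminus_0_r, Rabs_pos_eq by lra. right. ring.
Qed.

Lemma holo_deriv f c : holomorphic_near f c ->
  exists f', holomorphic_near f' c /\ locally c (fun z : C => cder f z (f' z)).
Proof.
intros H. apply holo_disc in H. destruct H as [rho [Hrho H]].
set (r := (rho / 2)%R). assert (Hr : (0 < r < rho)%R) by (unfold r; lra).
assert (D := cauchy_density_cont f c rho r Hr H).
exists (cauchy (cauchy_density f c r) c r 2). split.
- apply holo_disc. exists r. split. lra. intros w Hw. eexists. apply cauchy_cder; auto. lra.
- apply locally_disc. exists (rho / 4)%R. split. lra. intros z Hz.
  apply (cder_ext (cauchy (cauchy_density f c r) c r 1)).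
  + eapply filter_imp; [|exact (disc_open _ _ _ Hz)]. intros w Hw. symmetry. apply cauchy_formula; auto.
  + eapply cder_eq. apply cauchy_cder; auto. lra. eapply disc_le; [|exact Hz]. unfold r; lra. simpl. ring.
Qed.

(** A zero of infinite order forces [f = 0]: the remainders of Taylor's formula
  are bounded by a geometric sequence. *)
Lemma zero_dichotomy f c : holomorphic_near f c ->
  locally c (fun z : C => f z = 0) \/
  exists n v, holomorphic_near v c /\ v c <> 0 /\ locally c (fun z : C => f z = (z - c) ^ n * v z).
Proof.
intros H. apply holo_disc in H. destruct H as [rho [Hrho H]].
set (r := (rho / 2)%R). assert (Hr : (0 < r < rho)%R) by (unfold r; lra).
assert (Expand : forall n, (forall k, (k < n)%nat -> taylor_rest f c r k c = 0) ->
  forall z, disc c (rho / 4) z -> f z = (z - c) ^ n * taylor_rest f c r n z).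
{ induction n as [|n IH]; intros Hn z Hz.
  - rewrite (cauchy_formula f c rho z) by auto. rewrite Cmult_1_l. unfold taylor_rest. f_equal.
    apply functional_extensionality. intros t. fold r. cbn [Cpow]. ring.
  - rewrite IH by (auto; intros; apply Hn; lia). rewrite (taylor_step f c rho r n z); auto.
    rewrite Hn by lia. rewrite Cpow_S. ring. eapply disc_le; [|exact Hz]. unfold r; lra. }
destruct (classic (exists n, taylor_rest f c r n c <> 0)) as [Hex|Hno].
- right.
  assert (exists n, taylor_rest f c r n c <> 0 /\ forall k, (k < n)%nat -> taylor_rest f c r k c = 0) as [n [Hn Hmin]].
  { destruct Hex as [n Hn]. revert Hn. pattern n. apply (well_founded_induction lt_wf). clear n.
    intros n IH Hn. destruct (classic (exists k, (k < n)%nat /\ taylor_rest f c r k c <> 0)) as [[k [Hk Hk']]|Hk].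
    apply (IH k); auto. exists n. split; auto. intros k Hkn. apply NNPP. intros E. apply Hk. exists k; auto. }
  exists n, (taylor_rest f c r n). split; [|split]; auto.
  + apply holo_disc. exists r. split. lra. intros w Hw. eexists. apply cauchy_cder; auto; try lra.
    eapply taylor_density_cont; eauto.
  + apply locally_disc. exists (rho / 4)%R. split. lra. intros z Hz. apply Expand; auto.
- left. assert (Hz0 : forall n, taylor_rest f c r n c = 0).
  { intros n. apply NNPP. intros E. apply Hno. exists n; auto. }
  destruct (taylor_bound f c rho r Hr H) as [M [HM B]].
  apply locally_disc. exists (rho / 4)%R. split. lra. intros z Hz.
  apply NNPP. intros Hne. apply Cmod_gt_0 in Hne.
  set (q := (Cmod (z - c) * / r)%R). pose proof (Cmod_ge_0 (z - c)) as Hpos.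
  assert (Hir : (0 < / r)%R) by (apply Rinv_0_lt_compat; lra).
  assert (Hq : (0 <= q < 1)%R).
  { unfold q. split. apply Rmult_le_pos; lra. apply (Rmult_lt_reg_r r). lra.
    rewrite Rmult_assoc, Rinv_l by lra. unfold disc in Hz. unfold r. lra. }
  destruct (pow_lt_1_zero q) with (y := (Cmod (f z) / M)%R) as [n Hn].
  { rewrite Rabs_pos_eq; lra. } { apply Rdiv_lt_0_compat; auto. }
  specialize (Hn n (Nat.le_refl n)). rewrite Rabs_pos_eq in Hn by (apply pow_le; lra).
  assert (Cmod (f z) <= q ^ n * M)%R.
  { rewrite (Expand n) by auto. rewrite Cmod_mult, Cmod_pow. unfold q. rewrite Rpow_mult_distr, Rmult_assoc.
    apply Rmult_le_compat_l. apply pow_le; auto. rewrite Rmult_comm. apply B.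
    eapply disc_le; [|exact Hz]. unfold r; lra. }
  apply (Rmult_lt_compat_r M) in Hn; auto. unfold Rdiv in Hn. rewrite Rmult_assoc, Rinv_l, Rmult_1_r in Hn by lra. lra.
Qed.

(** * Holomorphic and meromorphic germs *)

Lemma locally_and {c : C} {P Q : C -> Prop} : locally c P -> locally c Q -> locally c (fun z : C => P z /\ Q z).
Proof. apply filter_and. Qed.

Lemma locally_here {c : C} {P : C -> Prop} : locally c P -> P c.
Proof. apply locally_singleton. Qed.

Lemma locally_near {c : C} {P : C -> Prop} : locally c P -> locally c (fun z : C => locally z P).
Proof. apply locally_locally. Qed.

Lemma locally_cont (f : C -> C) {c : C} {P : C -> Prop} : cont f c -> locally (f c) P -> locally c (fun z : C => P (f z)).
Proof. intros H HP. apply (H P HP). Qed.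

Lemma locally_eq_sym {c : C} {f g : C -> C} : locally c (fun z : C => f z = g z) -> locally c (fun z : C => g z = f z).
Proof. apply filter_imp. auto. Qed.

(** Reduces a statement near a point to the statement [H] near that point. *)
Ltac near H := eapply filter_imp; [|exact H].

Lemma holo_cont f c : holomorphic_near f c -> cont f c.
Proof. intros H. apply cex_cont. exact (locally_here H). Qed.

Lemma holo_mk f f' c : locally c (fun z : C => cder f z (f' z)) -> holomorphic_near f c.
Proof. intros H. unfold holomorphic_near. near H. intros z Hz. exists (f' z); exact Hz. Qed.

Lemma holo_on_disc f p r c : (forall w, disc p r w -> cex f w) -> disc p r c -> holomorphic_near f c.
Proof. intros H Hc. unfold holomorphic_near. near (disc_open _ _ _ Hc). exact H. Qed.

Lemma holo_const k c : holomorphic_near (fun _ => k) c.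
Proof. apply (holo_mk _ (fun _ => 0)), filter_forall. intros; apply cder_const. Qed.

Lemma holo_id c : holomorphic_near (fun z => z) c.
Proof. apply (holo_mk _ (fun _ => 1)), filter_forall. intros; apply cder_id. Qed.

(* differentiability near a point from [H] near that point and the pointwise rule *)
Ltac holo_from H rule := unfold holomorphic_near; near H; intros z Hz; cbv beta in Hz;
  repeat match goal with X : _ /\ _ |- _ => destruct X | X : ex_derive _ _ |- _ => destruct X end;
  eexists; apply rule; eassumption.

Lemma holo_plus f g c : holomorphic_near f c -> holomorphic_near g c -> holomorphic_near (fun z => f z + g z) c.
Proof. intros H1 H2. holo_from (locally_and H1 H2) cder_plus. Qed.

Lemma holo_minus f g c : holomorphic_near f c -> holomorphic_near g c -> holomorphic_near (fun z => f z - g z) c.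
Proof. intros H1 H2. holo_from (locally_and H1 H2) cder_minus. Qed.

Lemma holo_mult f g c : holomorphic_near f c -> holomorphic_near g c -> holomorphic_near (fun z => f z * g z) c.
Proof. intros H1 H2. holo_from (locally_and H1 H2) cder_mult. Qed.

Lemma holo_pow f n c : holomorphic_near f c -> holomorphic_near (fun z => f z ^ n) c.
Proof. intros H. holo_from H cder_pow. Qed.

Lemma cont_nonzero f c : cont f c -> f c <> 0 -> locally c (fun z : C => f z <> 0).
Proof.
intros H Hn. apply (H (fun y : C => y <> 0)). apply locally_disc. exists (Cmod (f c)). split.
apply Cmod_gt_0; auto. intros w Hw ->. unfold disc in Hw. rewrite Cmod_sym in Hw.
replace (f c - 0) with (f c) in Hw by ring. lra.
Qed.

Lemma holo_nonzero f c : holomorphic_near f c -> f c <> 0 -> locally c (fun z : C => f z <> 0).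
Proof. intros H. apply cont_nonzero, holo_cont, H. Qed.

Lemma holo_inv f c : holomorphic_near f c -> f c <> 0 -> holomorphic_near (fun z => / f z) c.
Proof. intros H Hn. holo_from (locally_and H (holo_nonzero f c H Hn)) cder_inv. Qed.

Lemma holo_div f g c : holomorphic_near f c -> holomorphic_near g c -> g c <> 0 -> holomorphic_near (fun z => f z / g z) c.
Proof. intros. apply holo_mult; auto. apply holo_inv; auto. Qed.

Lemma holo_comp f g c : holomorphic_near f (g c) -> holomorphic_near g c -> holomorphic_near (fun z => f (g z)) c.
Proof. intros H1 H2. holo_from (locally_and H2 (locally_cont g (holo_cont g c H2) H1)) cder_comp. Qed.

(** Leaves the holomorphy of the atoms and the nonvanishing of denominators. *)
Ltac holo :=
  lazymatch goal with
  | |- holomorphic_near (fun w => w) _ => apply holo_id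
  | |- holomorphic_near (fun _ => ?c) _ => apply (holo_const c)
  | |- holomorphic_near (fun w => @?f w + @?g w) _ => apply (holo_plus f g); holo
  | |- holomorphic_near (fun w => @?f w - @?g w) _ => apply (holo_minus f g); holo
  | |- holomorphic_near (fun w => @?f w * @?g w) _ => apply (holo_mult f g); holo
  | |- holomorphic_near (fun w => @?f w / @?g w) _ => apply (holo_div f g); [holo | holo | ]
  | |- holomorphic_near (fun w => / @?f w) _ => apply (holo_inv f); [holo | ]
  | |- holomorphic_near (fun w => @?f w ^ ?n) _ => apply (holo_pow f); holo
  | |- _ => try assumption
  end.

Lemma identity_theorem f c : holomorphic_near f c ->
  (forall e : R, (0 < e)%R -> exists z, z <> c /\ disc c e z /\ f z = 0) -> locally c (fun z : C => f z = 0).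
Proof.
intros H Hacc. destruct (zero_dichotomy f c H) as [|[n [v [Hv [Hvc E]]]]]; auto.
exfalso. assert (L := locally_and E (holo_nonzero v c Hv Hvc)).
apply locally_disc in L. destruct L as [r [Hr L]].
destruct (Hacc r Hr) as [z [Hz [Hd Hf]]]. destruct (L z Hd) as [E1 E2]. rewrite Hf in E1.
symmetry in E1. revert E1. apply Cmult_neq_0; auto. apply Cpow_nz, Cminus_eq_contra; auto.
Qed.

Lemma holo_injective_at f c l : holomorphic_near f c -> cder f c l -> l <> 0 ->
  locally c (fun w : C => w <> c -> f w <> f c).
Proof.
intros Hf Hl Hn. apply NNPP. intros Hno. apply Hn. apply (cder_unique f c); auto.
apply (cder_ext (fun _ => f c)); [|apply cder_const].
assert (I : locally c (fun z : C => f z - f c = 0)).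
{ apply (identity_theorem (fun z => f z - f c)). { holo. }
  intros e He. apply NNPP. intros H. apply Hno. apply locally_disc. exists e. split; auto.
  intros w Hw Hwc E. apply H. exists w. repeat split; auto. rewrite E. ring. }
near I. intros w Hw. symmetry. apply Ceq_minus. exact Hw.
Qed.

Definition mero_at (f : C -> C) (c : C) : Prop := exists (n : nat) (g : C -> C),
  holomorphic_near g c /\ locally c (fun z : C => z <> c -> f z = g z / (z - c) ^ n).

Lemma mero_ext f g c : locally c (fun z : C => z <> c -> f z = g z) -> mero_at f c -> mero_at g c.
Proof.
intros E [n [h [H1 H2]]]. exists n, h. split; auto.
near (locally_and E H2). intros z [E1 E2] Hz. rewrite <- E1; auto.
Qed.

Lemma holo_mero f c : holomorphic_near f c -> mero_at f c.
Proof. intros H. exists 0%nat, f. split; auto. apply filter_forall. intros z _. simpl. field. Qed.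

Lemma mero_plus f g c : mero_at f c -> mero_at g c -> mero_at (fun z => f z + g z) c.
Proof.
intros [n1 [f1 [H1 E1]]] [n2 [f2 [H2 E2]]].
exists (n1 + n2)%nat, (fun z => f1 z * (z - c) ^ n2 + f2 z * (z - c) ^ n1). split. { holo. }
near (locally_and E1 E2). intros z [A1 A2] Hz. rewrite A1, A2, Cpow_add_r by auto.
field. split; apply Cpow_nz, Cminus_eq_contra; auto.
Qed.

Lemma mero_mult f g c : mero_at f c -> mero_at g c -> mero_at (fun z => f z * g z) c.
Proof.
intros [n1 [f1 [H1 E1]]] [n2 [f2 [H2 E2]]]. exists (n1 + n2)%nat, (fun z => f1 z * f2 z). split. { holo. }
near (locally_and E1 E2). intros z [A1 A2] Hz. rewrite A1, A2, Cpow_add_r by auto.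
field. split; apply Cpow_nz, Cminus_eq_contra; auto.
Qed.

Lemma mero_pow f n c : mero_at f c -> mero_at (fun z => f z ^ n) c.
Proof.
intros H. induction n as [|n IH]. { exact (holo_mero (fun _ => 1) c (holo_const 1 c)). }
exact (mero_mult f (fun z => f z ^ n) c H IH).
Qed.

Lemma Cinv_0 : / (RtoC 0) = 0.
Proof. apply injective_projections; simpl; unfold Rdiv; ring. Qed.

(** With the convention [/ 0 = 0] this also holds where [f] vanishes identically. *)
Lemma mero_inv f c : mero_at f c -> mero_at (fun z => / f z) c.
Proof.
intros [n [g [H E]]]. destruct (zero_dichotomy g c H) as [Hz|[m [v [Hv [Hvc Ev]]]]].
- apply (mero_ext (fun _ => 0)); [|apply holo_mero, holo_const].
  near (locally_and E Hz). intros z [A1 A2] Hzc.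
  rewrite A1, A2 by auto. unfold Cdiv. rewrite Cmult_0_l, Cinv_0. reflexivity.
- exists m, (fun z => (z - c) ^ n / v z). split. { holo. auto. }
  near (locally_and E (locally_and Ev (holo_nonzero v c Hv Hvc))). intros z [A1 [A2 A3]] Hzc.
  rewrite A1, A2 by auto. field. repeat split; auto; apply Cpow_nz, Cminus_eq_contra; auto.
Qed.

Lemma mero_affine f (a b c : C) : b <> 0 -> mero_at f (a + b * c) -> mero_at (fun z => f (a + b * z)) c.
Proof.
intros Hb [n [g [H E]]].
assert (Haff : holomorphic_near (fun z => a + b * z) c) by holo.
exists n, (fun z => g (a + b * z) / b ^ n). split.
- apply holo_div; try apply Cpow_nz; auto; [|holo]. exact (holo_comp g _ c H Haff).
- near (locally_cont _ (holo_cont _ _ Haff) E). intros z Hz Hzc. rewrite Hz.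
  + replace (a + b * z - (a + b * c)) with (b * (z - c)) by ring. rewrite Cpow_mult_l. field.
    split; apply Cpow_nz; auto. apply Cminus_eq_contra; auto.
  + intros E'. apply Hzc. apply Ceq_minus. apply Ceq_minus in E'.
    replace (z - c) with ((a + b * z - (a + b * c)) / b) by (field; auto). rewrite E'. field; auto.
Qed.

(** * Orders of vanishing at the origin *)

Lemma Cinv_nz (z : C) : z <> 0 -> / z <> 0.
Proof. intros Hz E. apply C1_nz. rewrite <- (Cinv_r z Hz), E. ring. Qed.

Lemma Cdiv_nz (x z : C) : x <> 0 -> z <> 0 -> x / z <> 0.
Proof. intros Hx Hz. apply Cmult_neq_0; auto. apply Cinv_nz; auto. Qed.

Lemma Copp_nz (z : C) : z <> 0 -> - z <> 0.
Proof. intros Hz E. apply Hz. replace z with (- - z) by ring. rewrite E. ring. Qed.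

Lemma RtoC_neq (x y : R) : x <> y -> RtoC x <> RtoC y.
Proof. intros H E. apply H, RtoC_inj, E. Qed.

Definition nC (n : nat) : C := RtoC (INR n).

Lemma nC_plus n m : nC (n + m) = nC n + nC m.
Proof. unfold nC. rewrite plus_INR, RtoC_plus. reflexivity. Qed.

Lemma nC_mult n m : nC (n * m) = nC n * nC m.
Proof. unfold nC. rewrite mult_INR, RtoC_mult. reflexivity. Qed.

Lemma nC_inj n m : nC n = nC m -> n = m.
Proof. intros E. apply RtoC_inj, INR_eq in E. exact E. Qed.

Lemma nC_nz n : (0 < n)%nat -> nC n <> 0.
Proof. intros H E. apply lt_0_INR in H. apply RtoC_inj in E. lra. Qed.

Lemma Cpow_pred (z : C) n : (0 < n)%nat -> z <> 0 -> z ^ (n - 1) = z ^ n / z.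
Proof. intros Hn Hz. destruct n; [lia|]. replace (S n - 1)%nat with n by lia. rewrite Cpow_S. field. auto. Qed.

Lemma cder_powC (f : C -> C) z df n : f z <> 0 -> cder f z df ->
  cder (fun w => f w ^ n) z (nC n * f z ^ n / f z * df).
Proof.
intros Hn H. eapply cder_eq. apply cder_pow; eassumption. fold (nC n).
destruct n as [|n]. { unfold nC; simpl. field. auto. }
rewrite Cpow_pred by (auto; lia). field. auto.
Qed.

Lemma disc0_real r x : (0 <= x < r)%R -> disc 0 r (RtoC x).
Proof. intros H. unfold disc. replace (RtoC x - 0) with (RtoC x) by ring. rewrite Cmod_R, Rabs_pos_eq; lra. Qed.

Lemma locally_disc0 (r : R) : (0 < r)%R -> locally (RtoC 0) (disc 0 r).
Proof. intros H. apply locally_disc. exists r; auto. Qed.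

Lemma locally_exists (Q : C -> Prop) : locally (RtoC 0) Q -> exists w : C, w <> 0 /\ Q w.
Proof.
intros H. apply locally_disc in H. destruct H as [r [Hr H]]. exists (RtoC (r / 2)). split.
apply RtoC_neq; lra. apply H, disc0_real; lra.
Qed.

Lemma locally_punctured (Q : C -> Prop) : locally (RtoC 0) (fun w : C => w <> 0 -> Q w) ->
  locally (RtoC 0) (fun w : C => w <> 0 -> locally w Q).
Proof.
intros H. near (locally_near H). intros w Hw Hn.
assert (N : locally w (fun z : C => z <> 0)) by (apply (cont_nonzero (fun z => z)); auto; apply holo_cont; holo).
near (locally_and Hw N). intros z [H1 H2]. exact (H1 H2).
Qed.

Lemma punctured_limit f g : cont f 0 -> cont g 0 -> locally (RtoC 0) (fun w : C => w <> 0 -> f w = g w) -> f 0 = g 0.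
Proof.
intros Hf Hg E. apply NNPP. intros Hn. apply Cminus_eq_contra in Hn.
assert (N := cont_nonzero _ 0 (cont_minus f g 0 Hf Hg) Hn).
destruct (locally_exists _ (locally_and E N)) as [w [Hw [E1 E2]]]. apply E2. rewrite E1 by auto. ring.
Qed.

Lemma order_le n m (f g : C -> C) : cont f 0 -> cont g 0 -> f 0 <> 0 ->
  locally (RtoC 0) (fun w : C => w <> 0 -> w ^ n * f w = w ^ m * g w) -> (m <= n)%nat.
Proof.
intros Hf Hg Hf0 E. destruct (le_lt_dec m n) as [|Hlt]; auto. exfalso. apply Hf0.
transitivity ((0 : C) ^ (m - n) * g 0).
- apply (punctured_limit f (fun w => w ^ (m - n) * g w)); auto.
  + apply cont_mult; auto. apply holo_cont; holo.
  + near E. intros w Hw Hn. specialize (Hw Hn).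
    replace m with (n + (m - n))%nat in Hw by lia. rewrite Cpow_add_r in Hw.
    assert (Hp := Cpow_nz w n Hn).
    replace (f w) with (w ^ n * f w / w ^ n) by (field; auto). rewrite Hw. field. auto.
- destruct (m - n)%nat eqn:Emn. lia. rewrite Cpow_S. ring.
Qed.

Lemma order_unique n m (f g : C -> C) : cont f 0 -> cont g 0 -> f 0 <> 0 -> g 0 <> 0 ->
  locally (RtoC 0) (fun w : C => w <> 0 -> w ^ n * f w = w ^ m * g w) -> n = m.
Proof.
intros Hf Hg Hf0 Hg0 E. apply Nat.le_antisymm; [apply (order_le m n g f) | apply (order_le n m f g)]; auto.
near E. intros w Hw Hn. symmetry; auto.
Qed.

Lemma zero_order f : holomorphic_near f 0 -> locally (RtoC 0) (fun z : C => f z = 0) \/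
  exists n v, holomorphic_near v 0 /\ v 0 <> 0 /\ locally (RtoC 0) (fun z : C => f z = z ^ n * v z).
Proof.
intros H. destruct (zero_dichotomy f 0 H) as [|[n [v [Hv [Hv0 E]]]]]; auto. right.
exists n, v. repeat split; auto. near E. intros z Hz. rewrite Hz. f_equal. f_equal. ring.
Qed.

(** [D' = u ^ (n - 1) (n v + u v')], where the second factor is not zero at [0]. *)
Lemma order_deriv (D v r : C -> C) n m : holomorphic_near v 0 -> v 0 <> 0 -> D 0 = 0 -> cont r 0 ->
  locally (RtoC 0) (fun z : C => D z = z ^ n * v z) -> locally (RtoC 0) (fun u : C => u <> 0 -> cder D u (u ^ m * r u)) ->
  (0 < n)%nat /\ (m <= n - 1)%nat /\ (r 0 <> 0 -> n = S m /\ nC n * v 0 = r 0).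
Proof.
intros Hv Hv0 D0 Hr HDv HDr. destruct (holo_deriv v 0 Hv) as [v' [Hv' Dv]].
assert (Hn : (0 < n)%nat).
{ destruct n; [|lia]. exfalso. apply Hv0. apply locally_here in HDv. cbv beta in HDv. rewrite D0, Cmult_1_l in HDv. auto. }
assert (A : cont (fun u => nC n * v u + u * v' u) 0) by (apply holo_cont; holo).
assert (A0 : nC n * v 0 + 0 * v' 0 = nC n * v 0) by ring.
assert (N0 : nC n * v 0 + 0 * v' 0 <> 0) by (rewrite A0; apply Cmult_neq_0; auto; apply nC_nz; auto).
assert (E : locally (RtoC 0) (fun u : C => u <> 0 -> u ^ (n - 1) * (nC n * v u + u * v' u) = u ^ m * r u)).
{ near (locally_and (locally_near HDv) (locally_and HDr Dv)).
  intros u [L [B1 B2]] Hu.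
  assert (X : cder D u (nC n * u ^ n / u * 1 * v u + u ^ n * v' u)).
  { apply (cder_ext (fun u => u ^ n * v u)). exact (locally_eq_sym L).
    apply cder_mult; auto. apply (cder_powC (fun u => u)); auto. apply cder_id. }
  rewrite <- (cder_unique _ _ _ _ X (B1 Hu)), Cpow_pred by auto. field. auto. }
split; [exact Hn | split].
- apply (order_le (n - 1) m (fun u => nC n * v u + u * v' u) r); auto.
- intros Hr0. assert (Em : (n - 1 = m)%nat) by (apply (order_unique (n - 1) m (fun u => nC n * v u + u * v' u) r); auto).
  split. lia. rewrite <- A0. apply (punctured_limit (fun u => nC n * v u + u * v' u) r); auto.
  near E. intros u Eu Hu. specialize (Eu Hu). rewrite <- Em in Eu. assert (Hp := Cpow_nz u (n - 1) Hu).
  replace (r u) with (u ^ (n - 1) * r u / u ^ (n - 1)) by (field; auto). rewrite <- Eu. field. auto.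
Qed.

(** * The functions [delta] and [I] of an urn *)

Lemma de_moivre (r t : R) (n : nat) :
  ((r * cos t, r * sin t)%R : C) ^ n = (r ^ n * cos (INR n * t), r ^ n * sin (INR n * t))%R.
Proof.
induction n as [|n IH].
- simpl. rewrite Rmult_0_l, cos_0, sin_0. apply injective_projections; simpl; ring.
- rewrite Cpow_S, IH, S_INR, Rmult_plus_distr_r, Rmult_1_l, cos_plus, sin_plus.
  apply injective_projections; simpl; ring.
Qed.

Lemma Cmod_pos_right z : (0 < Re z)%R -> (0 < Cmod z)%R.
Proof. intros Hz. apply Cmod_gt_0. intros E. rewrite E in Hz. simpl in Hz. lra. Qed.

Lemma root_right_pow h z : (0 < h)%nat -> (0 < Re z)%R -> root_right h z ^ h = z.
Proof.
intros Hh Hz. assert (Hm := Cmod_pos_right z Hz). destruct z as [x y]. unfold root_right. simpl in Hz. simpl Re. simpl Im.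
assert (Hh' : (0 < INR h)%R) by (apply lt_0_INR; auto).
rewrite de_moivre, <- Rpower_pow by (unfold Rpower; apply exp_pos).
rewrite Rpower_mult, Rinv_l, Rpower_1 by (auto; lra).
replace (INR h * (atan (y / x) / INR h))%R with (atan (y / x))%R by (field; lra).
rewrite cos_atan, sin_atan.
assert (E : Cmod (x, y) = (x * sqrt (1 + (y / x)²))%R).
{ transitivity (sqrt (x * x) * sqrt (1 + (y / x)²))%R.
  - rewrite <- sqrt_mult_alt by nra. unfold Cmod; simpl. f_equal. unfold Rsqr. field. lra.
  - rewrite sqrt_square by lra. reflexivity. }
assert (Hs : (0 < sqrt (1 + (y / x)²))%R).
{ apply sqrt_lt_R0. pose proof (Rle_0_sqr (y / x)). lra. }
rewrite E. apply injective_projections; simpl; field; lra.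
Qed.

Lemma root_right_real h x : (0 < x)%R -> root_right h (RtoC x) = RtoC (Rpower x (/ INR h)).
Proof.
intros Hx. unfold root_right; simpl. rewrite Cmod_R, Rabs_pos_eq by lra.
unfold Rdiv. rewrite !Rmult_0_l, atan_0, Rmult_0_l, cos_0, sin_0.
apply injective_projections; simpl; ring.
Qed.

Lemma root_right_cont h z : (0 < Re z)%R -> cont (root_right h) z.
Proof.
intros Hz. assert (Hm := Cmod_pos_right z Hz).
assert (Cr : rc (fun w => Rpower (Cmod w) (/ INR h)) z).
{ apply (rc_comp (fun m => Rpower m (/ INR h)) Cmod). apply rc_Cmod. unfold Rpower. auto_derive. auto. }
assert (Ct : rc (fun w => Rdiv (atan (Rdiv (Im w) (Re w))) (INR h)) z).
{ apply (rc_comp (fun m => Rdiv (atan m) (INR h)) (fun w => Rdiv (Im w) (Re w))).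
  - apply (rc_mult Im (fun w => Rinv (Re w))). apply rc_snd.
    apply (rc_comp Rinv Re). apply rc_fst. auto_derive. lra.
  - auto_derive. auto. }
apply cont_pair; apply rc_mult; auto; (apply rc_comp; [exact Ct | auto_derive; auto]).
Qed.

Lemma cder_inverse (f g : C -> C) (z l : C) : cont g z -> locally z (fun w : C => f (g w) = w) ->
  cder f (g z) l -> l <> 0 -> cder g z (/ l).
Proof.
intros Hg E Hf Hl. apply cder_eps. intros eps He.
apply Cmod_gt_0 in Hl as Hm. set (m := Cmod l) in *.
set (e := Rmin (m / 2) (eps * m * m / 2)).
assert (He' : (0 < e)%R).
{ apply Rmin_glb_lt. lra. apply Rdiv_lt_0_compat; try lra. repeat apply Rmult_lt_0_compat; auto. }
assert (e <= m / 2)%R by apply Rmin_l. assert (e <= eps * m * m / 2)%R by apply Rmin_r.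
destruct (proj1 (cder_eps _ _ _) Hf e He') as [r1 [Hr1 B]].
assert (L := locally_and (locally_cont g Hg (proj2 (locally_disc (g z) _) (ex_intro _ r1 (conj Hr1 B)))) E).
apply locally_disc in L. destruct L as [r [Hr L]]. exists r. split; auto.
intros w Hw. destruct (L w Hw) as [Bw Ew]. rewrite Ew, (locally_here E) in Bw.
set (d := g w - g z) in *. set (x := w - z) in *. pose proof (Cmod_ge_0 d).
assert (D : (Cmod d * (m / 2) <= Cmod x)%R).
{ assert (T := Cmod_triangle x (- (x - d * l))). replace (x + - (x - d * l)) with (l * d) in T by ring.
  rewrite Cmod_opp, Cmod_mult in T. fold m in T. nra. }
replace (d - x * / l) with (- (x - d * l) / l) by (field; auto).
rewrite Cmod_div, Cmod_opp by auto. fold m.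
apply (Rmult_le_reg_r m); auto. unfold Rdiv. rewrite Rmult_assoc, Rinv_l, Rmult_1_r by lra.
eapply Rle_trans. exact Bw. apply Rle_trans with (eps * m * (Cmod d * (m / 2)))%R. nra.
replace (eps * Cmod x * m)%R with (eps * m * Cmod x)%R by ring. apply Rmult_le_compat_l; nra.
Qed.

Lemma root_right_nz h z : (0 < h)%nat -> (0 < Re z)%R -> root_right h z <> 0.
Proof.
intros Hh Hz E. assert (P := root_right_pow h z Hh Hz). rewrite E in P.
destruct h; [lia|]. rewrite Cpow_S, Cmult_0_l in P. rewrite <- P in Hz. simpl in Hz. lra.
Qed.

Lemma Re_pos_locally z : (0 < Re z)%R -> locally z (fun w : C => (0 < Re w)%R).
Proof.
intros H. apply locally_disc. exists (Re z). split; auto. intros w Hw. unfold disc in Hw.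
assert (A := re_le_Cmod (w - z)). assert (E : Re (w - z) = (Re w - Re z)%R) by reflexivity. rewrite E in A.
apply Rabs_le_between in A. lra.
Qed.

Lemma root_right_cder h z : (0 < h)%nat -> (0 < Re z)%R ->
  cder (root_right h) z (root_right h z / (nC h * z)).
Proof.
intros Hh Hz. assert (Hn := root_right_nz h z Hh Hz). assert (HI := nC_nz h Hh).
assert (Hz0 : z <> 0) by (apply Cmod_gt_0, Cmod_pos_right; auto).
eapply cder_eq. apply (cder_inverse (fun w => w ^ h)).
- apply root_right_cont; auto.
- near (Re_pos_locally z Hz). intros w Hw. apply root_right_pow; auto.
- apply (cder_powC (fun w => w)). exact Hn. apply cder_id.
- rewrite root_right_pow, Cmult_1_r by auto. apply Cdiv_nz; auto. apply Cmult_neq_0; auto.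
- rewrite root_right_pow by auto. field. auto.
Qed.

Lemma delta_arg h u : (0 < h)%nat -> disc 0 1 u -> (0 < Re (1 - u ^ h))%R.
Proof.
unfold disc. intros Hh Hu. replace (u - 0) with u in Hu by ring.
assert (A := re_le_Cmod (u ^ h)). rewrite Cmod_pow in A.
assert (E : Re (1 - u ^ h) = (1 - Re (u ^ h))%R) by reflexivity. rewrite E.
assert (B := pow_lt_1_compat (Cmod u) h (conj (Cmod_ge_0 u) Hu) Hh).
apply Rabs_le_between in A. lra.
Qed.

Lemma delta_pow h u : (0 < h)%nat -> disc 0 1 u -> delta h u ^ h = 1 - u ^ h.
Proof. intros. apply root_right_pow; auto. apply delta_arg; auto. Qed.

Lemma delta_nz h u : (0 < h)%nat -> disc 0 1 u -> delta h u <> 0.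
Proof. intros. apply root_right_nz; auto. apply delta_arg; auto. Qed.

Lemma delta_cder h u : (0 < h)%nat -> disc 0 1 u ->
  cder (delta h) u (- (u ^ (h - 1) * delta h u / delta h u ^ h)).
Proof.
intros Hh Hu. assert (Hp := delta_pow h u Hh Hu).
assert (Hz : 1 - u ^ h <> 0) by (rewrite <- Hp; apply Cpow_nz, delta_nz; auto).
eapply cder_eq. unfold delta. apply (cder_comp (root_right h) (fun u => 1 - u ^ h)).
apply root_right_cder; auto. apply delta_arg; auto. cderiv.
fold (delta h u) (nC h). rewrite Hp. field. auto using nC_nz.
Qed.

Lemma delta_0 h : (0 < h)%nat -> delta h 0 = 1.
Proof.
intros Hh. unfold delta. replace (1 - 0 ^ h) with (RtoC 1).
rewrite root_right_real by lra. unfold Rpower. rewrite ln_1, Rmult_0_r, exp_0. reflexivity.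
destruct h; [lia|]. simpl. ring.
Qed.

Lemma delta_holo h w : (0 < h)%nat -> disc 0 1 w -> holomorphic_near (delta h) w.
Proof. intros H. apply holo_on_disc. intros v Hv. eexists. apply delta_cder; auto. Qed.

(** [delta] on the real segment, an involution of the open unit interval. *)
Definition rdelta (h : nat) (x : R) : R := Rpower (1 - x ^ h) (/ INR h).

Lemma delta_real h x : (0 < h)%nat -> (0 <= x < 1)%R -> delta h (RtoC x) = RtoC (rdelta h x).
Proof.
intros Hh Hx. unfold delta, rdelta.
rewrite <- RtoC_pow, <- RtoC_minus. apply root_right_real. pose proof (pow_lt_1_compat x h Hx Hh). lra.
Qed.

Lemma rdelta_pow h x : (0 < h)%nat -> (0 <= x < 1)%R -> (rdelta h x ^ h = 1 - x ^ h)%R.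
Proof.
intros Hh Hx. unfold rdelta. rewrite <- Rpower_pow by (unfold Rpower; apply exp_pos).
rewrite Rpower_mult, Rinv_l, Rpower_1. auto. pose proof (pow_lt_1_compat x h Hx Hh). lra.
apply not_0_INR. lia.
Qed.

Lemma pow_inj_pos x y h : (0 < h)%nat -> (0 < x)%R -> (0 < y)%R -> (x ^ h = y ^ h)%R -> x = y.
Proof.
intros Hh Hx Hy E. rewrite <- (Rpower_1 x), <- (Rpower_1 y) by auto.
rewrite <- (Rinv_r (INR h)) by (apply not_0_INR; lia).
rewrite <- !Rpower_mult, !Rpower_pow by auto. rewrite E; auto.
Qed.

Lemma rdelta_lt1 h x : (0 < h)%nat -> (0 < x < 1)%R -> (0 < rdelta h x < 1)%R.
Proof.
intros Hh Hx. split. apply exp_pos.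
apply Rnot_le_lt. intros H. assert (E := rdelta_pow h x Hh ltac:(lra)).
assert (1 <= rdelta h x ^ h)%R by (apply pow_R1_Rle; auto).
assert (0 < x ^ h)%R by (apply pow_lt; lra). lra.
Qed.

Lemma rdelta_invol h x : (0 < h)%nat -> (0 < x < 1)%R -> rdelta h (rdelta h x) = x.
Proof.
intros Hh Hx. pose proof (rdelta_lt1 h x Hh Hx).
apply (pow_inj_pos _ _ h); auto; try lra. apply exp_pos.
rewrite rdelta_pow, rdelta_pow by (auto; lra). ring.
Qed.

Definition urn_integrand (a b s : nat) (t : C) : C := t ^ (a - 1) / delta (a + b + s) t ^ (a + b).

Lemma urn_integrand_cex a b s u : (0 < a + b + s)%nat -> disc 0 1 u -> cex (urn_integrand a b s) u.
Proof.
intros Hh Hu. eexists. unfold urn_integrand. apply cder_div. cderiv.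
apply cder_pow. apply delta_cder; auto. apply Cpow_nz, delta_nz; auto.
Qed.

(** The integral over segments is the primitive vanishing at [0]. *)
Lemma urn_integral_cder a b s : (0 < a + b + s)%nat ->
  urn_integral a b s 0 = 0 /\ forall u, disc 0 1 u -> cder (urn_integral a b s) u (urn_integrand a b s u).
Proof.
intros Hh. assert (Hc := fun w Hw => cex_cont _ w (urn_integrand_cex a b s w Hh Hw)).
destruct (primitive_on_disc (urn_integrand a b s) 0 1 Hc) as [F HF].
{ intros w Hw _. apply urn_integrand_cex; auto. }
assert (E : forall u, disc 0 1 u -> F u - F 0 = urn_integral a b s u).
{ intros u Hu. symmetry. unfold urn_integral, segment_integral.
  change (CI (fun x => u * urn_integrand a b s (RtoC x * u)) 0 1 = F u - F 0).
  assert (Hpath : forall x, rder (fun x => RtoC x * u) x u).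
  { intros x. eapply rder_eq. apply rder_mult. apply rder_id. apply rder_const. cbv beta. ring. }
  rewrite (CI_FTC (fun x => F (RtoC x * u))). { f_equal; f_equal; ring. }
  intros x Hx. unfold btw in Hx. rewrite Rmin_left, Rmax_right in Hx by lra.
  assert (Hxu : disc 0 1 (RtoC x * u)).
  { unfold disc in *. replace (RtoC x * u - 0) with (RtoC x * (u - 0)) by ring.
    rewrite Cmod_mult, Cmod_R, Rabs_pos_eq by lra. pose proof (Cmod_ge_0 (u - 0)). nra. }
  split.
  - eapply rder_eq. apply (rder_comp F (fun x => RtoC x * u)). apply HF; auto. apply Hpath. ring.
  - apply (rcont_mult (fun _ => u)). eapply rder_cont, rder_const.
    apply (rcont_comp (urn_integrand a b s) (fun x => RtoC x * u)); auto. eapply rder_cont, Hpath. }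
split.
- rewrite <- E. ring. apply disc_center. lra.
- intros u Hu. apply (cder_ext (fun u => F u - F 0)).
  + near (disc_open _ _ _ Hu). exact E.
  + eapply cder_eq. apply cder_minus. apply HF; auto. apply cder_const. ring.
Qed.

Lemma urn_holo a b s w : (0 < a + b + s)%nat -> disc 0 1 w -> holomorphic_near (urn_integral a b s) w.
Proof. intros H. apply holo_on_disc. intros v Hv. eexists. apply urn_integral_cder; auto. Qed.

Lemma urn_cont0 a b s : (0 < a)%nat -> cont (urn_integral a b s) 0 /\ urn_integral a b s 0 = 0.
Proof.
intros Ha. split; [|apply urn_integral_cder; lia]. apply holo_cont, urn_holo. lia. apply disc_center; lra.
Qed.

Lemma urn_pull a b s (P : C -> Prop) : (0 < a)%nat -> locally (RtoC 0) P ->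
  locally (RtoC 0) (fun w : C => P (urn_integral a b s w)).
Proof.
intros Ha HP. destruct (urn_cont0 a b s Ha) as [Hc H0]. apply locally_cont; auto. rewrite H0; auto.
Qed.

Lemma holo_urn_comp f a b s : (0 < a)%nat -> holomorphic_near f 0 ->
  holomorphic_near (fun w => f (urn_integral a b s w)) 0.
Proof.
intros Ha Hf. apply holo_comp. rewrite (proj2 (urn_cont0 a b s Ha)); auto. apply urn_holo. lia. apply disc_center; lra.
Qed.

(** [I u = u ^ a / a + ...], because [I' u = u ^ (a - 1) (1 + ...)]. *)
Lemma urn_order a b s : (0 < a)%nat -> exists v, holomorphic_near v 0 /\ v 0 = / nC a /\ v 0 <> 0 /\
  locally (RtoC 0) (fun u : C => urn_integral a b s u = u ^ a * v u).
Proof.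
intros Ha. assert (Hh : (0 < a + b + s)%nat) by lia. assert (L1 := locally_disc0 1 Rlt_0_1).
destruct (urn_integral_cder a b s Hh) as [I0 Id].
assert (D0 : disc 0 1 0) by (apply disc_center; lra).
set (r := fun u => / (delta (a + b + s) u ^ (a + b))).
assert (Hr : cont r 0).
{ apply holo_cont, holo_inv. apply holo_pow, delta_holo; auto. apply Cpow_nz, delta_nz; auto. }
assert (Hr0 : r 0 = 1) by (unfold r; rewrite delta_0, Cpow_1_l by auto; field).
destruct (zero_order _ (urn_holo a b s 0 Hh D0)) as [Hz|[n [v [Hv [Hv0 E]]]]].
- exfalso. destruct (locally_exists _ (locally_and (locally_near Hz) L1)) as [u [Hu [E Du]]].
  assert (Z : urn_integrand a b s u = 0).
  { apply (cder_unique (urn_integral a b s) u); auto. apply (cder_ext (fun _ => 0)); [exact (locally_eq_sym E)|apply cder_const]. }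
  revert Z. apply Cdiv_nz; apply Cpow_nz; auto. apply delta_nz; auto.
- destruct (order_deriv _ v r n (a - 1) Hv Hv0 I0 Hr E) as [_ [_ A]].
  { near L1. intros u Hu _. exact (Id u Hu). }
  destruct A as [A1 A2]. { rewrite Hr0. apply C1_nz. } assert (n = a) by lia. clear A1. subst n.
  exists v. repeat split; auto. assert (Hna := nC_nz a Ha).
  replace (v 0) with (nC a * v 0 / nC a) by (field; auto). rewrite A2, Hr0. field. auto.
Qed.

(** In terms of [w ^ s], [w ^ h] and [delta w ^ a], the identities at the pole
  become rational. *)
Lemma delta_data a b s (w : C) : (0 < s)%nat -> w <> 0 -> disc 0 1 w ->
  let h := (a + b + s)%nat in let D := delta h w ^ a in
  1 - w ^ h <> 0 /\ D <> 0 /\ w ^ s <> 0 /\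
  cder (urn_integral s b a) w (w ^ s / w * D / (1 - w ^ h)) /\
  cder (fun w => w ^ s) w (nC s * w ^ s / w) /\
  cder (fun w => w ^ h) w (nC h * w ^ h / w) /\
  cder (fun w => delta h w ^ a) w (- (nC a * D * w ^ h / (w * (1 - w ^ h)))).
Proof.
intros Hs Hw Hd h D. assert (Hh : (0 < h)%nat) by (unfold h; lia).
assert (Hp := delta_pow h w Hh Hd). assert (Hn := delta_nz h w Hh Hd).
assert (H1 : 1 - w ^ h <> 0) by (rewrite <- Hp; apply Cpow_nz; auto).
assert (HD : D <> 0) by (apply Cpow_nz; auto).
assert (HW : w ^ s <> 0) by (apply Cpow_nz; auto).
split; [exact H1 | split; [exact HD | split; [exact HW | split; [|split; [|split]]]]].
- eapply cder_eq. apply urn_integral_cder; auto. lia.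
  unfold urn_integrand. replace (s + b + a)%nat with h by (unfold h; lia).
  rewrite Cpow_pred, <- Hp by auto. replace (delta h w ^ h) with (delta h w ^ (s + b) * D).
  field. repeat split; auto. apply Cpow_nz; auto.
  unfold D. rewrite <- Cpow_add_r. f_equal. unfold h; lia.
- eapply cder_eq. apply (cder_powC (fun w => w)); auto. apply cder_id. cbv beta. field; auto.
- eapply cder_eq. apply (cder_powC (fun w => w)); auto. apply cder_id. cbv beta. field; auto.
- eapply cder_eq. apply cder_powC; auto. apply delta_cder; auto.
  rewrite Hp, Cpow_pred by auto. unfold D. field. auto.
Qed.

(** * Divisibility from the expansion at the pole of [psi] *)

(** As [I u = u ^ a / a + ...], a zero of order [n] of [f] gives order [a n]. *)
Lemma order_multiple f a b s m c : (0 < a)%nat -> holomorphic_near f 0 -> cont c 0 -> c 0 <> 0 ->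
  locally (RtoC 0) (fun w : C => w <> 0 -> f (urn_integral a b s w) = w ^ m * c w) -> Nat.divide a m.
Proof.
intros Ha Hf Hc Hc0 E.
destruct (zero_order f Hf) as [Hz|[n [v [Hv [Hv0 Ev]]]]].
- exfalso. apply Hc0.
  apply (punctured_limit c (fun _ => 0)); auto. { apply holo_cont; holo. }
  near (locally_and E (urn_pull a b s _ Ha Hz)). intros w [E1 E2] Hw. specialize (E1 Hw). rewrite E2 in E1.
  assert (Hp := Cpow_nz w m Hw). replace (c w) with (w ^ m * c w / w ^ m) by (field; auto). rewrite <- E1. field; auto.
- destruct (urn_order a b s Ha) as [lam [Hl [_ [Hl0 El]]]].
  exists n. symmetry. rewrite Nat.mul_comm.
  apply (order_unique (a * n) m (fun w => lam w ^ n * v (urn_integral a b s w)) c); auto.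
  + apply holo_cont, holo_mult. apply holo_pow; auto. apply holo_urn_comp; auto.
  + rewrite (proj2 (urn_cont0 a b s Ha)). apply Cmult_neq_0; auto. apply Cpow_nz; auto.
  + near (locally_and E (locally_and El (urn_pull a b s _ Ha Ev))).
    intros w [E1 [E2 E3]] Hw. specialize (E1 Hw). rewrite <- E1, E3, E2, Cpow_mult_l, Cpow_mult_r. ring.
Qed.

Lemma first_invariant_expansion (a b s a0 b0 X : C) : a0 + b0 <> 0 -> a0 + b0 - b0 * X <> 0 -> 1 - X <> 0 ->
  (1 - X) / (a0 + b0 - b0 * X) * (- ((a + b + s) * b0 * X / (a0 + b0 - b0 * X)) - s + a * X / (1 - X)) + s / (a0 + b0) =
  X * (- (b0 * (b + s) - a0 * (a + s) + - (b0 * (b + s * b0 / (a0 + b0))) * X) /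
    ((a0 + b0 - b0 * X) * (a0 + b0 - b0 * X))).
Proof. intros. field. auto. Qed.

Section Arithmetic.
Variables (a b s a0 b0 : nat).
Hypotheses (Ha : (0 < a)%nat) (Hb : (0 < b)%nat) (Hs : (0 < s)%nat) (Ht : (1 <= a0 + b0)%nat).
Let h := (a + b + s)%nat.
Let t0 := (a0 + b0)%nat.
Let L := urn_integral s b a.
Let q (X : C) : C := nC t0 - nC b0 * X.

(* minus the logarithmic derivative of [delta w ^ a0 / w ^ t0] with respect to [L] *)
Let ell (w : C) : C := q (w ^ h) / (w ^ s * delta h w ^ a).

Variable E : C -> C.
Hypothesis HE : holomorphic_near E 0.
Hypothesis KL : locally (RtoC 0) (fun w : C => w <> 0 -> E (L w) = L w * ell w).

Let Hh : (0 < h)%nat. Proof. unfold h; lia. Qed.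
Let Ht0 : nC t0 <> 0. Proof. apply nC_nz; exact Ht. Qed.
Let HSs : nC s <> 0. Proof. apply nC_nz; exact Hs. Qed.

Lemma pow_h_0 : (0 : C) ^ h = 0.
Proof. destruct h; [lia|]. rewrite Cpow_S. ring. Qed.

Lemma q_0 : q (0 ^ h) = nC t0.
Proof. rewrite pow_h_0. unfold q. ring. Qed.

Lemma q_holo : holomorphic_near (fun w => q (w ^ h)) 0.
Proof. unfold q. holo. Qed.

Lemma E_nonzero : E 0 <> 0.
Proof.
destruct (urn_order s b a Hs) as [lam [Hl [_ [Hl0 El]]]]. destruct (urn_cont0 s b a Hs) as [_ H0].
assert (D0 : disc 0 1 0) by (apply disc_center; lra).
assert (A : E (L 0) = lam 0 * (q (0 ^ h) / delta h 0 ^ a)).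
{ apply (punctured_limit (fun w => E (L w)) (fun w => lam w * (q (w ^ h) / delta h w ^ a))).
  - apply holo_cont, (holo_urn_comp E); auto.
  - apply holo_cont, holo_mult; auto. apply holo_div. apply q_holo.
    apply holo_pow, delta_holo; auto. apply Cpow_nz, delta_nz; auto.
  - near (locally_and (locally_and KL El) (locally_disc0 1 Rlt_0_1)).
    intros w [[K1 K2] K3] Hw. rewrite K1 by auto. unfold L, ell. rewrite K2.
    destruct (delta_data a b s w Hs Hw K3) as [_ [N2 [N3 _]]]. fold h in N2. field. auto. }
unfold L in A. rewrite H0 in A. rewrite A, q_0. apply Cmult_neq_0; auto. apply Cdiv_nz; auto.
apply Cpow_nz, delta_nz; auto.
Qed.

(** Writing [L'] with [ell] makes [w ^ s] and [delta w ^ a] cancel below. *)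
Lemma generic_point : locally (RtoC 0) (fun w : C => w <> 0 ->
  1 - w ^ h <> 0 /\ q (w ^ h) <> 0 /\ ell w <> 0 /\ L w <> 0 /\ E (L w) <> 0 /\
  cder (fun w => w ^ h) w (nC h * w ^ h / w) /\
  cder L w (q (w ^ h) / (ell w * (w * (1 - w ^ h)))) /\
  cder ell w (ell w / w * (- (nC h * nC b0 * w ^ h / q (w ^ h)) - nC s + nC a * w ^ h / (1 - w ^ h)))).
Proof.
destruct (urn_order s b a Hs) as [lam [Hl [_ [Hl0 El]]]].
assert (Q : locally (RtoC 0) (fun w : C => q (w ^ h) <> 0)).
{ apply (holo_nonzero (fun w => q (w ^ h))). apply q_holo. rewrite q_0. apply Ht0. }
assert (NE := urn_pull s b a _ Hs (holo_nonzero E 0 HE E_nonzero)).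
near (locally_and (locally_and Q NE) (locally_and (locally_and (holo_nonzero lam 0 Hl Hl0) El) (locally_disc0 1 Rlt_0_1))).
intros w [[Hq HEw] [[Hlw Elw] Hd]] Hw.
destruct (delta_data a b s w Hs Hw Hd) as [N1 [N2 [N3 [D1 [D2 [D3 D4]]]]]]. fold h in N1, N2, D1, D3, D4.
assert (Hell : ell w <> 0) by (apply Cdiv_nz; auto; apply Cmult_neq_0; auto).
assert (HL : L w <> 0) by (unfold L; rewrite Elw; apply Cmult_neq_0; auto; apply Cpow_nz; auto).
refine (conj N1 (conj Hq (conj Hell (conj HL (conj HEw (conj D3 (conj _ _))))))).
- eapply cder_eq. exact D1. unfold ell. field. repeat split; auto.
- eapply cder_eq.
  + unfold ell, q. apply cder_div. apply cder_minus. apply cder_const. apply cder_mult. apply cder_const.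
    exact D3. apply cder_mult. exact D2. exact D4. apply Cmult_neq_0; auto.
  + cbv beta. unfold ell. unfold q in *. field. repeat split; auto.
Qed.

(** [ell' / (L' ell^2)] is a function of [X = w ^ h] only; in terms of [L] it is
  [(L E' - E) / E^2], hence holomorphic. *)
Lemma first_invariant : exists M, holomorphic_near M 0 /\
  locally (RtoC 0) (fun w : C => w <> 0 -> M (L w) =
    (1 - w ^ h) / q (w ^ h) * (- (nC h * nC b0 * w ^ h / q (w ^ h)) - nC s + nC a * w ^ h / (1 - w ^ h))).
Proof.
destruct (holo_deriv E 0 HE) as [E' [HE' DE]]. assert (E0 := E_nonzero).
exists (fun x => (E' x * x - E x) / (E x * E x)). split.
{ holo. apply Cmult_neq_0; auto. }
near (locally_and (locally_and generic_point (locally_punctured _ KL)) (urn_pull s b a _ Hs DE)).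
intros w [[G K] DEw] Hw. cbv beta in DEw; fold L in DEw. specialize (K Hw).
destruct (G Hw) as [N1 [Hq [Hell [HL [HEw [_ [DL Dell]]]]]]].
set (l' := q (w ^ h) / (ell w * (w * (1 - w ^ h)))) in *.
assert (U := cder_unique _ _ _ _ (cder_comp E L w _ _ DEw DL)
  (cder_ext _ _ w _ (locally_eq_sym K) (cder_mult L ell w _ _ DL Dell))).
assert (Hl' : l' <> 0) by (apply Cdiv_nz; auto; apply Cmult_neq_0; auto; apply Cmult_neq_0; auto).
replace (E' (L w)) with (E' (L w) * l' / l') by (field; auto). rewrite U, (locally_here K).
unfold l'. field. repeat split; auto.
Qed.

Lemma quotient_cont (k1 k2 : C) : k1 <> 0 ->
  let c := fun w => (k1 + k2 * w ^ h) / (q (w ^ h) * q (w ^ h)) in cont c 0 /\ c 0 <> 0.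
Proof.
intros Hk c. assert (Hq := q_holo). assert (N : q (0 ^ h) * q (0 ^ h) <> 0) by (rewrite q_0; apply Cmult_neq_0; auto).
split.
- apply holo_cont. unfold c. apply holo_div; auto. holo. exact (holo_mult _ _ 0 Hq Hq).
- unfold c. apply Cdiv_nz; auto. rewrite pow_h_0. replace (k1 + k2 * 0) with k1 by ring. auto.
Qed.

(** The invariant without its constant term vanishes to order [h] in [w], so [s]
  divides [h], unless [k1 = b0 (b + s) - a0 (a + s)] is zero. In that case it is
  [- k2 (X / q)^2] with [k2 <> 0], of order [2 h]. Applying [(L / E) d/dL] and
  subtracting a multiple gives a function of order [3 h] unless [a0 = b0], and a
  common divisor of [2 h] and [3 h] divides [h]. *)
Lemma urn_arithmetic : Nat.divide s h \/ (a0 = b0 /\ a = b /\ Nat.divide s (2 * h)).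
Proof.
destruct first_invariant as [M [HM EM]].
set (mu := fun x => M x + nC s / nC t0).
assert (Hmu : holomorphic_near mu 0) by (unfold mu; holo; auto).
set (k1 := nC b0 * (nC b + nC s) - nC a0 * (nC a + nC s)).
set (k2 := - (nC b0 * (nC b + nC s * nC b0 / nC t0))).
assert (Et : nC t0 = nC a0 + nC b0) by apply nC_plus.
assert (Emu : locally (RtoC 0) (fun w : C => w <> 0 ->
  mu (L w) = w ^ h * (- (k1 + k2 * w ^ h) / (q (w ^ h) * q (w ^ h))))).
{ near (locally_and generic_point EM). intros w [G Ew] Hw. destruct (G Hw) as [N1 [Hq _]].
  unfold mu. rewrite Ew by auto. unfold k1, k2. unfold q in *.
  assert (Eh : nC h = nC a + nC b + nC s) by (unfold h; rewrite !nC_plus; reflexivity).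
  assert (Ht0' := Ht0). rewrite Eh. rewrite Et in *. apply first_invariant_expansion; auto. }
destruct (classic (k1 = 0)) as [Hk1|Hk1].
2:{ left. destruct (quotient_cont (- k1) (- k2)) as [C1 C2]. { apply Copp_nz; auto. }
  apply (order_multiple mu s b a h _ Hs Hmu C1 C2). near Emu. intros w Hw Hn. fold L. rewrite Hw by auto. f_equal. f_equal. ring. }
assert (Hk1' : (b0 * (b + s) = a0 * (a + s))%nat).
{ apply nC_inj. rewrite !nC_mult, !nC_plus. apply Ceq_minus. exact Hk1. }
assert (Hb0 : (0 < b0)%nat). { destruct b0; [exfalso|lia]. destruct a0; [lia|]. simpl in Hk1'. nia. }
assert (Hk2 : k2 <> 0).
{ unfold k2. apply Copp_nz.
  replace (nC b0 * (nC b + nC s * nC b0 / nC t0)) with (nC b0 * (nC b * nC t0 + nC s * nC b0) / nC t0) by (field; auto).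
  apply Cdiv_nz; auto. rewrite <- !nC_mult, <- nC_plus, <- nC_mult. apply nC_nz. unfold t0. nia. }
assert (Emu2 : locally (RtoC 0) (fun w : C => w <> 0 -> mu (L w) = - k2 * (w ^ h * w ^ h) / (q (w ^ h) * q (w ^ h)))).
{ near Emu. intros w Hw Hn. rewrite Hw by auto. rewrite Hk1. unfold Cdiv. ring. }
assert (D2 : Nat.divide s (2 * h)).
{ destruct (quotient_cont (- k2) 0) as [C1 C2]. { apply Copp_nz; auto. }
  apply (order_multiple mu s b a (2 * h) _ Hs Hmu C1 C2). near Emu2. intros w Hw Hn. fold L. rewrite Hw by auto.
  replace (2 * h)%nat with (h + h)%nat by lia. rewrite Cpow_add_r. unfold Cdiv. ring. }
destruct (Nat.eq_dec a0 b0) as [Eab|Eab].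
{ right. split; auto. split; auto. rewrite Eab in Hk1'. nia. }
left. apply (Nat.divide_add_cancel_r s (2 * h) h D2).
destruct (holo_deriv mu 0 Hmu) as [mu' [Hmu' Dmu]]. assert (E0 := E_nonzero).
set (nu := fun x => x * mu' x / E x - 2 * nC h / nC t0 * mu x).
assert (Hnu : holomorphic_near nu 0) by (unfold nu; holo; auto).
set (k3 := - k2 * (2 * nC h / nC t0) * (nC t0 * (nC b0 - nC a0))).
assert (Hk3 : k3 <> 0).
{ assert (H2 : RtoC 2 <> 0) by (apply RtoC_neq; lra).
  apply Cmult_neq_0; [apply Cmult_neq_0; auto using Copp_nz | apply Cmult_neq_0; auto].
  - apply Cdiv_nz; auto. apply Cmult_neq_0; auto. apply nC_nz; auto.
  - apply Cminus_eq_contra. intros Z. apply nC_inj in Z. auto. }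
destruct (quotient_cont k3 (k2 * (2 * nC h / nC t0) * (nC b0 * nC b0)) Hk3) as [C1 C2].
destruct (quotient_cont 1 0 C1_nz) as [C3 C4].
apply (order_multiple nu s b a (2 * h + h) _ Hs Hnu (cont_mult _ _ 0 C1 C3)). { apply Cmult_neq_0; auto. }
near (locally_and (locally_and generic_point (locally_punctured _ Emu2)) (locally_and KL (urn_pull s b a _ Hs Dmu))).
intros w [[G K] [EL Dw]] Hw. cbv beta in Dw. fold L in Dw |- *. specialize (EL Hw). specialize (K Hw).
destruct (G Hw) as [N1 [Hq [Hell [HL [_ [DX [DL _]]]]]]].
set (l' := q (w ^ h) / (ell w * (w * (1 - w ^ h)))) in *.
assert (D : cder (fun w => - k2 * (w ^ h * w ^ h) / (q (w ^ h) * q (w ^ h))) w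
  (- k2 * (w ^ h * w ^ h) * (2 * nC h * nC t0 / (w * q (w ^ h))) / (q (w ^ h) * q (w ^ h)))).
{ assert (Dq : cder (fun w => q (w ^ h)) w (0 - (0 * w ^ h + nC b0 * (nC h * w ^ h / w)))).
  { unfold q. apply cder_minus. apply cder_const. apply cder_mult. apply cder_const. exact DX. }
  eapply cder_eq. apply cder_div. apply cder_mult. apply cder_const. apply cder_mult; exact DX.
  apply cder_mult; exact Dq. apply Cmult_neq_0; auto. cbv beta. unfold q in *. field. auto. }
assert (U := cder_unique _ _ _ _ (cder_comp mu L w _ _ Dw DL) (cder_ext _ _ w _ (locally_eq_sym K) D)).
assert (Hl' : l' <> 0) by (apply Cdiv_nz; auto; apply Cmult_neq_0; auto; apply Cmult_neq_0; auto).
unfold nu. replace (mu' (L w)) with (mu' (L w) * l' / l') by (field; auto).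
rewrite U, (locally_here K), EL. unfold l', k3.
replace (2 * h + h)%nat with (h + (h + h))%nat by lia. rewrite !Cpow_add_r.
unfold q in *. rewrite Et in *. field. repeat split; auto.
Qed.
End Arithmetic.

(** * Continuation of [psi] along a side of the triangle *)

Lemma mero_comp f g c : holomorphic_near g c -> locally c (fun w : C => w <> c -> g w <> g c) ->
  mero_at f (g c) -> mero_at (fun w => f (g w)) c.
Proof.
intros Hg Hi [n [k [Hk E]]].
apply (mero_ext (fun w => k (g w) * / ((g w - g c) ^ n))).
- near (locally_and Hi (locally_cont g (holo_cont g c Hg) E)). intros w [H1 H2] Hw. symmetry. exact (H2 (H1 Hw)).
- apply mero_mult. exact (holo_mero _ c (holo_comp k g c Hk Hg)).
  apply (mero_inv (fun w => (g w - g c) ^ n)), holo_mero. holo.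
Qed.

Lemma mero_identity f c : mero_at f c ->
  (forall e : R, (0 < e)%R -> exists z, z <> c /\ disc c e z /\ f z = 0) -> locally c (fun z : C => z <> c -> f z = 0).
Proof.
intros [n [g [Hg E]]] Hacc.
assert (F0 : locally c (fun z : C => g z = 0)).
{ apply identity_theorem; auto. intros e He. apply locally_disc in E. destruct E as [r [Hr E]].
  destruct (Hacc (Rmin e r)) as [z [Hz [Hd Hf]]]. { apply Rmin_glb_lt; auto. }
  apply Rmin_def in Hd. destruct Hd as [Hd1 Hd2]. exists z. repeat split; auto.
  assert (Hp := Cpow_nz _ n (Cminus_eq_contra _ _ Hz)). specialize (E z Hd2 Hz). rewrite Hf in E.
  replace (g z) with (g z / (z - c) ^ n * (z - c) ^ n) by (field; auto). rewrite <- E. ring. }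
near (locally_and E F0). intros z [E1 E2] Hz. rewrite E1, E2 by auto. unfold Cdiv. ring.
Qed.

(** The supremum of the points around which [P] fails would be a limit of points
  where [P] holds. *)
Lemma punctured_continuation (P : R -> Prop) d0 : (0 < d0 < 1)%R -> (forall d, (d0 < d < 1)%R -> P d) ->
  let good d := exists e : R, (0 < e)%R /\ forall x, x <> d -> (Rabs (x - d) < e)%R -> P x in
  (forall d, (0 <= d < 1)%R ->
    (forall e : R, (0 < e)%R -> exists x, x <> d /\ (Rabs (x - d) < e)%R /\ P x) -> good d) -> good 0%R.
Proof.
intros Hd0 H0 good Hstep. apply NNPP. intros Hbad.
destruct (completeness (fun x => (0 <= x < 1)%R /\ ~ good x)) as [m [Hm1 Hm2]].
{ exists 1%R. intros x [Hx _]. lra. }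
{ exists 0%R. split; auto. lra. }
assert (Hm : (0 <= m)%R) by (apply Hm1; split; auto; lra).
assert (Hmd : (m <= d0)%R).
{ apply Hm2. intros x [Hx Hxb]. apply Rnot_lt_le. intros Hlt. apply Hxb.
  exists (Rmin (x - d0) (1 - x)). split. apply Rmin_glb_lt; lra.
  intros y _ Hy. apply H0. apply Rmin_def in Hy. destruct Hy as [Y1 Y2]. apply Rabs_lt_between in Y1, Y2. lra. }
assert (Hgt : forall x, (m < x < 1)%R -> good x).
{ intros x Hx. apply NNPP. intros Hxb. assert (x <= m)%R; [|lra]. apply Hm1. split; auto. lra. }
destruct (Hstep m) as [e [He Hem]]. lra.
{ intros e He. assert (Hmin : (0 < Rmin e (1 - m))%R) by (apply Rmin_glb_lt; lra).
  assert (M1 := Rmin_l e (1 - m)). assert (M2 := Rmin_r e (1 - m)).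
  set (k := (Rmin e (1 - m) / 2)%R) in *. destruct (Hgt (m + k)%R) as [e' [He' G]]. unfold k; lra.
  assert (Hmin' : (0 < Rmin e' k)%R) by (apply Rmin_glb_lt; unfold k; lra).
  assert (M3 := Rmin_l e' k). assert (M4 := Rmin_r e' k).
  exists (m + k + Rmin e' k / 2)%R. split. unfold k in *; lra. split. rewrite Rabs_pos_eq; unfold k in *; lra.
  apply G. lra. rewrite Rabs_pos_eq; lra. }
assert (m <= m - e)%R; [|lra].
apply Hm2. intros x [Hx Hxb]. apply Rnot_lt_le. intros Hlt. apply Hxb.
assert (x <= m)%R by (apply Hm1; auto).
destruct (Req_dec x m) as [->|Hne]. { exists e. auto. }
exists (Rmin (m - x) (x - (m - e)))%R. split. apply Rmin_glb_lt; lra.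
intros y Hy Hyx. apply Rmin_def in Hyx. destruct Hyx as [Y1 Y2]. apply Rabs_lt_between in Y1, Y2.
apply Hem. lra. apply Rabs_lt_between. lra.
Qed.

(** The derivative of the sum vanishes, as [delta] is an involution; [z1] is the
  length of the side of the triangle from the corner [0] to the pole of [psi]. *)
Lemma dual_integral a b s : (0 < a)%nat -> (0 < b)%nat -> (0 < s)%nat -> exists z1 : C, forall d : R, (0 < d < 1)%R ->
  urn_integral a b s (RtoC (rdelta (a + b + s) d)) + urn_integral s b a (RtoC d) = z1.
Proof.
intros Ha Hb Hs. set (h := (a + b + s)%nat). assert (Hh : (0 < h)%nat) by (unfold h; lia).
set (G := fun w => urn_integral a b s (delta h w) + urn_integral s b a w).
assert (HG : forall d : R, (0 < d < 1)%R -> cder G (RtoC d) 0).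
{ intros d Hd. assert (Hd' := disc0_real 1 d ltac:(lra)). assert (Hn := RtoC_neq d 0 ltac:(lra)).
  assert (Er := delta_real h d Hh ltac:(lra)). assert (Hr := rdelta_lt1 h d Hh Hd).
  assert (Hdel : disc 0 1 (delta h (RtoC d))) by (rewrite Er; apply disc0_real; lra).
  assert (Edd : delta h (delta h (RtoC d)) = RtoC d).
  { rewrite Er, delta_real, rdelta_invol; auto; lra. }
  assert (Hdn := delta_nz h (RtoC d) Hh Hd').
  eapply cder_eq. unfold G. apply cder_plus.
  - apply (cder_comp (urn_integral a b s) (delta h)). apply urn_integral_cder; auto. apply delta_cder; auto.
  - apply urn_integral_cder; auto. lia.
  - unfold urn_integrand. replace (s + b + a)%nat with h by (unfold h; lia). fold h. rewrite Edd.
    set (w := RtoC d) in *. set (x := delta h w) in *.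
    replace (x ^ h) with (x ^ a * x ^ (s + b)) by (rewrite <- Cpow_add_r; f_equal; unfold h; lia).
    replace (w ^ (h - 1)) with (w ^ (s - 1) * w ^ (a + b)) by (rewrite <- Cpow_add_r; f_equal; unfold h; lia).
    rewrite (Cpow_pred x a) by auto. field. repeat split; auto; apply Cpow_nz; auto. }
exists (G (RtoC (1 / 2))). intros d Hd. rewrite <- delta_real by (auto; lra).
apply (zero_derivative_constant (fun t => G (RtoC t))). intros t Ht.
eapply rder_eq. apply (rder_comp G RtoC). apply HG. revert Ht. unfold btw, Rmin, Rmax. destruct Rle_dec; lra. apply rder_id. ring.
Qed.

Definition logder (f : C -> C) (w l : C) : Prop := f w <> 0 /\ cder f w (f w * l).

Lemma logder_mult f g w l m : logder f w l -> logder g w m -> logder (fun x => f x * g x) w (l + m).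
Proof.
intros [N1 D1] [N2 D2]. split. apply Cmult_neq_0; auto.
eapply cder_eq. exact (cder_mult f g w _ _ D1 D2). ring.
Qed.

Lemma logder_pow f n w l : logder f w l -> logder (fun x => f x ^ n) w (nC n * l).
Proof.
intros [N1 D1]. split. apply Cpow_nz; auto.
eapply cder_eq. exact (cder_powC f w _ n N1 D1). field; auto.
Qed.

Lemma logder_inv f w l : logder f w l -> logder (fun x => / f x) w (- l).
Proof.
intros [N1 D1]. split. apply Cinv_nz; auto.
eapply cder_eq. exact (cder_inv f w _ D1 N1). field; auto.
Qed.

Lemma logder_of (f : C -> C) w l : f w <> 0 -> cder f w l -> logder f w (l / f w).
Proof. intros N D. split; auto. eapply cder_eq. exact D. field; auto. Qed.

Lemma logder_unique f g w l m : locally w (fun x : C => f x = g x) -> logder f w l -> logder g w m -> l = m.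
Proof.
intros E [N1 D1] [N2 D2]. assert (Ew := locally_here E). cbv beta in Ew.
assert (U := cder_unique g w _ _ (cder_ext f g w _ E D1) D2). rewrite Ew in U.
replace l with (g w * l / g w) by (field; auto). rewrite U. field; auto.
Qed.

Section Continuation.
Variables (a b s a0 b0 q : nat) (psi M : C -> C) (z1 : C).
Hypotheses (Ha : (0 < a)%nat) (Hb : (0 < b)%nat) (Hs : (0 < s)%nat) (Hq : (0 < q)%nat).
Hypothesis Hmero : meromorphic M.
Hypothesis Hfun : fundamental_function a b s a0 b0 psi.
Hypothesis Hpow : locally (RtoC 0) (fun z : C => z <> RtoC 0 -> psi z ^ q = M z).

Let h := (a + b + s)%nat.
Let L := urn_integral s b a.
Hypothesis Hz1 : forall d : R, (0 < d < 1)%R -> urn_integral a b s (RtoC (rdelta h d)) + L (RtoC d) = z1.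

Let Psi (w : C) : C := delta h w ^ a0 * / (w ^ (a0 + b0)).
Let defect (w : C) : C := M (z1 - L w) - Psi w ^ q.
Let Hh : (0 < h)%nat. Proof. unfold h; lia. Qed.

Lemma equation_near_start : exists d0 : R, (0 < d0 < 1)%R /\ forall d : R, (d0 < d < 1)%R -> defect (RtoC d) = 0.
Proof.
destruct Hfun as [_ HF]. fold h in HF.
destruct (urn_order a b s Ha) as [v [Hv [_ [Nv Ev]]]].
assert (A := locally_and (locally_and HF (urn_pull a b s _ Ha Hpow)) (locally_and Ev (holo_nonzero v 0 Hv Nv))).
apply locally_disc in A. destruct A as [r [Hr A]].
set (e := Rmin r (1 / 2)). assert (He : (0 < e <= 1 / 2)%R). { split. apply Rmin_glb_lt; lra. apply Rmin_r. }
assert (Her : (e <= r)%R) by apply Rmin_l.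
exists (rdelta h e). split. apply rdelta_lt1; auto; lra.
intros d Hd. assert (Hde := rdelta_lt1 h e Hh ltac:(lra)).
set (u := rdelta h d). assert (Hu := rdelta_lt1 h d Hh ltac:(lra)). fold u in Hu.
assert (Hue : (u < e)%R).
{ apply Rnot_le_lt. intros Hle.
  assert (e ^ h <= u ^ h)%R by (apply pow_incr; lra).
  assert (E1 := rdelta_pow h d Hh ltac:(lra)). fold u in E1.
  assert (E2 := rdelta_pow h e Hh ltac:(lra)).
  assert (rdelta h e ^ h <= d ^ h)%R by (apply pow_incr; lra).
  assert (rdelta h e = d) by (apply (pow_inj_pos _ _ h); auto; lra). lra. }
destruct (A (RtoC u)) as [[A1 A2] [A3 A4]]. { apply disc0_real. lra. }
assert (EI : urn_integral a b s (RtoC u) = z1 - L (RtoC d)).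
{ rewrite <- (Hz1 d) by lra. unfold u. ring. }
assert (HIn : urn_integral a b s (RtoC u) <> 0).
{ rewrite A3. apply Cmult_neq_0; auto. apply Cpow_nz, RtoC_neq; lra. }
specialize (A2 HIn). rewrite A1, EI in A2. unfold defect. rewrite <- A2. unfold Psi.
rewrite (delta_real h d), (delta_real h u) by (auto; lra). fold u.
replace (rdelta h u) with d by (symmetry; unfold u; apply rdelta_invol; auto; lra). unfold Cdiv. ring.
Qed.

Lemma L_injective (d : R) : (0 <= d < 1)%R -> locally (RtoC d) (fun w : C => w <> RtoC d -> L w <> L (RtoC d)).
Proof.
intros Hd. assert (Hd1 := disc0_real 1 d Hd). destruct (Req_dec d 0) as [->|Hd0].
- destruct (urn_order s b a Hs) as [v [Hv [_ [Nv Ev]]]]. unfold L. rewrite (proj2 (urn_cont0 s b a Hs)).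
  near (locally_and Ev (holo_nonzero v 0 Hv Nv)). intros w [E1 E2] Hw. rewrite E1. apply Cmult_neq_0; auto. apply Cpow_nz; auto.
- apply (holo_injective_at L (RtoC d) (urn_integrand s b a (RtoC d))).
  + apply urn_holo; auto. lia.
  + apply urn_integral_cder; auto. lia.
  + apply Cdiv_nz; apply Cpow_nz. apply RtoC_neq; auto. apply delta_nz; auto. lia.
Qed.

Lemma defect_mero (d : R) : (0 <= d < 1)%R -> mero_at defect (RtoC d).
Proof.
intros Hd. assert (Hd1 := disc0_real 1 d Hd).
assert (HL : holomorphic_near (fun w => z1 - L w) (RtoC d)) by (holo; apply urn_holo; auto; lia).
assert (HM : mero_at (fun w => M (z1 - L w)) (RtoC d)).
{ apply (mero_comp M (fun w => z1 - L w)); auto; [|apply Hmero].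
  near (L_injective d Hd). intros w Hw Hn E. apply (Hw Hn).
  replace (L w) with (z1 - (z1 - L w)) by ring. rewrite E. ring. }
assert (HP : mero_at (fun w => Psi w ^ q) (RtoC d)).
{ apply mero_pow, mero_mult. apply holo_mero, holo_pow, delta_holo; auto.
  apply (mero_inv (fun w => w ^ (a0 + b0))), holo_mero. holo. }
apply (mero_ext (fun w => M (z1 - L w) + (- (1)) * Psi w ^ q)).
- apply filter_forall. intros w _. unfold defect. ring.
- apply mero_plus; auto. apply (mero_mult (fun _ => - (1))); auto. apply holo_mero, holo_const.
Qed.

Lemma equation_at_corner : locally (RtoC 0) (fun w : C => w <> 0 -> defect w = 0).
Proof.
destruct equation_near_start as [d0 [Hd0 Hst]].
assert (Near : forall d x e, (Rabs (x - d) < e)%R -> disc (RtoC d) e (RtoC x)).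
{ intros d x e H. unfold disc. rewrite <- RtoC_minus, Cmod_R; auto. }
assert (Step : forall d, (0 <= d < 1)%R -> (forall e : R, (0 < e)%R -> exists x, x <> d /\ (Rabs (x - d) < e)%R /\ defect (RtoC x) = 0) ->
  locally (RtoC d) (fun w : C => w <> RtoC d -> defect w = 0)).
{ intros d Hd H. apply mero_identity. apply defect_mero; auto.
  intros e He. destruct (H e He) as [x [H1 [H2 H3]]]. exists (RtoC x). split; auto. apply RtoC_neq; auto. }
apply Step. lra. intros e He.
destruct (punctured_continuation (fun d => defect (RtoC d) = 0) d0 Hd0 Hst) as [r [Hr G]].
{ intros d Hd H. assert (A := Step d Hd H). apply locally_disc in A. destruct A as [r [Hr A]]. exists r. split; auto.
  intros x Hx Hxd. apply A; auto. apply RtoC_neq; auto. }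
assert (Hm : (0 < Rmin e r)%R) by (apply Rmin_glb_lt; auto). assert (M1 := Rmin_l e r). assert (M2 := Rmin_r e r).
assert (Hx : Rabs (Rmin e r / 2 - 0) = (Rmin e r / 2)%R) by (rewrite Rminus_0_r, Rabs_pos_eq; lra).
exists (Rmin e r / 2)%R. split. lra. split. lra. apply G; lra.
Qed.

(** Near the corner [M (z1 - x) = x ^ (N - n) v x], and [- q ell] is its
  logarithmic derivative [(N - n) / x + v' / v]. *)
Lemma key_relation : exists E, holomorphic_near E 0 /\ locally (RtoC 0) (fun w : C => w <> 0 ->
  E (L w) = L w * ((nC (a0 + b0) - nC b0 * w ^ h) / (w ^ s * delta h w ^ a))).
Proof.
destruct (mero_affine M z1 (- (1)) 0) as [n [g [Hg Eg]]].
{ apply Copp_nz, C1_nz. } { apply Hmero. }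
assert (HL0 := proj2 (urn_cont0 s b a Hs)).
assert (NL := L_injective 0 ltac:(lra)). unfold L in NL at 2. rewrite HL0 in NL.
assert (NP : forall w, disc 0 1 w -> w <> 0 -> Psi w <> 0).
{ intros w Hd Hw. apply Cdiv_nz; apply Cpow_nz; auto. apply delta_nz; auto. }
assert (EqF : locally (RtoC 0) (fun w : C => w <> 0 -> g (L w) = L w ^ n * Psi w ^ q)).
{ near (locally_and equation_at_corner (locally_and NL (urn_pull s b a _ Hs Eg))).
  intros w [E1 [E2 E3]] Hw. specialize (E1 Hw). specialize (E2 Hw). cbv beta in E3. fold L in E3.
  assert (Hp := Cpow_nz _ n E2). unfold defect in E1. apply Ceq_minus in E1. rewrite <- E1.
  replace (z1 - L w) with (z1 + - (1) * L w) by ring. rewrite (E3 E2).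
  replace (L w - 0) with (L w) by ring. field. auto. }
destruct (zero_order g Hg) as [Hz|[N [v [Hv [Hv0 Ev]]]]].
{ exfalso. destruct (locally_exists _ (locally_and (locally_and EqF NL) (locally_and (urn_pull s b a _ Hs Hz) (locally_disc0 1 Rlt_0_1))))
    as [w [Hw [[E1 E2] [E3 Hd]]]]. fold L in E3. specialize (E1 Hw). rewrite E3 in E1. symmetry in E1. revert E1.
  apply Cmult_neq_0; apply Cpow_nz; auto. }
destruct (holo_deriv v 0 Hv) as [v' [Hv' Dv]]. assert (Hqn := nC_nz q Hq).
exists (fun x => (nC n - nC N - x * v' x / v x) / nC q). split. { holo; auto. }
assert (NV := urn_pull s b a _ Hs (holo_nonzero v 0 Hv Hv0)).
assert (EqV : locally (RtoC 0) (fun w : C => w <> 0 -> L w ^ N * v (L w) = L w ^ n * Psi w ^ q)).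
{ near (locally_and EqF (urn_pull s b a _ Hs Ev)). intros w [E1 E2] Hw. fold L in E2. rewrite <- E1, E2 by auto. reflexivity. }
near (locally_and (locally_and NL (locally_disc0 1 Rlt_0_1)) (locally_and NV (locally_and (locally_punctured _ EqV) (urn_pull s b a _ Hs Dv)))).
intros w [[W1 W3] [W4 [W5 W6]]] Hw. specialize (W1 Hw). specialize (W5 Hw). cbv beta in W4, W6. fold L in W4, W6.
destruct (delta_data a b s w Hs Hw W3) as [N1 [N2 [N3 [DL _]]]]. fold h L in N1, N2, DL.
set (l' := w ^ s / w * delta h w ^ a / (1 - w ^ h)) in *.
assert (Hl' : l' <> 0) by (repeat apply Cdiv_nz; auto; apply Cmult_neq_0; auto; apply Cdiv_nz; auto).
assert (LL := logder_of L w l' W1 DL).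
assert (G1 := logder_mult _ _ w _ _ (logder_pow L N w _ LL) (logder_of (fun w => v (L w)) w _ W4 (cder_comp v L w _ _ W6 DL))).
assert (Ld := logder_of (delta h) w _ (delta_nz h w Hh W3) (delta_cder h w Hh W3)).
assert (G2 := logder_mult _ _ w _ _ (logder_pow L n w _ LL)
  (logder_pow Psi q w _ (logder_mult _ _ w _ _ (logder_pow _ a0 w _ Ld)
    (logder_inv _ w _ (logder_pow _ (a0 + b0) w _ (logder_of (fun w => w) w 1 Hw (cder_id w))))))).
assert (U := logder_unique _ _ w _ _ W5 G1 G2). cbv beta in U.
rewrite delta_pow, Cpow_pred in U by auto.
assert (V : L w * v' (L w) / v (L w) =
  (L w / l') * ((nC N * (l' / L w) + v' (L w) * l' / v (L w)) - nC N * (l' / L w))) by (field; auto).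
rewrite V, U, nC_plus. assert (Hdn := delta_nz h w Hh W3).
unfold l'. field. repeat split; auto.
Qed.
End Continuation.

Lemma mero_CpowZ f p c : mero_at f c -> mero_at (fun z => CpowZ (f z) p) c.
Proof.
intros H. destruct p as [|k|k]; simpl. apply holo_mero, holo_const. apply mero_pow, H.
apply (mero_inv (fun z => f z ^ Pos.to_nat k)), mero_pow, H.
Qed.

Lemma elliptic_divisibility a b s a0 b0 : (0 < a)%nat -> (0 < b)%nat -> (0 < s)%nat -> (1 <= a0 + b0)%nat ->
  elliptic_from a b s a0 b0 ->
  Nat.divide s (a + b + s) \/ (a0 = b0 /\ a = b /\ Nat.divide s (2 * (a + b + s))).
Proof.
intros Ha Hb Hs Ht [psi [Hfun [Pi [p [q [[Hmero _] [_ [Hq Hpow]]]]]]]].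
destruct (dual_integral a b s Ha Hb Hs) as [z1 Hz1].
destruct (key_relation a b s a0 b0 q psi (fun z => CpowZ (Pi z) p) z1 Ha Hb Hs Hq) as [E [HE KL]]; auto.
{ intros z. exact (mero_CpowZ Pi p z (Hmero z)). }
exact (urn_arithmetic a b s a0 b0 Ha Hb Hs Ht E HE KL).
Qed.

(** * Jacobi's functions *)

Lemma real_constant (f : R -> R) x y : (forall t, is_derive f t 0%R) -> f x = f y.
Proof.
intros H. apply RtoC_inj, (zero_derivative_constant (fun t => RtoC (f t))). intros t _. apply rder_RtoC, H.
Qed.

(** Jacobi's amplitude with parameter [m], the square of the modulus. *)
Record amplitude (m : R) : Type := {
  am : R -> R; per : R; per_pos : (0 < per)%R;
  am_derive : forall y, is_derive am y (sqrt (1 - m * (sin (am y) * sin (am y))));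
  am_0 : am 0%R = 0%R;
  am_odd : forall y, am (- y)%R = (- am y)%R;
  am_per : forall y, am (y + per)%R = (am y + 2 * PI)%R;
  am_onto : forall phi, exists y, am y = phi }.

Lemma amp_arg m t : (0 < m < 1)%R -> (0 < 1 - m * (sin t * sin t) <= 1)%R.
Proof. intros Hm. pose proof (sin2_cos2 t) as E. unfold Rsqr in E. assert (0 <= cos t * cos t)%R by nra. nra. Qed.

(** It inverts the elliptic integral [F], which grows at least as fast as the
  identity. *)
Lemma amplitude_exists m : (0 < m < 1)%R -> inhabited (amplitude m).
Proof.
intros Hm. set (p := fun t => (/ sqrt (1 - m * (sin t * sin t)))%R).
assert (P1 : forall t, (1 <= p t)%R).
{ intros t. destruct (amp_arg m t Hm) as [A1 A2]. unfold p. apply sqrt_le_1_alt in A2. rewrite sqrt_1 in A2.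
  rewrite <- Rinv_1 at 1. apply Rinv_le_contravar; auto. apply sqrt_lt_R0; auto. }
assert (Pc : forall t, continuous p t).
{ intros t. destruct (amp_arg m t Hm) as [A1 A2]. pose proof (sqrt_lt_R0 _ A1) as A3.
  apply (ex_derive_continuous (K := R_AbsRing) (V := R_NormedModule)). unfold p. auto_derive.
  repeat split; auto; apply Rgt_not_eq; exact A3. }
set (F := (fun x => RInt p 0 x) : R -> R).
assert (DF : forall x, is_derive F x (p x)).
{ intros x. apply (is_derive_RInt p F 0 x); [|apply Pc]. apply filter_forall. intros y.
  apply (RInt_correct (V := R_CompleteNormedModule)), (ex_RInt_continuous (V := R_CompleteNormedModule)).
  intros z _. apply Pc. }
assert (F0 : F 0%R = 0%R) by (unfold F; apply (RInt_point (V := R_CompleteNormedModule))).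
assert (CF : forall x, continuity_pt F x).
{ intros x. apply continuity_pt_filterlim, (ex_derive_continuous (K := R_AbsRing) (V := R_NormedModule)).
  exists (p x). apply DF. }
assert (Grow : forall x y, (x <= y)%R -> (y - x <= F y - F x)%R).
{ intros x y Hxy. destruct (MVT_gen F x y p) as [c [_ E]]. intros; apply DF. intros; apply CF. rewrite E. pose proof (P1 c). nra. }
assert (Lip : forall x y, (Rabs (y - x) <= Rabs (F y - F x))%R).
{ intros x y. destruct (Rle_dec x y).
  - pose proof (Grow x y ltac:(lra)). rewrite !Rabs_pos_eq; lra.
  - pose proof (Grow y x ltac:(lra)). rewrite !Rabs_left1; lra. }
assert (Inj : forall x y, F x = F y -> x = y).
{ intros x y E. pose proof (Lip x y) as H. rewrite E, Rminus_diag, Rabs_R0 in H. pose proof (Rabs_pos (y - x)).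
  assert (H1 : Rabs (y - x) = 0%R) by lra. apply Rabs_eq_0 in H1. lra. }
assert (Surj : forall y, exists x, F x = y).
{ intros y. set (b := (Rabs y + 1)%R). pose proof (Rabs_pos y). pose proof (Rle_abs y). pose proof (Rle_abs (- y)) as H1. rewrite Rabs_Ropp in H1.
  pose proof (Grow 0%R b ltac:(unfold b; lra)). pose proof (Grow (- b)%R 0%R ltac:(unfold b; lra)).
  destruct (IVT (fun x => F x - y)%R (- b) b) as [x [_ Hx]]; try (unfold b in *; lra).
  - intros x. apply continuity_pt_minus. apply CF. apply continuity_pt_const. intros ? ?; auto.
  - exists x. lra. }
set (f := fun y => proj1_sig (constructive_indefinite_description _ (Surj y))).
assert (Ff : forall y, F (f y) = y).
{ intros y. unfold f. destruct constructive_indefinite_description; auto. }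
assert (Odd : forall x, F (- x)%R = (- F x)%R).
{ intros x. assert (E : (F (- x) + F x = F (- 0) + F 0)%R).
  { apply (real_constant (fun x => F (- x) + F x)%R). intros t. replace 0%R with (-1 * p (- t)%R + p t)%R.
    2:{ unfold p. rewrite sin_neg, Rmult_opp_opp. ring. }
    apply @is_derive_plus; [|apply DF].
    apply (is_derive_comp (K := R_AbsRing) F (fun x => - x)%R t (p (- t)%R) (-1)%R). apply DF. auto_derive; auto; ring. }
  rewrite Ropp_0, F0 in E. lra. }
assert (Per : forall x, F (x + 2 * PI)%R = (F x + F (2 * PI))%R).
{ intros x. assert (E : (F (x + 2 * PI) - F x = F (0 + 2 * PI) - F 0)%R).
  { apply (real_constant (fun x => F (x + 2 * PI) - F x)%R). intros t. replace 0%R with (1 * p (t + 2 * PI) - p t)%R.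
    2:{ unfold p. rewrite sin_plus, cos_2PI, sin_2PI, Rmult_1_r, Rmult_0_r, Rplus_0_r. ring. }
    apply @is_derive_minus; [|apply DF].
    apply (is_derive_comp (K := R_AbsRing) F (fun x => x + 2 * PI)%R t (p (t + 2 * PI)%R) 1%R). apply DF. auto_derive; auto; ring. }
  rewrite Rplus_0_l, F0 in E. lra. }
pose proof PI_RGT_0 as Hpi. constructor. apply (Build_amplitude m f (F (2 * PI)%R)).
- pose proof (Grow 0%R (2 * PI)%R ltac:(lra)). lra.
- intros y. assert (HD := P1 (f y)).
  replace (sqrt (1 - m * (sin (f y) * sin (f y)))) with (/ p (f y))%R by (unfold p; rewrite Rinv_inv; auto).
  set (D := p (f y)) in *. split. { apply is_linear_scal_l. }
  intros y' Hy'. assert (y' = y) as ->. { symmetry. apply is_filter_lim_locally_unique. exact Hy'. }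
  intros eps. destruct (proj2 (DF (f y)) (f y) (fun P HP => HP) eps) as [r B].
  exists r. intros s Hs. change (Rabs (s - y) < r)%R in Hs.
  assert (L := Lip (f y) (f s)). rewrite !Ff in L.
  assert (B' : (Rabs (F (f s) - F (f y) - (f s - f y) * D) <= eps * Rabs (f s - f y))%R).
  { apply B. change (Rabs (f s - f y) < r)%R. lra. }
  rewrite !Ff in B'. change (Rabs (f s - f y - (s - y) * / D) <= eps * Rabs (s - y))%R.
  replace (f s - f y - (s - y) * / D)%R with (- / D * (s - y - (f s - f y) * D))%R by (field; lra).
  assert (0 < / D)%R by (apply Rinv_0_lt_compat; lra).
  rewrite Rabs_mult, Rabs_Ropp, (Rabs_pos_eq (/ D)) by lra.
  assert (/ D <= 1)%R by (rewrite <- Rinv_1; apply Rinv_le_contravar; lra).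
  pose proof (cond_pos eps). apply Rle_trans with (1 * (eps * Rabs (f s - f y)))%R.
  + apply Rmult_le_compat; try lra. apply Rabs_pos.
  + rewrite Rmult_1_l. apply Rmult_le_compat_l; lra.
- apply Inj. rewrite Ff, F0. reflexivity.
- intros y. apply Inj. rewrite Odd, !Ff. reflexivity.
- intros y. apply Inj. rewrite Per, !Ff. reflexivity.
- intros phi. exists (F phi). apply Inj, Ff.
Qed.

Arguments am {m} _ _.
Arguments per {m} _.

Definition sn {m} (A : amplitude m) x := sin (am A x).
Definition cn {m} (A : amplitude m) x := cos (am A x).
Definition dn {m} (A : amplitude m) x := sqrt (1 - m * (sin (am A x) * sin (am A x))).

Section RealJacobi.
Variables (m : R) (A : amplitude m).
Hypothesis Hm : (0 < m < 1)%R.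

Lemma sn_derive x : is_derive (sn A) x (cn A x * dn A x)%R.
Proof.
rewrite Rmult_comm. exact (is_derive_comp (K := R_AbsRing) sin (am A) x _ _ (is_derive_sin _) (am_derive m A x)).
Qed.

Lemma cn_derive x : is_derive (cn A) x (- (sn A x * dn A x))%R.
Proof.
replace (- (sn A x * dn A x))%R with (dn A x * - sin (am A x))%R by (unfold sn; ring).
exact (is_derive_comp (K := R_AbsRing) cos (am A) x _ _ (is_derive_cos _) (am_derive m A x)).
Qed.

Lemma dn_sqr x : (dn A x * dn A x = 1 - m * (sn A x * sn A x))%R.
Proof. unfold dn. apply sqrt_sqrt. left. apply amp_arg, Hm. Qed.

Lemma cn_sqr x : (cn A x * cn A x = 1 - sn A x * sn A x)%R.
Proof. pose proof (sin2_cos2 (am A x)) as E. unfold Rsqr in E. unfold cn, sn. lra. Qed.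

Lemma dn_derive x : is_derive (dn A) x (- (m * (sn A x * cn A x)))%R.
Proof.
assert (Hx : (0 < dn A x)%R) by apply sqrt_lt_R0, amp_arg, Hm.
replace (- (m * (sn A x * cn A x)))%R with (dn A x * (- (m * (sn A x * cn A x)) / dn A x))%R by (field; lra).
apply (is_derive_comp (K := R_AbsRing) (fun t => sqrt (1 - m * (sin t * sin t))) (am A) x
  (- (m * (sn A x * cn A x)) / dn A x)%R (dn A x)); [|apply am_derive].
unfold dn, sn, cn in *. auto_derive. apply amp_arg, Hm. unfold Rminus in *. field. lra.
Qed.

Lemma jacobi_neg x : (sn A (- x) = - sn A x /\ cn A (- x) = cn A x /\ dn A (- x) = dn A x)%R.
Proof. unfold sn, cn, dn. rewrite am_odd, sin_neg, cos_neg, Rmult_opp_opp. auto. Qed.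

Lemma jacobi_per x : (sn A (x + per A) = sn A x /\ cn A (x + per A) = cn A x /\ dn A (x + per A) = dn A x)%R.
Proof.
unfold sn, cn, dn. rewrite am_per, sin_plus, cos_plus, sin_2PI, cos_2PI, !Rmult_1_r, !Rmult_0_r, Rplus_0_r, Rminus_0_r. auto.
Qed.

Lemma jacobi_0 : sn A 0 = 0%R /\ cn A 0 = 1%R /\ dn A 0 = 1%R.
Proof. unfold sn, cn, dn. rewrite am_0, sin_0, cos_0, !Rmult_0_r, Rminus_0_r, sqrt_1. auto. Qed.
End RealJacobi.

Ltac rcs :=
  lazymatch goal with
  | |- rc (fun _ => ?c) _ => apply rc_const
  | |- rc (fun w => @?f w * @?g w)%R _ => apply (rc_mult f g); rcs
  | |- rc (fun w => @?f w / @?g w)%R _ => apply (rc_mult f (fun w => / g w)%R); rcs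
  | |- rc (fun w => - @?f w)%R _ => apply (rc_comp Ropp f); [rcs | auto_derive; auto]
  | |- rc (fun w => @?f w - @?g w)%R _ => apply (rc_minus f g); rcs
  | |- _ => auto
  end.

Section ComplexJacobi.
Variables (m : R) (J : amplitude m) (J' : amplitude (1 - m)).
Hypothesis Hm : (0 < m < 1)%R.
Let Hm' : (0 < 1 - m < 1)%R. Proof. lra. Qed.

(** The addition theorem at [x + i y], where Jacobi's imaginary transformation
  expresses the functions at [i y] by those with parameter [1 - m] at [y]. *)
Definition jden (x y : R) : R := (1 - (1 - m * (sn J x * sn J x)) * (sn J' y * sn J' y))%R.
Definition csn (z : C) : C :=
  ((sn J (fst z) * dn J' (snd z)) / jden (fst z) (snd z),
   (cn J (fst z) * dn J (fst z) * sn J' (snd z) * cn J' (snd z)) / jden (fst z) (snd z))%R.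
Definition ccn (z : C) : C :=
  ((cn J (fst z) * cn J' (snd z)) / jden (fst z) (snd z),
   - (sn J (fst z) * dn J (fst z) * sn J' (snd z) * dn J' (snd z)) / jden (fst z) (snd z))%R.
Definition cdn (z : C) : C :=
  ((dn J (fst z) * cn J' (snd z) * dn J' (snd z)) / jden (fst z) (snd z),
   - (m * sn J (fst z) * cn J (fst z) * sn J' (snd z)) / jden (fst z) (snd z))%R.

(* abstracts the real Jacobi functions; [H] is the only denominator *)
Ltac jacobi_field x y H :=
  generalize (cn_sqr m J x) (dn_sqr m J Hm x) (cn_sqr _ J' y) (dn_sqr _ J' Hm' y); revert H; unfold jden;
  generalize (sn J x) (cn J x) (dn J x) (sn J' y) (cn J' y) (dn J' y);
  intros s c d s1 c1 d1 H Q1 Q2 Q3 Q4; (field_simplify_eq; [ring [Q1 Q2 Q3 Q4] | auto]).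

Lemma partials (x y : R) : jden x y <> 0%R ->
  (rder (fun t => csn (t, y)) x (ccn (x, y) * cdn (x, y)) /\
   rder (fun t => csn (x, t)) y (Ci * (ccn (x, y) * cdn (x, y)))) /\
  (rder (fun t => ccn (t, y)) x (- (csn (x, y) * cdn (x, y))) /\
   rder (fun t => ccn (x, t)) y (Ci * - (csn (x, y) * cdn (x, y)))) /\
  (rder (fun t => cdn (t, y)) x (- (RtoC m * (csn (x, y) * ccn (x, y)))) /\
   rder (fun t => cdn (x, t)) y (Ci * - (RtoC m * (csn (x, y) * ccn (x, y))))).
Proof.
intros HD.
assert (D1 := sn_derive m J x). assert (D2 := cn_derive m J x). assert (D3 := dn_derive m J Hm x).
assert (D4 := sn_derive _ J' y). assert (D5 := cn_derive _ J' y). assert (D6 := dn_derive _ J' Hm' y).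
pose proof (is_derive_unique _ _ _ D1 : Derive (fun t => sn J t) x = _) as U1. pose proof (is_derive_unique _ _ _ D2 : Derive (fun t => cn J t) x = _) as U2.
pose proof (is_derive_unique _ _ _ D3 : Derive (fun t => dn J t) x = _) as U3. pose proof (is_derive_unique _ _ _ D4 : Derive (fun t => sn J' t) y = _) as U4.
pose proof (is_derive_unique _ _ _ D5 : Derive (fun t => cn J' t) y = _) as U5. pose proof (is_derive_unique _ _ _ D6 : Derive (fun t => dn J' t) y = _) as U6.
apply (ex_intro _ _) in D1, D2, D3, D4, D5, D6.
refine (conj (conj _ _) (conj (conj _ _) (conj _ _)));
  cbv beta iota delta [Cmult Copp Ci RtoC fst snd csn ccn cdn]; apply rder_pair; unfold jden;
  (auto_derive; [ repeat split; auto | ]);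
  rewrite ?U1, ?U2, ?U3, ?U4, ?U5, ?U6; clear U1 U2 U3 U4 U5 U6 D1 D2 D3 D4 D5 D6; jacobi_field x y HD.
Qed.

Lemma jden_rc z : rc (fun w => jden (fst w) (snd w)) z /\ (jden (fst z) (snd z) <> 0%R -> cont csn z /\ cont ccn z /\ cont cdn z).
Proof.
assert (X : forall (f f' : R -> R), (forall x, is_derive f x (f' x)) ->
  rc (fun w : C => f (fst w)) z /\ rc (fun w : C => f (snd w)) z).
{ intros f f' H. split; apply rc_comp; try apply rc_fst; try apply rc_snd; eexists; apply H. }
destruct (X _ _ (sn_derive m J)), (X _ _ (cn_derive m J)), (X _ _ (dn_derive m J Hm)).
destruct (X _ _ (sn_derive _ J')), (X _ _ (cn_derive _ J')), (X _ _ (dn_derive _ J' Hm')).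
assert (Dc : rc (fun w => jden (fst w) (snd w)) z) by (unfold jden; rcs).
split; auto. intros HD.
assert (ID : rc (fun w => / jden (fst w) (snd w))%R z).
{ apply (rc_comp Rinv (fun w => jden (fst w) (snd w))); auto. auto_derive; auto. }
refine (conj _ (conj _ _)); apply cont_pair; rcs.
Qed.

Lemma jden_locally z : jden (fst z) (snd z) <> 0%R -> locally z (fun w : C => jden (fst w) (snd w) <> 0%R).
Proof.
intros H. assert (A := cont_nonzero (fun w => RtoC (jden (fst w) (snd w))) z
  (cont_pair _ (fun _ => 0%R) z (proj1 (jden_rc z)) (rc_const _ z)) (RtoC_neq _ _ H)).
near A. intros w Hw E. apply Hw. exact (f_equal RtoC E).
Qed.

Lemma jacobi_cder z : jden (fst z) (snd z) <> 0%R ->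
  cder csn z (ccn z * cdn z) /\ cder ccn z (- (csn z * cdn z)) /\ cder cdn z (- (RtoC m * (csn z * ccn z))).
Proof.
intros HD.
assert (Opp : forall f w, cont f w -> cont (fun w => - f w) w).
{ intros f w. exact (continuous_opp (K := C_AbsRing) (V := C_NormedModule) f w). }
refine (conj _ (conj _ _));
  [ apply (cauchy_riemann csn (fun w => ccn w * cdn w)) | apply (cauchy_riemann ccn (fun w => - (csn w * cdn w)))
  | apply (cauchy_riemann cdn (fun w => - (RtoC m * (csn w * ccn w)))) ];
  (near (jden_locally z HD); intros [x y] Hw; destruct (proj2 (jden_rc (x, y)) Hw) as [K1 [K2 K3]];
   destruct (partials x y Hw) as [[P1 P2] [[P3 P4] [P5 P6]]]; split; [assumption | split; [assumption |]]).
- apply cont_mult; auto.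
- apply Opp, cont_mult; auto.
- apply Opp. apply (cont_mult (fun _ => RtoC m)). apply holo_cont, holo_const. apply cont_mult; auto.
Qed.

Lemma jacobi_relations z : jden (fst z) (snd z) <> 0%R ->
  csn z * csn z = 1 - ccn z * ccn z /\ cdn z * cdn z = 1 - RtoC m * (csn z * csn z).
Proof.
destruct z as [x y]. simpl fst; simpl snd. intros HD.
split; cbv beta iota delta [csn ccn cdn Cmult Cminus Cplus Copp RtoC fst snd]; f_equal; unfold jden; jacobi_field x y HD.
Qed.

Lemma jacobi_periods : period ccn (RtoC (per J)) /\ period ccn (Ci * RtoC (per J')).
Proof.
split; intros [x y].
- replace ((x, y) + RtoC (per J)) with ((x + per J, y)%R : C) by (apply injective_projections; simpl; ring).
  unfold ccn, jden. simpl fst; simpl snd. destruct (jacobi_per m J x) as [-> [-> ->]]. reflexivity.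
- replace ((x, y) + Ci * RtoC (per J')) with ((x, y + per J')%R : C) by (apply injective_projections; simpl; ring).
  unfold ccn, jden. simpl fst; simpl snd. destruct (jacobi_per _ J' y) as [-> [-> ->]]. reflexivity.
Qed.

Lemma ccn_real x : jden x 0 <> 0%R /\ ccn (RtoC x) = RtoC (cn J x).
Proof.
unfold ccn, jden, RtoC. simpl fst; simpl snd. destruct (jacobi_0 _ J') as [-> [-> ->]].
rewrite Rmult_0_r, Rmult_0_r, Rminus_0_r. split. lra. f_equal; field.
Qed.

Lemma ccn_holo z : jden (fst z) (snd z) <> 0%R -> holomorphic_near ccn z.
Proof.
intros H. unfold holomorphic_near. near (jden_locally z H).
intros w Hw. destruct (jacobi_cder w Hw) as [_ [D _]]. eexists. exact D.
Qed.
End ComplexJacobi.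

Lemma amplitude_transport m m' (J : amplitude m) : m' = m -> exists K : amplitude m', forall x, am K x = am J x.
Proof. intros ->. exists J. auto. Qed.

(** Poles of [cn] are handled by the imaginary transformation in the other
  direction: [cn z] is the inverse of the function with parameter [1 - m] at
  [- i z]. *)
Section Pole.
Variables (m : R) (J : amplitude m) (J' : amplitude (1 - m)) (K : amplitude (1 - (1 - m))).
Hypothesis Hm : (0 < m < 1)%R.
Hypothesis HK : forall x, am K x = am J x.
Let Hm' : (0 < 1 - m < 1)%R. Proof. lra. Qed.

Lemma K_neg x : (sn K (- x) = - sn J x /\ cn K (- x) = cn J x /\ dn K (- x) = dn J x)%R.
Proof.
destruct (jacobi_neg _ K x) as [-> [-> ->]]. unfold sn, cn, dn. rewrite HK. repeat split.
f_equal. ring.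
Qed.

Lemma rotate_pair x y : 0 + - Ci * ((x, y) : C) = (y, - x)%R.
Proof. apply injective_projections; simpl; ring. Qed.

Lemma jden_both x y : jden m J J' x y = 0%R ->
  sn J x = 0%R /\ cn J' y = 0%R /\ jden (1 - m) J' K y (- x) <> 0%R.
Proof.
unfold jden. destruct (K_neg x) as [-> _]. intros H.
assert (Q3 := cn_sqr _ J' y). assert (P1 := Rle_0_sqr (cn J' y)). assert (P2 := Rle_0_sqr (sn J x)).
assert (P3 := Rle_0_sqr (sn J' y)). unfold Rsqr in *.
set (S := (sn J x * sn J x)%R) in *. set (T := (sn J' y * sn J' y)%R) in *.
assert (Hp : (0 <= S * T)%R) by (apply Rmult_le_pos; auto).
assert (Hp0 : (S * T = 0)%R) by nra. assert (HT : T = 1%R) by nra. rewrite HT, Rmult_1_r in Hp0.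
assert (sn J x = 0%R) by (unfold S in Hp0; nra). assert (cn J' y = 0%R) by nra.
split; auto. split; auto. replace (- sn J x)%R with 0%R by lra. lra.
Qed.

Lemma ccn_inverse z : jden (1 - m) J' K (snd z) (- fst z) <> 0%R -> ccn m J J' z = / ccn (1 - m) J' K (0 + - Ci * z).
Proof.
destruct z as [x y]. simpl fst; simpl snd. intros HD'. rewrite rotate_pair.
destruct (K_neg x) as [E1 [E2 E3]].
destruct (Req_dec (jden m J J' x y) 0) as [HD|HD].
- destruct (jden_both x y HD) as [H1 [H2 _]]. unfold ccn. simpl fst; simpl snd. rewrite HD, E1, H1, H2. unfold Rdiv. rewrite Rinv_0.
  match goal with |- _ = / ?z => replace z with (RtoC 0) by (apply injective_projections; simpl; ring) end.
  rewrite Cinv_0. apply injective_projections; simpl; ring.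
- assert (N : ccn m J J' (x, y) * ccn (1 - m) J' K (y, (- x)%R) = 1).
  { unfold ccn, jden in *. simpl fst in *; simpl snd in *. rewrite E1, E2, E3 in *.
    generalize (cn_sqr m J x) (dn_sqr m J Hm x) (cn_sqr _ J' y) (dn_sqr _ J' Hm' y).
    cbv beta iota delta [Cmult RtoC fst snd].
    revert HD HD'. generalize (sn J x) (cn J x) (dn J x) (sn J' y) (cn J' y) (dn J' y).
    intros s c d s1 c1 d1 HD HD' Q1 Q2 Q3 Q4.
    f_equal; (field_simplify_eq; [ring [Q1 Q2 Q3 Q4] | auto]). }
  assert (Nz : ccn (1 - m) J' K (y, (- x)%R) <> 0).
  { intros Z. rewrite Z, Cmult_0_r in N. symmetry in N. exact (C1_nz N). }
  rewrite <- (Cmult_1_l (/ _)), <- N. field. auto.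
Qed.

Lemma ccn_mero z : mero_at (ccn m J J') z.
Proof.
destruct (Req_dec (jden m J J' (fst z) (snd z)) 0) as [HD|HD]; [|apply holo_mero, ccn_holo; auto].
destruct (jden_both _ _ HD) as [_ [_ HD']].
assert (Hr : 0 + - Ci * z = (snd z, - fst z)%R) by (destruct z; apply rotate_pair).
apply (mero_ext (fun w => / ccn (1 - m) J' K (0 + - Ci * w))).
- assert (L := jden_locally (1 - m) J' K Hm' (snd z, (- fst z)%R) HD'). rewrite <- Hr in L.
  assert (Hc : cont (fun w => 0 + - Ci * w) z) by (apply holo_cont; holo).
  near (locally_cont _ Hc L).
  intros [x y] Hw _. rewrite rotate_pair in Hw. symmetry. apply ccn_inverse. exact Hw.
- apply mero_inv, (mero_affine (ccn (1 - m) J' K) 0 (- Ci) z).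
  + apply Copp_nz, Ci_nz.
  + rewrite Hr. apply holo_mero, ccn_holo; auto.
Qed.
End Pole.

(** Jacobi's [cn] and its derivative [v]; the point [z0] is real. *)
Lemma jacobi_cn m : (0 < m < 1)%R -> exists (f v : C -> C) (w1 w2 : C),
  (forall x y : R, RtoC x * w1 + RtoC y * w2 = 0 -> x = 0%R /\ y = 0%R) /\
  period f w1 /\ period f w2 /\ meromorphic f /\
  forall k : R, (-1 <= k <= 1)%R -> exists z0 : C, f z0 = RtoC k /\
    locally z0 (fun z : C => cder f z (v z) /\ cder v z (f z * (2 * RtoC m - 1 - 2 * RtoC m * (f z * f z))) /\
      v z * v z = (1 - f z * f z) * (1 - RtoC m + RtoC m * (f z * f z))).
Proof.
intros Hm. destruct (amplitude_exists m Hm) as [J]. destruct (amplitude_exists (1 - m)) as [J']. lra.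
destruct (amplitude_transport m (1 - (1 - m)) J) as [K HK]. ring.
exists (ccn m J J'), (fun z => - (csn m J J' z * cdn m J J' z)), (RtoC (per J)), (Ci * RtoC (per J')).
destruct (jacobi_periods m J J') as [P1 P2]. assert (T1 := per_pos m J). assert (T2 := per_pos _ J').
split; [|split; [exact P1 | split; [exact P2 | split]]].
- intros x y E. assert (E1 := f_equal fst E). assert (E2 := f_equal snd E). simpl in E1, E2. nra.
- intros z. exact (ccn_mero m J J' K Hm HK z).
- intros k Hk. destruct (am_onto m J (acos k)) as [x Hx]. exists (RtoC x).
  destruct (ccn_real m J J' x) as [HD Ex]. rewrite Ex. unfold cn at 1. rewrite Hx, cos_acos by auto. split; auto.
  near (jden_locally m J J' Hm (RtoC x) HD). intros z Hz.
  destruct (jacobi_cder m J J' Hm z Hz) as [D1 [D2 D3]].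
  destruct (jacobi_relations m J J' Hm z Hz) as [R1 R2].
  set (S := csn m J J' z) in *. set (D := cdn m J J' z) in *. set (X := ccn m J J' z) in *. split; [exact D2 | split].
  + eapply cder_eq. apply cder_opp. exact (cder_mult _ _ z _ _ D1 D3). cbv beta. fold S D.
    replace (- (X * D * D + S * - (RtoC m * (S * X)))) with (X * (RtoC m * (S * S) - D * D)) by ring.
    rewrite R2, R1. ring.
  + replace (- (S * D) * - (S * D)) with ((S * S) * (D * D)) by ring. rewrite R2, R1. ring.
Qed.

(** * Doubly periodic solutions of second order equations *)

Definition mero2 (w1 w2 : C) (f : C -> C) : Prop := meromorphic f /\ period f w1 /\ period f w2.

Definition independent (w1 w2 : C) : Prop :=
  forall x y : R, RtoC x * w1 + RtoC y * w2 = 0 -> x = 0%R /\ y = 0%R.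

Lemma mero2_const w1 w2 k : mero2 w1 w2 (fun _ => k).
Proof. split; [|split]; try (intros z; reflexivity). intros z. apply holo_mero, holo_const. Qed.

Lemma mero2_plus w1 w2 f g : mero2 w1 w2 f -> mero2 w1 w2 g -> mero2 w1 w2 (fun z => f z + g z).
Proof.
intros [M1 [P1 Q1]] [M2 [P2 Q2]]. split; [|split]; intros z.
exact (mero_plus f g z (M1 z) (M2 z)). rewrite (P1 z), (P2 z); reflexivity. rewrite (Q1 z), (Q2 z); reflexivity.
Qed.

Lemma mero2_mult w1 w2 f g : mero2 w1 w2 f -> mero2 w1 w2 g -> mero2 w1 w2 (fun z => f z * g z).
Proof.
intros [M1 [P1 Q1]] [M2 [P2 Q2]]. split; [|split]; intros z.
exact (mero_mult f g z (M1 z) (M2 z)). rewrite (P1 z), (P2 z); reflexivity. rewrite (Q1 z), (Q2 z); reflexivity.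
Qed.

Lemma mero2_inv w1 w2 f : mero2 w1 w2 f -> mero2 w1 w2 (fun z => / f z).
Proof.
intros [M1 [P1 Q1]]. split; [|split]; intros z.
exact (mero_inv f z (M1 z)). rewrite (P1 z); reflexivity. rewrite (Q1 z); reflexivity.
Qed.

Lemma mero2_div w1 w2 f g : mero2 w1 w2 f -> mero2 w1 w2 g -> mero2 w1 w2 (fun z => f z / g z).
Proof. intros H1 H2. apply (mero2_mult w1 w2 f (fun z => / g z)); auto. apply mero2_inv; auto. Qed.

Lemma mero2_minus w1 w2 f g : mero2 w1 w2 f -> mero2 w1 w2 g -> mero2 w1 w2 (fun z => f z - g z).
Proof.
intros [M1 [P1 Q1]] [M2 [P2 Q2]]. split; [|split]; intros z; [|rewrite (P1 z), (P2 z) | rewrite (Q1 z), (Q2 z)]; auto.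
apply (mero_ext (fun z => f z + - (1) * g z)). { apply filter_forall. intros; ring. }
apply mero_plus. apply M1. apply (mero_mult (fun _ => - (1))). apply holo_mero, holo_const. apply M2.
Qed.

Ltac mero :=
  lazymatch goal with
  | |- mero2 _ _ (fun _ => ?c) => apply (mero2_const _ _ c)
  | |- mero2 _ _ (fun w => @?f w + @?g w) => apply (mero2_plus _ _ f g); mero
  | |- mero2 _ _ (fun w => @?f w - @?g w) => apply (mero2_minus _ _ f g); mero
  | |- mero2 _ _ (fun w => @?f w * @?g w) => apply (mero2_mult _ _ f g); mero
  | |- mero2 _ _ (fun w => @?f w / @?g w) => apply (mero2_div _ _ f g); mero
  | |- mero2 _ _ (fun w => / @?f w) => apply (mero2_inv _ _ f); mero
  | |- _ => assumption
  end.

Lemma Csqr_eq (x y : C) : x * x = y * y -> x = y \/ x = - y.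
Proof.
intros E. destruct (classic (x - y = 0)) as [H|H]. left; apply Ceq_minus; auto.
right. apply Ceq_minus. apply NNPP. intros H'. apply (Cmult_neq_0 _ _ H H').
replace ((x - y) * (x - - y)) with (x * x - y * y) by ring. rewrite E. ring.
Qed.

(** The initial value problem [F'' = c0 + c2 F^2 + c3 F^3], [F 0 = x0], [F' 0 = x1]. *)
Definition doubly_periodic_solution (c0 c2 c3 x0 x1 : C) : Prop := exists (F G : C -> C) (w1 w2 : C),
  independent w1 w2 /\ mero2 w1 w2 F /\ F 0 = x0 /\ G 0 = x1 /\
  locally (RtoC 0) (fun z : C => cder F z (G z) /\ cder G z (c0 + c2 * (F z * F z) + c3 * (F z * F z * F z))).

(** The solution is a Moebius transform [x = (p f + q) / (r f + t)] of
  [f z = cn (z0 + lam z)] with [f 0 = k]. The hypothesis on all [f] is the equation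
  for [x''], where [Q] and [Q2] stand for [cn'^2] and [cn'']; the sign of [lam]
  is chosen according to the slope. *)
Lemma moebius_solution m k (p q r t lam c0 c2 c3 x0 x1 : C) :
  (0 < m < 1)%R -> (-1 <= k <= 1)%R -> lam <> 0 -> r * RtoC k + t <> 0 ->
  x0 = (p * RtoC k + q) / (r * RtoC k + t) ->
  (forall f : C, r * f + t <> 0 ->
    let Q := (1 - f * f) * (1 - RtoC m + RtoC m * (f * f)) in
    let Q2 := f * (2 * RtoC m - 1 - 2 * RtoC m * (f * f)) in
    let x := (p * f + q) / (r * f + t) in
    lam * lam * ((p * t - q * r) / ((r * f + t) * (r * f + t)) * Q2
      - 2 * r * (p * t - q * r) / ((r * f + t) * (r * f + t) * (r * f + t)) * Q)
    = c0 + c2 * (x * x) + c3 * (x * x * x)) ->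
  x1 * x1 = lam * lam * ((p * t - q * r) * (p * t - q * r)) * ((1 - RtoC k * RtoC k) * (1 - RtoC m + RtoC m * (RtoC k * RtoC k)))
     / ((r * RtoC k + t) * (r * RtoC k + t) * ((r * RtoC k + t) * (r * RtoC k + t))) ->
  doubly_periodic_solution c0 c2 c3 x0 x1.
Proof.
intros Hm Hk Hlam Hrt Hx0 Hode Hx1.
destruct (jacobi_cn m Hm) as [f [v [w1 [w2 [Hind [P1 [P2 [Hmero Hpt]]]]]]]].
destruct (Hpt k Hk) as [z0 [Ez0 Hloc]]. rewrite <- Ez0 in *.
set (M := fun z => (p * f z + q) / (r * f z + t)).
set (V := fun z => (p * t - q * r) / ((r * f z + t) * (r * f z + t)) * v z).
set (A := fun z => (p * t - q * r) / ((r * f z + t) * (r * f z + t)) * (f z * (2 * RtoC m - 1 - 2 * RtoC m * (f z * f z)))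
      - 2 * r * (p * t - q * r) / ((r * f z + t) * (r * f z + t) * (r * f z + t)) * ((1 - f z * f z) * (1 - RtoC m + RtoC m * (f z * f z)))).
assert (HM : mero2 w1 w2 M).
{ assert (Hf : mero2 w1 w2 f) by (split; auto). unfold M. mero. }
assert (Hden : locally z0 (fun z : C => r * f z + t <> 0)).
{ apply (cont_nonzero (fun z => r * f z + t)); auto. destruct (locally_here Hloc) as [D _].
  eapply cder_cont. cderiv. }
assert (HD : locally z0 (fun z : C => cder M z (V z) /\ cder V z (A z) /\
   lam * lam * A z = c0 + c2 * (M z * M z) + c3 * (M z * M z * M z))).
{ near (locally_and Hloc Hden). intros z [[D1 [D2 D3]] Hz]. split; [|split].
  - eapply cder_eq. unfold M. cderiv. exact Hz. unfold V. cbv beta. field. auto.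
  - eapply cder_eq. unfold V. apply cder_mult. apply cder_div. apply cder_const. cderiv. apply Cmult_neq_0; auto. exact D2.
    cbv beta. unfold A. rewrite <- D3. field. auto.
  - exact (Hode (f z) Hz). }
assert (exists l : C, l <> 0 /\ l * l = lam * lam /\ x1 = l * V z0) as [l [Hl [El Ex1]]].
{ destruct (Csqr_eq x1 (lam * V z0)) as [E|E].
  - rewrite Hx1. destruct (locally_here Hloc) as [_ [_ D3]]. rewrite <- D3. unfold V. field. auto.
  - exists lam. auto.
  - exists (- lam). split. apply Copp_nz; auto. split. ring. rewrite E. ring. }
exists (fun z => M (z0 + l * z)), (fun z => l * V (z0 + l * z)), (w1 / l), (w2 / l).
assert (Ez : z0 + l * 0 = z0) by ring.
split.
{ intros x y E. apply Hind. replace (RtoC x * w1 + RtoC y * w2) with (l * (RtoC x * (w1 / l) + RtoC y * (w2 / l))) by (field; auto).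
  rewrite E. ring. }
split.
{ destruct HM as [HM [Q1 Q2]]. split; [|split]; intros z. exact (mero_affine M z0 l z Hl (HM _)).
  rewrite <- (Q1 (z0 + l * z)). f_equal. field; auto. rewrite <- (Q2 (z0 + l * z)). f_equal. field; auto. }
split. { rewrite Ez, Hx0. reflexivity. }
split. { rewrite Ez, Ex1. reflexivity. }
rewrite <- Ez in HD. assert (Hc : cont (fun z => z0 + l * z) 0) by (apply holo_cont; holo).
near (locally_cont _ Hc HD). intros z [D1 [D2 E]].
assert (Da : cder (fun z => z0 + l * z) z l). { eapply cder_eq. cderiv. ring. }
split.
- eapply cder_eq. exact (cder_comp M _ z _ _ D1 Da). ring.
- eapply cder_eq. apply cder_mult. apply cder_const. exact (cder_comp V _ z _ _ D2 Da).
  cbv beta. rewrite <- E, <- El. ring.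
Qed.

Definition T : C := RtoC (sqrt 3).
Definition hex_m : R := ((2 + sqrt 3) / 4)%R.
Definition rho : C := RtoC (sqrt (sqrt 3)).

Lemma sqrt3_bounds : (1 < sqrt 3 < 2)%R.
Proof.
split.
- rewrite <- sqrt_1 at 1. apply sqrt_lt_1_alt; lra.
- replace 2%R with (sqrt (2 * 2)) by (apply sqrt_square; lra). apply sqrt_lt_1_alt; lra.
Qed.

Lemma hex_constants : T ^ 2 = 3 /\ rho * rho = T /\ rho <> 0 /\ RtoC hex_m = (2 + T) / 4 /\ (0 < hex_m < 1)%R.
Proof.
pose proof sqrt3_bounds as B.
assert (Er : rho * rho = T) by (unfold rho; rewrite <- RtoC_mult, sqrt_sqrt by lra; reflexivity).
split. { unfold T. simpl. rewrite Cmult_1_r, <- RtoC_mult, sqrt_sqrt by lra. reflexivity. }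
split; auto. split.
{ intros E. rewrite E, Cmult_0_l in Er. symmetry in Er. apply RtoC_inj in Er. lra. }
unfold hex_m, T. rewrite RtoC_div, RtoC_plus by lra. split. reflexivity. lra.
Qed.

(* decides rational identities in [T], [rho] and the free variables *)
Ltac hex_field := destruct hex_constants as [ET [Er [_ [Em _]]]]; rewrite ?Em;
  field_simplify_eq; [cbv beta; ring [ET Er] | repeat split; auto].

(** [c ((1 + T) f + 1 - T) / (f + 1)] with [m = (2 + T) / 4], [T^2 = 3] satisfies
  [3 x'^2 = 2 c2 (x^3 - c^3)]: the period lattice is hexagonal. *)
Lemma hexagonal_solution k (c sigma c2 x0 x1 : C) : (-1 < k <= 1)%R -> c <> 0 -> sigma <> 0 ->
  x0 * (RtoC k + 1) = c * ((1 + T) * RtoC k + (1 - T)) ->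
  2 * (c * c2) = - (3 * (sigma * sigma)) -> 3 * (x1 * x1) = 2 * c2 * (x0 * x0 * x0 - c * c * c) ->
  doubly_periodic_solution 0 c2 0 x0 x1.
Proof.
intros Hk Hc Hs Ex Ec Ex1. destruct hex_constants as [_ [_ [Hr [_ Hm]]]].
assert (Ec' : c2 = - (3 * (sigma * sigma)) / (2 * c)) by (rewrite <- Ec; field; auto).
assert (Hk1 : RtoC k + 1 <> 0) by (rewrite <- RtoC_plus; apply RtoC_neq; lra).
assert (Hk2 : 1 * RtoC k + 1 <> 0) by (rewrite Cmult_1_l; auto).
assert (Ex' : x0 = c * ((1 + T) * RtoC k + (1 - T)) / (RtoC k + 1)) by (rewrite <- Ex; field; auto).
apply (moebius_solution hex_m k (c * (1 + T)) (c * (1 - T)) 1 1 (rho * sigma)); auto.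
- lra.
- apply Cmult_neq_0; auto.
- rewrite Ex'. field. auto.
- intros f Hf Q Q2 x. unfold Q, Q2, x. rewrite Ec'. replace (1 * f + 1) with (f + 1) in * by ring. hex_field.
- replace (x1 * x1) with (3 * (x1 * x1) / 3) by field. rewrite Ex1, Ec', Ex'. hex_field.
Qed.

(** The inverse of the preceding function, at a zero of order two. *)
Lemma hexagonal_inverse_solution (sigma c c0 c3 : C) : sigma <> 0 -> c <> 0 -> 2 * c0 = - (sigma * sigma * c) ->
  c3 * (c * c) = 2 * (sigma * sigma) -> doubly_periodic_solution c0 0 c3 0 0.
Proof.
intros Hs Hc H0 H3. destruct hex_constants as [_ [_ [Hr [_ Hm]]]].
assert (E0 : c0 = - (sigma * sigma * c) / 2) by (rewrite <- H0; field).
assert (E3 : c3 = 2 * (sigma * sigma) / (c * c)) by (rewrite <- H3; field; auto).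
assert (Em1 : RtoC (-1) = - (1)) by (apply injective_projections; simpl; ring).
assert (HN : (1 + T) * RtoC (-1) + (1 - T) <> 0).
{ unfold T. rewrite <- !RtoC_plus, <- RtoC_minus, <- RtoC_mult, <- RtoC_plus. apply RtoC_neq. pose proof sqrt3_bounds. lra. }
apply (moebius_solution hex_m (-1) c c (1 + T) (1 - T) (rho * sigma)); auto.
- lra.
- apply Cmult_neq_0; auto.
- rewrite Em1. unfold Cdiv. ring.
- intros f Hf Q Q2 x. unfold Q, Q2, x. rewrite E0, E3. hex_field.
- rewrite Em1. unfold Cdiv. ring.
Qed.

(** [c cn (lam z)] with [m = 1 / 2]: the period lattice is square. *)
Lemma square_solution k (c lam c3 x0 x1 : C) : (-1 <= k <= 1)%R -> c <> 0 -> lam <> 0 -> c3 * (c * c) = - (lam * lam) ->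
  x0 = c * RtoC k -> 2 * (x1 * x1) = c3 * (x0 * x0 * (x0 * x0) - c * c * (c * c)) ->
  doubly_periodic_solution 0 0 c3 x0 x1.
Proof.
intros Hk Hc Hl H3 Ex Ex1. assert (Eh : RtoC (1 / 2) = 1 / 2) by (rewrite RtoC_div by lra; reflexivity).
assert (E3 : c3 = - (lam * lam) / (c * c)) by (rewrite <- H3; field; auto).
apply (moebius_solution (1 / 2) k c 0 0 1 lam); auto.
- lra.
- rewrite Cmult_0_l, Cplus_0_l. apply C1_nz.
- rewrite Ex. field.
- intros f Hf Q Q2 x. unfold Q, Q2, x. rewrite Eh, E3. field. auto.
- replace (x1 * x1) with (2 * (x1 * x1) / 2) by field. rewrite Ex1, Ex, E3, Eh. field. auto.
Qed.

(** A linear system [D1' = i D2], [D2' = i k D1] has no nonzero solution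
  vanishing at [0]: each of [D1] and [D2] would vanish to a smaller order than
  the other one. *)
Lemma linear_system_unique (D1 D2 i k : C -> C) :
  holomorphic_near D1 0 -> holomorphic_near D2 0 -> cont i 0 -> cont k 0 -> D1 0 = 0 -> D2 0 = 0 ->
  locally (RtoC 0) (fun u : C => cder D1 u (i u * D2 u) /\ cder D2 u (i u * (D1 u * k u))) ->
  locally (RtoC 0) (fun u : C => D1 u = 0).
Proof.
intros H1 H2 Hi Hk Z1 Z2 HD.
destruct (zero_order D1 H1) as [|[n [p [Hp [Hp0 Ep]]]]]; auto. exfalso.
destruct (zero_order D2 H2) as [Hz|[m [r [Hr [Hr0 Er]]]]].
- destruct (order_deriv D1 p (fun _ => 0) n n Hp Hp0 Z1) as [Hn [Hn' _]]; auto; [| |lia].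
  + apply holo_cont, holo_const.
  + near (locally_and HD Hz). intros u [[A _] B] _. rewrite B in A. eapply cder_eq. exact A. ring.
- destruct (order_deriv D1 p (fun u => i u * r u) n m Hp Hp0 Z1) as [_ [Hm _]]; auto.
  { apply cont_mult; auto. apply holo_cont; auto. }
  { near (locally_and HD Er). intros u [[A _] B] _. rewrite B in A. eapply cder_eq. exact A. ring. }
  destruct (order_deriv D2 r (fun u => i u * (p u * k u)) m n Hr Hr0 Z2) as [Hm0 [Hn _]]; auto; [| |lia].
  + apply cont_mult; auto. apply cont_mult; auto. apply holo_cont; auto.
  + near (locally_and HD Ep). intros u [[_ A] B] _. rewrite B in A. eapply cder_eq. exact A. ring.
Qed.

(** If [v1' = I' v2] and [v2' = I' (c0 + c2 v1^2 + c3 v1^3)], then [v1] as a function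
  of [I] solves the equation, hence is [F]. *)
Lemma solution_composed a b s (c0 c2 c3 : C) (F G v1 v2 : C -> C) : (0 < a)%nat ->
  locally (RtoC 0) (fun z : C => cder F z (G z) /\ cder G z (c0 + c2 * (F z * F z) + c3 * (F z * F z * F z))) ->
  locally (RtoC 0) (fun u : C => cder v1 u (urn_integrand a b s u * v2 u) /\
    cder v2 u (urn_integrand a b s u * (c0 + c2 * (v1 u * v1 u) + c3 * (v1 u * v1 u * v1 u)))) ->
  F 0 = v1 0 -> G 0 = v2 0 ->
  locally (RtoC 0) (fun u : C => F (urn_integral a b s u) = v1 u).
Proof.
intros Ha HFG Hv E1 E2.
destruct (urn_integral_cder a b s ltac:(lia)) as [I0 Id].
set (I := urn_integral a b s) in *.
assert (HFG' := urn_pull a b s _ Ha HFG). fold I in HFG'. cbv beta in HFG'.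
assert (Pair : forall f f' g g', locally (RtoC 0) (fun u : C => cder f u (f' u) /\ cder g u (g' u)) ->
  holomorphic_near f 0 /\ holomorphic_near g 0).
{ intros f f' g g' H. split; unfold holomorphic_near; near H; intros u [A B]; eexists; eassumption. }
destruct (Pair _ _ _ _ HFG) as [HF HG]. destruct (Pair _ _ _ _ Hv) as [Hv1 Hv2].
assert (HFI := holo_urn_comp F a b s Ha HF). assert (HGI := holo_urn_comp G a b s Ha HG). fold I in HFI, HGI.
assert (Z : locally (RtoC 0) (fun u : C => F (I u) - v1 u = 0)).
{ apply (linear_system_unique (fun u => F (I u) - v1 u) (fun u => G (I u) - v2 u) (urn_integrand a b s)
   (fun u => c2 * (F (I u) + v1 u) + c3 * (F (I u) * F (I u) + F (I u) * v1 u + v1 u * v1 u))).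
  - holo.
  - holo.
  - apply cex_cont, urn_integrand_cex. lia. apply disc_center; lra.
  - apply holo_cont. holo.
  - rewrite I0, E1. ring.
  - rewrite I0, E2. ring.
  - near (locally_and (locally_and HFG' Hv) (locally_disc0 1 Rlt_0_1)).
    intros u [[[A1 A2] [B1 B2]] Hu]. specialize (Id u Hu). split.
    + eapply cder_eq. exact (cder_minus _ _ u _ _ (cder_comp F I u _ _ A1 Id) B1). ring.
    + eapply cder_eq. exact (cder_minus _ _ u _ _ (cder_comp G I u _ _ A2 Id) B2). ring. }
near Z. intros u Hu. apply Ceq_minus. exact Hu.
Qed.

(** * The elliptic urns *)

(** [psi = Q (v1)] near [0], where [v1] is given as an expression [V1] in [u] and
  [delta u] and solves the differential equation along [I]. *)
Lemma elliptic_case a b s a0 b0 (c0 c2 c3 x0 x1 : C) (V1 V2 : C -> C -> C) (Q : C -> C) :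
  let h := (a + b + s)%nat in (0 < a)%nat -> tenable_init a b a0 b0 ->
  V1 0 1 = x0 -> V2 0 1 = x1 -> doubly_periodic_solution c0 c2 c3 x0 x1 ->
  (forall u : C, disc 0 1 u -> cder (fun u => V1 u (delta h u)) u (urn_integrand a b s u * V2 u (delta h u)) /\
    cder (fun u => V2 u (delta h u)) u (urn_integrand a b s u * (c0 + c2 * (V1 u (delta h u) * V1 u (delta h u))
      + c3 * (V1 u (delta h u) * V1 u (delta h u) * V1 u (delta h u))))) ->
  (forall w1 w2 F, mero2 w1 w2 F -> mero2 w1 w2 (fun z => Q (F z))) ->
  holomorphic_near Q x0 ->
  (forall u : C, disc 0 1 u -> Q (V1 u (delta h u)) = u ^ a0 / delta h u ^ (a0 + b0)) ->
  elliptic_urn a b s.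
Proof.
intros h Ha Hinit <- <- [F [G [w1 [w2 [Hind [HF [F0 [G0 HFG]]]]]]]] Hv HQ HQ0 Hpsi.
exists a0, b0. split; auto. exists (fun z => Q (F z)).
assert (D1 := locally_disc0 1 Rlt_0_1). assert (E0 : delta h 0 = 1) by (apply delta_0; unfold h; lia).
assert (L : locally (RtoC 0) (fun u : C => F (urn_integral a b s u) = V1 u (delta h u))).
{ apply (solution_composed a b s c0 c2 c3 F G (fun u => V1 u (delta h u)) (fun u => V2 u (delta h u))); auto; try (rewrite E0; auto).
  near D1. exact Hv. }
split; [split|].
- apply (holo_comp Q F). rewrite F0; auto. unfold holomorphic_near. near HFG. intros z [A _]. eexists; exact A.
- near (locally_and L D1). intros u [E Hu]. rewrite E. apply Hpsi. exact Hu.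
- exists (fun z => Q (F z)), 1%Z, 1%nat. split; [|split; [discriminate | split; [auto|]]].
  + destruct (HQ _ _ _ HF) as [M [P1 P2]]. split; auto. exists w1, w2. auto.
  + apply filter_forall. intros z _. simpl. reflexivity.
Qed.

(* differentiates expressions in [u] and [d = delta u] and compares using [d^h = 1 - u^h] *)
Ltac urn_ode h :=
  let u := fresh "u" in let Hu := fresh "Hu" in intros u Hu;
  let Hh := fresh "Hh" in assert (Hh : (0 < h)%nat) by lia;
  let N := fresh "N" in assert (N := delta_nz h u Hh Hu);
  let P := fresh "P" in assert (P := delta_pow h u Hh Hu);
  let D := fresh "D" in assert (D := delta_cder h u Hh Hu);
  unfold urn_integrand; cbn [Nat.add Nat.sub] in *;
  (split; (eapply cder_eq; [cderiv; try (repeat apply Cmult_neq_0; auto) |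
    cbv beta; set (d := delta h u) in *; clearbody d; clear D;
    field_simplify_eq; [cbv beta; ring [P] | auto]])).

Ltac urn_psi h :=
  let u := fresh "u" in let Hu := fresh "Hu" in intros u Hu;
  let Hh := fresh "Hh" in assert (Hh : (0 < h)%nat) by lia;
  let N := fresh "N" in assert (N := delta_nz h u Hh Hu);
  cbn [Nat.add]; set (d := delta h u) in *; clearbody d; cbn [Cpow]; field; auto.

Ltac urn_init := split; [| split; [| lia]]; match goal with |- Nat.divide ?x ?y => exists (y / x)%nat; reflexivity end.

(* leaves the initial value problem *)
Tactic Notation "urn_case" constr(h) "by" tactic3(t) :=
  t; [lia | urn_init | field | field | | urn_ode h | intros; mero | holo | try urn_psi h].

Lemma C2_nz : RtoC 2 <> 0.
Proof. apply RtoC_neq; lra. Qed.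

Lemma Cm1_nz : - (1) <> 0.
Proof. apply Copp_nz, C1_nz. Qed.

Lemma Ci_sqr : Ci ^ 2 = - (1).
Proof. apply injective_projections; simpl; ring. Qed.

(** The value of [cn] at the zero of [(1 + T) cn + 1 - T]. *)
Definition hex_zero : R := ((sqrt 3 - 1) / (sqrt 3 + 1))%R.

(** At [cn = 1] the derivative of [cn] vanishes and the function has the value [c]. *)
Lemma hexagonal_at_one (sigma c2 : C) : sigma <> 0 -> 2 * c2 = - (3 * (sigma * sigma)) -> doubly_periodic_solution 0 c2 0 1 0.
Proof.
intros Hs Ec. apply (hexagonal_solution 1 1 sigma); auto; try ring. lra. apply C1_nz. rewrite <- Ec. ring.
Qed.

Lemma hexagonal_at_zero (c c2 x1 : C) : c <> 0 -> x1 <> 0 -> 2 * (c * c * c * c2) = - (3 * (x1 * x1)) -> doubly_periodic_solution 0 c2 0 0 x1.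
Proof.
intros Hc Hx Ex. pose proof sqrt3_bounds as B.
assert (H : (-1 < hex_zero <= 1)%R).
{ unfold hex_zero. split; apply (Rmult_lt_reg_r (sqrt 3 + 1)) || apply (Rmult_le_reg_r (sqrt 3 + 1)); try lra;
  unfold Rdiv; rewrite Rmult_assoc, Rinv_l by lra; lra. }
apply (hexagonal_solution hex_zero c (x1 / c)); auto.
- apply Cdiv_nz; auto.
- assert (N : T + 1 <> 0) by (unfold T; rewrite <- RtoC_plus; apply RtoC_neq; lra).
  unfold hex_zero. rewrite RtoC_div, RtoC_minus, RtoC_plus by lra. fold T. field. auto.
- replace (2 * (c * c2)) with (2 * (c * c * c * c2) / (c * c)) by (field; auto). rewrite Ex. field. auto.
- replace (3 * (x1 * x1)) with (- - (3 * (x1 * x1))) by ring. rewrite <- Ex. ring.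
Qed.

(** In each case [V2 = V1' / I'], and [V2^2] is a polynomial in [V1], by
  [u^h + d^h = 1]; half of its derivative gives the constants of the equation. *)
Lemma elliptic_321 : elliptic_urn 3 2 1.
Proof.
urn_case 6%nat by apply (elliptic_case 3 2 1 0 2 0 6 0 1 0 (fun u d => 1 / (d * d)) (fun u d => 2 * (u * u * u) / (d * d * d)) (fun x => x)).
apply (hexagonal_at_one (2 * Ci)). apply Cmult_neq_0. apply C2_nz. apply Ci_nz. ring [Ci_sqr].
Qed.

Lemma elliptic_231 : elliptic_urn 2 3 1.
Proof.
urn_case 6%nat by apply (elliptic_case 2 3 1 2 0 0 6 0 0 2 (fun u d => u * u / (d * d)) (fun u d => 2 / (d * d * d)) (fun x => x)).
apply (hexagonal_at_zero (- (1))). apply Cm1_nz. apply C2_nz. ring.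
Qed.

Lemma elliptic_111 : elliptic_urn 1 1 1.
Proof.
urn_case 3%nat by apply (elliptic_case 1 1 1 1 1 0 6 0 0 1 (fun u d => u / (d * d)) (fun u d => (1 + u * u * u) / (d * d * d)) (fun x => x)).
(* the scale is the real cube root of [- 1 / 4] *)
set (x := Rpower (/ 4) (/ 3)). assert (Hx : (0 < x)%R) by apply exp_pos.
assert (Ex : (x * x * x = / 4)%R).
{ unfold x. rewrite <- !Rpower_plus. replace (/ 3 + / 3 + / 3)%R with 1%R by lra. apply Rpower_1. lra. }
apply (hexagonal_at_zero (RtoC (- x))). apply RtoC_neq; lra. apply C1_nz.
rewrite <- !RtoC_mult, <- RtoC_opp. f_equal. replace (- x * - x * - x)%R with (- (x * x * x))%R by ring. rewrite Ex. field.
Qed.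

Lemma elliptic_312 : elliptic_urn 3 1 2.
Proof.
urn_case 6%nat by apply (elliptic_case 3 1 2 0 2 0 (- (6)) 0 1 0 (fun u d => d * d) (fun u d => - (2 * (u * u * u))) (fun x => / x)).
- apply (hexagonal_at_one 2). apply C2_nz. ring.
- apply C1_nz.
Qed.

Lemma elliptic_132 : elliptic_urn 1 3 2.
Proof.
urn_case 6%nat by apply (elliptic_case 1 3 2 2 0 2 0 8 0 0 (fun u d => u * u / (d * d)) (fun u d => 2 * u / (d * d * (d * d))) (fun x => x)).
apply (hexagonal_inverse_solution 2 (- (1))); try ring. apply C2_nz. apply Cm1_nz.
Qed.

(* [psi] is a rational function of [u^6 = v1^3] *)
Ltac sixth_power :=
  let u := fresh "u" in let Hu := fresh "Hu" in intros u Hu; cbn [Nat.add]; rewrite delta_pow by (auto; lia);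
  replace (u * u * (u * u) * (u * u)) with (u ^ 6) by ring; simpl; auto.

Lemma elliptic_213 : elliptic_urn 2 1 3.
Proof.
urn_case 6%nat by apply (elliptic_case 2 1 3 0 6 0 (- (6)) 0 0 2 (fun u d => u * u) (fun u d => 2 * (d * d * d)) (fun x => 1 / (1 - x * x * x))).
- apply (hexagonal_at_zero 1). apply C1_nz. apply C2_nz. ring.
- replace (1 - 0 * 0 * 0) with (RtoC 1) by ring. apply C1_nz.
- sixth_power.
Qed.

Lemma elliptic_123 : elliptic_urn 1 2 3.
Proof.
urn_case 6%nat by apply (elliptic_case 1 2 3 6 0 2 0 (- (8)) 0 0 (fun u d => u * u) (fun u d => 2 * u * (d * d * d)) (fun x => x * x * x / (1 - x * x * x))).
- apply (hexagonal_inverse_solution (2 * Ci) 1); try ring [Ci_sqr]. apply Cmult_neq_0. apply C2_nz. apply Ci_nz. apply C1_nz.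
- replace (1 - 0 * 0 * 0) with (RtoC 1) by ring. apply C1_nz.
- sixth_power.
Qed.

Lemma sqrt2_C : RtoC (sqrt 2) ^ 2 = 2 /\ RtoC (sqrt 2) <> 0.
Proof.
split; [|apply RtoC_neq, Rgt_not_eq, sqrt_lt_R0; lra].
simpl. rewrite Cmult_1_r, <- RtoC_mult, sqrt_sqrt by lra. reflexivity.
Qed.

Lemma square_at_zero (c c3 : C) : c <> 0 -> c3 * (c * c * (c * c)) = - (2) -> doubly_periodic_solution 0 0 c3 0 1.
Proof.
intros Hc H3. destruct sqrt2_C as [S2 N2].
apply (square_solution 0 c (RtoC (sqrt 2) / c)); auto; try ring [H3].
- lra.
- apply Cdiv_nz; auto.
- replace (c3 * (c * c)) with (c3 * (c * c * (c * c)) / (c * c)) by (field; auto). rewrite H3.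
  field_simplify_eq; auto. cbv beta. ring [S2].
Qed.

Lemma elliptic_211 : elliptic_urn 2 1 1.
Proof.
urn_case 4%nat by apply (elliptic_case 2 1 1 0 1 0 0 2 1 0 (fun u d => 1 / d) (fun u d => u * u / (d * d)) (fun x => x)).
destruct sqrt2_C as [S2 N2].
apply (square_solution 1 1 (Ci * RtoC (sqrt 2))); try ring [Ci_sqr S2]. lra. apply C1_nz. apply Cmult_neq_0; auto using Ci_nz.
Qed.

Lemma one_plus_i : 1 + Ci <> 0 /\ (1 + Ci) ^ 4 = - (4).
Proof. split; [|apply injective_projections; simpl; ring]. intros E. apply (f_equal fst) in E. simpl in E. lra. Qed.

Lemma elliptic_121 : elliptic_urn 1 2 1.
Proof.
urn_case 4%nat by apply (elliptic_case 1 2 1 1 0 0 0 2 0 1 (fun u d => u / d) (fun u d => 1 / (d * d)) (fun x => x)).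
destruct sqrt2_C as [S2 N2], one_plus_i as [N4 H4]. set (z := 1 + Ci) in *.
apply (square_at_zero (z / RtoC (sqrt 2))). { apply Cdiv_nz; auto. } field_simplify_eq; auto. cbv beta. ring [S2 H4].
Qed.

Lemma elliptic_112 : elliptic_urn 1 1 2.
Proof.
urn_case 4%nat by apply (elliptic_case 1 1 2 1 1 0 0 8 0 1 (fun u d => u / (d * d)) (fun u d => (1 + u * u * (u * u)) / (d * d * (d * d))) (fun x => x)).
destruct one_plus_i as [N4 H4]. set (z := 1 + Ci) in *.
apply (square_at_zero (z / 2)). { apply Cdiv_nz; auto using C2_nz. } field_simplify_eq. cbv beta. ring [H4].
Qed.

(** * Arithmetic of the triangles *)

Open Scope nat_scope.

Lemma common_divisor_one a b s d : arith_irreducible (urn_matrix a b s) ->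
  Nat.divide d a -> Nat.divide d b -> Nat.divide d s -> d = 1.
Proof.
intros H [x ->] [y ->] [z ->]. unfold arith_irreducible, urn_matrix in H.
assert (D : (Z.of_nat d | 1)%Z).
{ rewrite <- H. repeat apply Z.gcd_greatest.
  exists (- Z.of_nat x)%Z; lia. exists (Z.of_nat (x + z)); lia. exists (Z.of_nat (y + z)); lia. exists (- Z.of_nat y)%Z; lia. }
apply Z.divide_1_r_nonneg in D; lia.
Qed.

(** The angles [a pi / h], [b pi / h], [s pi / h] of the triangle are unit
  fractions of [pi]. *)
Definition triples : list (nat * nat * nat) :=
  [(1,1,1); (1,1,2); (2,1,1); (1,2,1); (2,3,1); (3,2,1); (1,3,2); (3,1,2); (1,2,3); (2,1,3)].
Definition euclidean_triple (a b s : nat) : Prop := In (a, b, s) triples.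

Ltac list_member := simpl; repeat first [solve [left; repeat f_equal; lia] | right].

Lemma largest_is_sum x y z : 0 < y -> 0 < z -> x = y + z ->
  Nat.divide y (x + z) -> Nat.divide z (x + y) -> y = 2 * z \/ y = z \/ z = 2 * y.
Proof.
intros Hy Hz -> [n Hn] [k Hk].
assert (Hn1 : 1 < n) by (destruct n as [|[|n]]; nia).
assert (Hk1 : 1 < k) by (destruct k as [|[|k]]; nia).
assert (E1 : 2 * z = (n - 1) * y) by nia.
assert (E2 : 2 * y = (k - 1) * z) by nia.
assert (E : (n - 1) * (k - 1) = 4).
{ apply (Nat.mul_cancel_r _ _ (y * z)). nia. nia. }
assert (n - 1 <= 4) by nia.
assert (n - 1 = 1 \/ n - 1 = 2 \/ n - 1 = 3 \/ n - 1 = 4) as [X|[X|[X|X]]] by lia; rewrite X in *; lia.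
Qed.

Ltac scale H d x y z := assert (d = 1) by (apply (H d x y z); lia); list_member.

(** Three unit fractions of sum [1] are all equal to [1 / 3], or the largest one
  is [1 / 2], the sum of the other two. *)
Lemma euclidean_triangles a b s : tenable a b s -> arith_irreducible (urn_matrix a b s) ->
  Nat.divide s (a + b) -> euclidean_triple a b s.
Proof.
intros [Ha [Hb [Hs [D1 D2]]]] Hirr D3.
assert (Sum : (a = b /\ b = s) \/ a = b + s \/ b = a + s \/ s = a + b).
{ destruct D1 as [m Hm], D2 as [n Hn], D3 as [k Hk].
  assert (m = 1 \/ m = 2 \/ 3 <= m) as [->|[->|]] by nia; try lia;
  assert (n = 1 \/ n = 2 \/ 3 <= n) as [->|[->|]] by nia; try lia;
  assert (k = 1 \/ k = 2 \/ 3 <= k) as [->|[->|]] by nia; try lia; nia. }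
assert (Scale : forall d x y z, a = x * d -> b = y * d -> s = z * d -> d = 1).
{ intros d x y z E1 E2 E3. apply (common_divisor_one a b s d Hirr); [exists x | exists y | exists z]; auto. }
unfold euclidean_triple, triples. destruct Sum as [[E1 E2]|[E|[E|E]]].
- scale Scale s 1 1 1.
- destruct (largest_is_sum a b s Hb Hs E D2 D3) as [F|[F|F]].
  + scale Scale s 3 2 1.
  + scale Scale s 2 1 1.
  + scale Scale b 3 1 2.
- rewrite Nat.add_comm in D3. destruct (largest_is_sum b a s Ha Hs E D1 D3) as [F|[F|F]].
  + scale Scale s 2 3 1.
  + scale Scale s 1 2 1.
  + scale Scale a 1 3 2.
- rewrite Nat.add_comm in D1, D2. destruct (largest_is_sum s a b Ha Hb E D1 D2) as [F|[F|F]].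
  + scale Scale b 2 1 3.
  + scale Scale b 1 1 2.
  + scale Scale a 1 2 3.
Qed.

Ltac triple_cases H :=
  unfold euclidean_triple, triples in H; simpl in H;
  repeat (destruct H as [H|H]; [try discriminate H; injection H; intros; subst|]); [.. | contradiction].

Lemma represented_triple a b s : represented (urn_matrix a b s) [matA; matB; matC; matD; matE; matF] ->
  euclidean_triple a b s.
Proof.
intros H. unfold represented, exchange_colors, urn_matrix, matA, matB, matC, matD, matE, matF in H. simpl In in H.
unfold euclidean_triple, triples.
repeat match type of H with _ \/ _ => destruct H as [H|H] end; try contradiction;
injection H as E1 E2 E3 E4; list_member.
Qed.

Lemma triple_tenable a b s : euclidean_triple a b s ->
  tenable a b s /\ arith_irreducible (urn_matrix a b s).
Proof.
intros H. triple_cases H; (split; [|reflexivity]); unfold tenable; (repeat split; try lia);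
 match goal with |- Nat.divide ?x ?y => exists (y / x); reflexivity end.
Qed.

Lemma triple_elliptic a b s : euclidean_triple a b s -> elliptic_urn a b s.
Proof.
intros H. triple_cases H; auto using elliptic_111, elliptic_112, elliptic_211, elliptic_121, elliptic_231, elliptic_321,
  elliptic_132, elliptic_312, elliptic_123, elliptic_213.
Qed.

Lemma elliptic_classification a b s a0 b0 : tenable a b s -> arith_irreducible (urn_matrix a b s) ->
  tenable_init a b a0 b0 -> elliptic_from a b s a0 b0 ->
  euclidean_triple a b s \/ ((a, b, s) = (1, 1, 4) /\ a0 = b0).
Proof.
intros T Hirr [_ [_ Ht]] Hell. assert (T' := T). destruct T' as [Ha [Hb [Hs [D1 D2]]]].
destruct (elliptic_divisibility a b s a0 b0 Ha Hb Hs Ht Hell) as [D|[E0 [Eab D]]].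
- left. apply euclidean_triangles; auto. apply (Nat.divide_add_cancel_r s s (a + b)). apply Nat.divide_refl.
  rewrite Nat.add_comm. exact D.
- subst b b0. assert (a = 1).
  { apply (common_divisor_one a a s); auto; try apply Nat.divide_refl.
    apply (Nat.divide_add_cancel_r a a s); auto. apply Nat.divide_refl. }
  subst a. assert (D4 : Nat.divide s 4).
  { apply (Nat.divide_add_cancel_r s (2 * s) 4). exists 2; reflexivity.
    replace (2 * s + 4) with (2 * (1 + 1 + s)) by lia. exact D. }
  assert (s <= 4) by (apply Nat.divide_pos_le; auto; lia). destruct D4 as [k Hk].
  assert (s = 4 \/ s <> 4) as [->|N] by lia. { right. auto. }
  left. unfold euclidean_triple, triples. assert (s = 1 \/ s = 2) as [-> | ->] by (destruct k as [|[|[|[|[|k]]]]]; nia); list_member.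
Qed.

Lemma balance_one_triple a b : tenable a b 1 -> euclidean_triple a b 1.
Proof.
intros T. apply euclidean_triangles; auto; [|apply Nat.divide_1_l].
unfold arith_irreducible, urn_matrix.
assert (D : forall x y g : Z, (x + y = 1 -> 0 <= g -> Z.gcd (Z.gcd x y) g = 1)%Z); [|apply D; [lia | apply Z.gcd_nonneg]].
intros x y g E Hg. assert (H : (Z.gcd (Z.gcd x y) g | 1)%Z).
{ rewrite <- E. apply Z.divide_add_r; (eapply Z.divide_trans; [apply Z.gcd_divide_l|]).
  apply Z.gcd_divide_l. apply Z.gcd_divide_r. }
apply Z.divide_1_r_nonneg in H; auto. apply Z.gcd_nonneg.
Qed.

(** [a] and [b] have the same parity, since an even one divides the other one
  plus an even number, and they are not both even. *)
Lemma balance_two_triple a b : tenable a b 2 -> arith_irreducible (urn_matrix a b 2) -> euclidean_triple a b 2.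
Proof.
intros T Hirr. apply euclidean_triangles; auto. destruct T as [Ha [Hb [_ [D1 D2]]]].
assert (P : forall x, Nat.divide 2 x \/ exists k, x = 2 * k + 1).
{ intros x. destruct (Nat.Even_or_Odd x) as [[k E]|[k E]]. left; exists k; lia. right; exists k; lia. }
destruct (P a) as [Ea|[k Ea]], (P b) as [Eb|[j Eb]].
- exfalso. assert (2 = 1); [|lia]. apply (common_divisor_one a b 2); auto. apply Nat.divide_refl.
- exfalso. assert (Nat.divide 2 (b + 2)) as [x Hx] by (eapply Nat.divide_trans; eauto). lia.
- exfalso. assert (Nat.divide 2 (a + 2)) as [x Hx] by (eapply Nat.divide_trans; eauto). lia.
- exists (k + j + 1). lia.
Qed.

Close Scope nat_scope.

Theorem theorem4 :
  (* balance 1 *)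
  (forall a b : nat,
     tenable a b 1 <-> represented (urn_matrix a b 1) [matA; matB; matC]) /\
  (forall a b : nat, tenable a b 1 -> elliptic_urn a b 1) /\
  (* balance 2 *)
  (forall a b : nat,
     (tenable a b 2 /\ arith_irreducible (urn_matrix a b 2)) <->
     represented (urn_matrix a b 2) [matD; matE]) /\
  (forall a b : nat,
     tenable a b 2 -> arith_irreducible (urn_matrix a b 2) ->
     elliptic_urn a b 2) /\
  (* balance 3 *)
  (forall a b : nat,
     (tenable a b 3 /\ arith_irreducible (urn_matrix a b 3) /\
      elliptic_urn a b 3) <->
     represented (urn_matrix a b 3) [matF]) /\
  (* classification *)
  (forall M : mat2, In M [matA; matB; matC; matD; matE; matF] ->
     exists a b s : nat,
       M = urn_matrix a b s /\ tenable a b s /\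
       arith_irreducible M /\ elliptic_urn a b s) /\
  (forall a b s a0 b0 : nat,
     tenable a b s -> arith_irreducible (urn_matrix a b s) ->
     tenable_init a b a0 b0 -> elliptic_from a b s a0 b0 ->
     represented (urn_matrix a b s) [matA; matB; matC; matD; matE; matF] \/
     (urn_matrix a b s = matG /\ a0 = b0)).
Proof.
assert (Sub : forall M l, incl l [matA; matB; matC; matD; matE; matF] -> represented M l ->
  represented M [matA; matB; matC; matD; matE; matF]).
{ intros M l I [H|H]; [left|right]; apply I; auto. }
assert (Back : forall a b s l, incl l [matA; matB; matC; matD; matE; matF] -> represented (urn_matrix a b s) l ->
  tenable a b s /\ arith_irreducible (urn_matrix a b s) /\ elliptic_urn a b s).
{ intros a b s l I H. assert (X : euclidean_triple a b s) by (apply represented_triple, (Sub _ l); auto).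
  destruct (triple_tenable a b s X). auto using triple_elliptic. }
split; [|split; [|split; [|split; [|split; [|split]]]]].
- intros a b. split.
  + intros T. apply balance_one_triple in T. triple_cases T; unfold represented; simpl; auto 20.
  + intros R. apply (Back a b 1%nat [matA; matB; matC] ltac:(intros x; simpl; tauto) R).
- intros a b T. apply triple_elliptic, balance_one_triple, T.
- intros a b. split.
  + intros [T H]. assert (X := balance_two_triple a b T H). triple_cases X; unfold represented; simpl; auto 20.
  + intros R. destruct (Back a b 2%nat [matD; matE] ltac:(intros x; simpl; tauto) R) as [T [H _]]. auto.
- intros a b T H. apply triple_elliptic, balance_two_triple; auto.
- intros a b. split.
  + intros [T [H [a0 [b0 [I E]]]]]. destruct (elliptic_classification a b 3 a0 b0 T H I E) as [X|[X _]]; [|discriminate X].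
    triple_cases X; unfold represented; simpl; auto 20.
  + intros R. apply (Back a b 3%nat [matF] ltac:(intros x; simpl; tauto) R).
- intros M HM. assert (W : exists a b s, M = urn_matrix a b s).
  { simpl in HM. destruct HM as [<-|[<-|[<-|[<-|[<-|[<-|[]]]]]]];
    [exists 2%nat, 3%nat, 1%nat | exists 1%nat, 2%nat, 1%nat | exists 1%nat, 1%nat, 1%nat
    | exists 1%nat, 1%nat, 2%nat | exists 1%nat, 3%nat, 2%nat | exists 1%nat, 2%nat, 3%nat]; reflexivity. }
  destruct W as [a [b [s ->]]]. exists a, b, s. split; auto. apply (Back a b s _ (fun x H => H)). left. exact HM.
- intros a b s a0 b0 T H I E. destruct (elliptic_classification a b s a0 b0 T H I E) as [X|[X ->]].
  + left. triple_cases X; unfold represented; simpl; auto 20.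
  + right. injection X as -> -> ->. split; reflexivity.
Qed.
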